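(* Let $\tau : \mathbb{S}^2 \to \mathbb{S}^2$ be a conformal map and $u \in H^1(\mathbb{S}^2)$. Define $$u_{\tau}:=u\circ \tau +\psi_{\tau},\qquad \psi_{\tau}(\omega)=\frac{3}{4}\ln \mathcal{J}_{\tau}(\omega)+c_{\tau},\qquad c_\tau=-\frac12\ln\int_{\mathbb{S}^2}\mathcal{J}_\tau^{\frac32}\,d\omega .$$ Then $$I_{\frac{2}{3}}(u_{\tau})=I_{\frac{2}{3}}(u).$$
   Context: $\mathbb{S}^2\subset\mathbb{R}^3$ is the unit sphere with the round metric, $\nabla_{\mathbb{S}^2}$ its gradient, $d\omega$ the normalized surface measure (total mass $1$), and $H^1(\mathbb{S}^2)$ the Sobolev space of square-integrable real functions with square-integrable gradient. For $u\in H^1(\mathbb{S}^2)$, $$I_{\frac23}(u)=\frac23\int_{\mathbb{S}^2}|\nabla_{\mathbb{S}^2}u|^2\,d\omega+2\int_{\mathbb{S}^2}u\,d\omega-\frac12\ln\left[\left(\int_{\mathbb{S}^2}e^{2u}\,d\omega\right)^2-\sum_{i=1}^3\left(\int_{\mathbb{S}^2}\omega_i e^{2u}\,d\omega\right)^2\right].$$ A conformal map $\tau:\mathbb{S}^2\to\mathbb{S}^2$ is an angle-preserving diffeomorphism, possibly orientation reversing; equivalently, via stereographic projection, a map of the form $z\mapsto\frac{az+b}{cz+d}$ with $a,b,c,d\in\mathbb{C}$, $ad-bc=1$, or such a map precomposed with $z\mapsto\bar z$. Its Jacobian $\mathcal{J}_\tau(p)$ is the area distortion factor $\lim_{r\to0}\sigma(\tau(B(p,r)))/\sigma(B(p,r))$,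 where $\sigma$ is surface area and $B(p,r)$ the geodesic ball. *)

(* Defs.v *)
From HB Require Import structures.
From mathcomp Require Import all_boot all_order all_algebra.
From mathcomp Require Import all_classical all_reals all_analysis ring.
From mathcomp Require Import measurable_realfun.
From mathcomp Require Import complex.

Set Implicit Arguments.
Unset Strict Implicit.
Unset Printing Implicit Defensive.

Import Order.TTheory GRing.Theory Num.Theory.
Import numFieldNormedType.Exports.

Local Open Scope classical_set_scope.
Local Open Scope ring_scope.

Notation R3 R := (R * R * R)%type.

Section SurfaceMeasure.
Context {R : realType}.

Definition coord3 (x : R3 R) (i : 'I_3) : R := [:: x.1.1; x.1.2; x.2]`_i.

Definition std_basis (i : 'I_3) : R3 R :=
  ((i == 0%N :> nat)%:R, (i == 1%N :> nat)%:R, (i == 2%N :> nat)%:R).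

Definition dot (x y : R3 R) : R := \sum_(i < 3) coord3 x i * coord3 y i.

(* Functions on the sphere and maps of the sphere are represented by functions
   on R^3; only their values on S2 matter. *)
Definition S2 : set (R3 R) := [set x | dot x x = 1].

(* Cylindrical coordinates X(phi, z).  Since |X_phi x X_z| = 1, the area element
   of the unit sphere in these coordinates is dphi dz; the poles and the
   meridian where X fails to be a chart have area zero. *)
Definition cylindrical (p : R * R) : R3 R :=
  (Num.sqrt (1 - p.2 ^+ 2) * cos p.1, Num.sqrt (1 - p.2 ^+ 2) * sin p.1, p.2).

Lemma measurable_cylindrical : measurable_fun setT cylindrical.
Proof.
have ms : measurable_fun setT (fun p : R * R => Num.sqrt (1 - p.2 ^+ 2)).
  apply: measurableT_comp.
    by apply: continuous_measurable_fun; exact: sqrt_continuous.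
  by apply: measurable_funB => //; apply: measurable_funX; exact: measurable_snd.
have mc : measurable_fun setT (fun p : R * R => cos p.1).
  apply: measurableT_comp; last exact: measurable_fst.
  by apply: continuous_measurable_fun; exact: continuous_cos.
have msi : measurable_fun setT (fun p : R * R => sin p.1).
  apply: measurableT_comp; last exact: measurable_fst.
  by apply: continuous_measurable_fun; exact: continuous_sin.
apply: measurable_fun_pair; last exact: measurable_snd.
by apply: measurable_fun_pair; exact: measurable_funM.
Qed.

Definition coord_domain : set (R * R) := `[0, 2 * pi] `*` `[-1, 1].

Lemma measurable_coord_domain : measurable coord_domain.
Proof. by apply: measurableX. Qed.

Definition area : set (R3 R) -> \bar R :=
  pushforward (mrestr (lebesgue_measure \x lebesgue_measure)%E
    measurable_coord_domain) cylindrical.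

Let area0 : area set0 = 0%E.
Proof. by rewrite /area /pushforward preimage_set0 measure0. Qed.

Let area_ge0 A : (0 <= area A)%E.
Proof. by apply: measure_ge0; exact: measurable_cylindrical. Qed.

Let area_sigma_additive : semi_sigma_additive area.
Proof. apply: measure_semi_sigma_additive; exact: measurable_cylindrical. Qed.

HB.instance Definition _ :=
  isMeasure.Build _ _ _ area area0 area_ge0 area_sigma_additive.

Fact inv4pi_ge0 : 0 <= (4 * pi)^-1 :> R.
Proof. by rewrite invr_ge0 mulr_ge0 // pi_ge0. Qed.

Definition domega : {measure set (R3 R) -> \bar R} :=
  mscale (NngNum inv4pi_ge0) area.

Lemma domega_S2 : domega S2 = 1%E.
Proof.
rewrite /domega /= /mscale /= /area /pushforward /mrestr.
have -> : cylindrical @^-1` S2 `&` coord_domain = coord_domain.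
  apply/seteqP; split => [x []//|[t z] [tD zD]]; split => //=.
  rewrite /S2 /= /dot !big_ord_recl big_ord0 /coord3 /=.
  move: zD; rewrite /= in_itv /= => /andP[z1 z2].
  have z2' : 0 <= 1 - z ^+ 2.
    by rewrite subr_ge0 -[z ^+ 2]real_normK ?num_real// expr_le1// ler_norml z1.
  have := sqr_sqrtr z2'; have := cos2Dsin2 t.
  set s := Num.sqrt _ => e2 e1.
  transitivity (s ^+ 2 * (cos t ^+ 2 + sin t ^+ 2) + z ^+ 2); last
    by rewrite e2 mulr1 e1 subrK.
  by rewrite -/s; ring.
rewrite /coord_domain product_measure1E//=.
have L (a b : R) :
    lebesgue_measure (`[a, b]%classic : set R) = (if a < b then (b - a)%:E else 0%E)
  by rewrite lebesgue_measure_itv /= lte_fin EFinB.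
rewrite (L 0 (2 * pi)) (L (-1) 1).
have pi0 := @pi_gt0 R.
rewrite mulr_gt0// gtrN//.
rewrite -!EFinM; congr EFin.
by move: pi0; move: pi => p p0; field; rewrite gt_eqF.
Qed.

End SurfaceMeasure.

Section Sobolev.
Context {R : realType}.
Implicit Types (u : R3 R -> R) (V X : R3 R -> R3 R).

(* A C^1 tangent field of S2, given by an extension that is C^1 near S2. *)
Definition C1_tangent_field X : Prop :=
  (forall p, S2 p -> dot p (X p) = 0) /\
  (forall p, S2 p -> \forall x \near p,
     differentiable X x /\ forall v, {for x, continuous ('D_v X)}).

(* trace of DX(x) over the tangent plane at x, i.e. tr DX(x) - <x, DX(x) x> *)
Definition sphere_div X (x : R3 R) : R :=
  \sum_(i < 3) coord3 ('D_(std_basis i) X x) i - dot x ('D_x X x).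

Definition is_weak_gradient u V : Prop :=
  [/\ measurable_fun S2 V,
      domega.-integrable S2 (fun x => (dot (V x) (V x))%:E),
      (forall x, S2 x -> dot x (V x) = 0) &
      (forall X, C1_tangent_field X ->
         \int[domega]_(x in S2) dot (V x) (X x) =
         - \int[domega]_(x in S2) (u x * sphere_div X x))].

Definition H1 u : Prop :=
  [/\ measurable_fun S2 u,
      domega.-integrable S2 (fun x => (u x ^+ 2)%:E) &
      exists V, is_weak_gradient u V].

(* A weak gradient is unique up to a set of measure zero, so the energy below
   does not depend on the choice made by xget. *)
Definition gradient u : R3 R -> R3 R := xget (fun=> 0) (is_weak_gradient u).

Definition I23 u : R :=
  2 / 3 * \int[domega]_(x in S2) dot (gradient u x) (gradient u x)
  + 2 * \int[domega]_(x in S2) u x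
  - 2^-1 * ln ((\int[domega]_(x in S2) expR (2 * u x)) ^+ 2
      - \sum_(i < 3)
          (\int[domega]_(x in S2) (coord3 x i * expR (2 * u x))) ^+ 2).

End Sobolev.

Section Conformal.
Context {R : realType}.
Local Notation C := R[i].
Local Open Scope complex_scope.

(* Projection from the north pole (0, 0, 1) to the Riemann sphere, which is
   [option C] with [None] the point at infinity. *)
Definition stereographic (x : R3 R) : option C :=
  if x.2 == 1 then None
  else Some ((x.1.1 / (1 - x.2)) +i* (x.1.2 / (1 - x.2))).

Definition mobius (a b c d : C) (w : option C) : option C :=
  match w with
  | None => if c == 0 then None else Some (a / c)
  | Some z =>
      if c * z + d == 0 then None else Some ((a * z + b) / (c * z + d))
  end.

Definition conformal (tau : R3 R -> R3 R) : Prop :=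
  (forall x, S2 x -> S2 (tau x)) /\
  exists a b c d : C, a * d - b * c = 1 /\
    ((forall x, S2 x ->
        stereographic (tau x) = mobius a b c d (stereographic x)) \/
     (forall x, S2 x -> stereographic (tau x) =
        mobius a b c d (omap (@conjc R) (stereographic x)))).

Definition geodesic_ball (p : R3 R) (r : R) : set (R3 R) :=
  [set q | S2 q /\ acos (dot p q) < r].

(* the Jacobian J_tau *)
Definition area_distortion (tau : R3 R -> R3 R) (p : R3 R) : R :=
  lim (fine (area (tau @` geodesic_ball p r)) / fine (area (geodesic_ball p r))
       @[r --> 0^'+]).

Definition c_conf (tau : R3 R -> R3 R) : R :=
  - 2^-1 *
    ln (\int[domega]_(x in S2) (area_distortion tau x `^ (3 / 2))).

Definition psi_conf (tau : R3 R -> R3 R) (x : R3 R) : R :=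
  3 / 4 * ln (area_distortion tau x) + c_conf tau.

Definition conf_transform (tau : R3 R -> R3 R) (u : R3 R -> R) (x : R3 R) : R :=
  u (tau x) + psi_conf tau x.

End Conformal.

(* Main.v *)
Require Import Defs.
From HB Require Import structures.
From mathcomp Require Import all_boot all_order all_algebra.
From mathcomp Require Import all_classical all_reals all_analysis ring lra.
From mathcomp Require Import measurable_realfun complex.
Set Implicit Arguments.
Unset Strict Implicit.
Unset Printing Implicit Defensive.
Import Order.TTheory GRing.Theory Num.Theory.
Import numFieldNormedType.Exports.
Local Open Scope classical_set_scope.
Local Open Scope ring_scope.

(* A conformal map of the sphere is the projective action x |-> (n + M x) / ell(x),
   ell(x) = a + l.x, of a Lorentz matrix [[a, l], [n, M]], and its Jacobian is
   ell^-2, so psi = -(3/2) ln ell + c.  Pulling test fields back through the map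
   (a Piola transform) gives the change of variables formula and the weak gradient
   of u o tau; the Dirichlet energy is invariant, and its cross term with grad psi
   is found by testing against the field grad ln ell, whose divergence is
   ell^-2 - 1.  The remaining constants cancel because ln ell has the same mean for
   a Lorentz matrix and for its inverse (they differ by a rotation).  The moments
   of e^(2 u_tau) against 1, x1, x2, x3 are e^(2c) times the inverse Lorentz matrix
   applied to those of e^(2u), so the quadratic form in the logarithm is only
   multiplied by e^(4c).

   Since integrals of non-integrable functions have junk values, the integrability
   of e^(2u) has to be proved.  Testing the weak gradient V with the fields whose
   divergence is a Poisson kernel minus 1 yields, almost everywhere,
   |u(y) - mean u| <= int |V(x)| rho^(-1/2) dx, with rho = (1 - x.y) / 2.
   Splitting at rho = e^(-8n), the far part is at most C + n/2 by the arithmetic-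
   geometric mean inequality, and the near part at most
   e^(-2n) int |V(x)| rho^(-3/4) dx; taking n close to |u(y) - mean u| bounds
   e^(2u) by an integrable function. *)

(** * Borel sets of R^3 and measurability of continuous functions *)

Section OpenMeasurable.
Context {R : realType}.

(** Everything rests on the divergence theorem. The area measure is given only through cylindrical
    coordinates, in which a conformal map has no convenient form, so the change of variables is not
    computed in a chart: it is extracted from vanishing integrals of divergences, via Poisson
    kernels and the separation of measures by continuous functions. Lorentz matrices replace Mobius
    maps because they turn every pointwise identity into a polynomial one modulo L eta L^T = eta and
    L^T eta L = eta, and because they cover orientation reversing maps as well.

    The exponents fit as follows. In e^(2 u_tau) the function psi contributes ell^-3: two powers are
    the Jacobian, and the third is ell of the inverse matrix at the image point. Against 1, x1, x2,
    x3 it produces affine functions, so the moments transform linearly. In the energy, 2/3 times the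
    factor 3 of the cross term matches the 2 in front of the mean, 2/3 times 9/2 offsets 2 times the
    3/2 in the mean of psi, and 2c is offset by half of 4c. *)

Lemma open_measurable3 (U : set (R3 R)) : open U -> measurable U.
Proof.
move=> oU.
(* Boxes with rational centre and radius [1 / (n + 1)]: products of measurable intervals, and
   countably many of them. *)
pose B (t : rat * rat * rat * nat) : set (R3 R) :=
  [set x | [/\ `|ratr t.1.1.1 - x.1.1| < t.2.+1%:R^-1,
    `|ratr t.1.1.2 - x.1.2| < t.2.+1%:R^-1 &
    `|ratr t.1.2 - x.2| < t.2.+1%:R^-1] ].
have mB t : measurable (B t).
  pose b (q : rat) := [set z : R | `|ratr q - z| < t.2.+1%:R^-1].
  have mb q : measurable (b q).
    have -> : b q = ball (ratr q : R) t.2.+1%:R^-1 by apply/seteqP; split.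
    exact: measurable_ball.
  have -> : B t = (b t.1.1.1 `*` b t.1.1.2) `*` b t.1.2.
    by apply/seteqP; split => [z [] //|z [[]]//].
  by apply: measurableX => //; exact: measurableX.
have -> : U = \bigcup_t (if pselect (B t `<=` U) then B t else set0).
  apply/seteqP; split => [x Ux|x [t _]]; last first.
    by case: pselect => // h /h.
  have [e /= e0 eU] : exists2 e : R, 0 < e & ball x e `<=` U.
    by have /nbhs_ballP[e /= e0 h] := open_nbhs_nbhs (conj oU Ux); exists e.
  (* A box of radius [d] whose centre is within [d] of [x] contains [x] and stays within [d + d] of
     it; hence the bound [2 / e] on the index. *)
  pose N := `|Num.ceil (2 / e)|%N.
  pose d : R := N.+1%:R^-1.
  have d0 : 0 < d by rewrite invr_gt0.
  have de : d + d <= e.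
    have : 2 / e <= N.+1%:R.
      rewrite (le_trans (Num.Theory.ceil_ge _))// (@le_trans _ _ N%:R)// ?ler_nat//.
      by rewrite /N natr_absz ler_int ler_norm.
    move=> h; rewrite -mulr2n -mulr_natl -ler_pdivlMr ?invr_gt0// invrK.
    by rewrite mulrC -ler_pdivrMr.
  have Q (z : R) : exists q : rat, `|ratr q - z| < d.
    have /rat_in_itvoo[q] : z - d < z + d by rewrite ltrBlDr -addrA ltrDl addr_gt0.
    by rewrite in_itv /= => qz; exists q; rewrite ltr_distl.
  have [q1 h1] := Q x.1.1; have [q2 h2] := Q x.1.2; have [q3 h3] := Q x.2.
  have BU : B (q1, q2, q3, N) `<=` U.
    move=> y [/= k1 k2 k3]; apply: eU.
    have T (a b q : R) : `|q - a| < d -> `|q - b| < d -> `|a - b| < e.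
      move=> ha hb; apply: lt_le_trans de.
      rewrite (_ : a - b = (q - b) - (q - a)); last by ring.
      by rewrite (le_lt_trans (ler_normB _ _))// addrC ltrD.
    by split; [split|]; rewrite /ball /=; [exact: T h1 k1|exact: T h2 k2|exact: T h3 k3].
  by exists (q1, q2, q3, N) => //; rewrite /=; case: pselect => // _; split.
apply: countable_bigcupT_measurable => // t.
by case: (pselect (B t `<=` U)) => [h|h]; [exact: mB|exact: measurable0].
Qed.

(** Continuity is assumed only at the points of [D], so the preimage of an open interval need not be
    open. Its points in [D] are interior to it, however, so after intersection with [D] it may be
    replaced by its interior. *)
Lemma within_continuous_measurable3 (D : set (R3 R)) (f : R3 R -> R) :
  (forall x, D x -> {for x, continuous f}) -> measurable D ->
  measurable_fun D f.
Proof.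
move=> cf mD; apply: (measurability (@RGenOpens.G R)).
  exact: RGenOpens.measurableE.
move=> _ [_ [a [b ->]] <-].

suff -> : D `&` f @^-1` `]a, b[ = D `&` (f @^-1` `]a, b[)^°.
  by apply: measurableI => //; apply: open_measurable3; exact: open_interior.
apply/seteqP; split => x [Dx fx]; split => //; last exact: interior_subset.
by apply: cf => //; apply: open_nbhs_nbhs; split => //.
Qed.

End OpenMeasurable.

(** * Separation of measures on R^3 by bounded continuous functions *)

Section Separation.
Context {R : realType}.

Definition ramp (s : R) : R := Num.min 1 (Num.max 0 s).

Lemma ramp_continuous : continuous ramp.
Proof.
move=> s; apply: (@continuous_min R R (cst 1) (fun s => Num.max 0 s) s).
  exact: cvg_cst.
by apply: (@continuous_max R R (cst 0) id s); [exact: cvg_cst|exact: cvg_id].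
Qed.

Lemma ramp_ge0 s : 0 <= ramp s.
Proof. by rewrite /ramp le_min ler01 le_max lexx. Qed.

Lemma ramp_le1 s : ramp s <= 1.
Proof. by rewrite /ramp ge_min lexx. Qed.

Lemma ramp_cvg s : ramp (n%:R * s) @[n --> \oo] --> ((0 < s)%R%:R : R).
Proof.
have [s0|s0] := ltP 0 s; last first.
  rewrite (_ : (fun n => _) = cst 0); first exact: cvg_cst.
  apply/funext => n; rewrite /ramp /= max_l; first by rewrite min_r.
  by rewrite mulr_ge0_le0.
apply: cvg_near_cst; near=> n.
have h : 1 <= n%:R * s.
  rewrite -ler_pdivrMr // div1r.
  near: n; exact: nbhs_infty_ger.
by rewrite /ramp max_r ?min_l// (le_trans ler01).
Unshelve. all: by end_near. Qed.

Definition corner (a : R3 R) : set (R3 R) :=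
  [set x | [/\ a.1.1 < x.1.1, a.1.2 < x.1.2 & a.2 < x.2]].

(** A half-space [r < x_i] is the union of the corners whose two other bounds are [- n]. The three
    coordinates are therefore measurable for the sigma-algebra generated by the corners, and so is
    the identity map into the Borel sets. *)
Lemma measurable_corners :
  (@measurable _ (R3 R)) = <<s range corner >>.
Proof.
apply/seteqP; split; last first.
  apply: smallest_sub; first exact: sigma_algebra_measurable.
  move=> _ [a _ <-].
  have -> : corner a = (`]a.1.1, +oo[ `*` `]a.1.2, +oo[) `*` `]a.2, +oo[.
    apply/seteqP; split => [x [h1 h2 h3]|x [[]]] /=; rewrite ?in_itv/= ?andbT// => -[].
  by apply: measurableX => //; apply: measurableX.
pose T := g_sigma_algebraType (range corner).
suff m : measurable_fun setT (fun x : T => (x : R3 R)).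
  by move=> A mA; have := m measurableT _ mA; rewrite setTI.
have key (f : T -> R) (c : nat -> R -> R3 R) :
    (forall r, [set x | r < f x] = \bigcup_n corner (c n r)) ->
    measurable_fun setT f.
  move=> h; apply: (measurability (@RGenOInfty.G R)).
    exact: RGenOInfty.measurableE.
  move=> _ [_ [a ->] <-]; rewrite setTI.
  have -> : f @^-1` `]a, +oo[ = [set x | a < f x].
    by apply/seteqP; split => x /=; rewrite in_itv /= andbT.
  rewrite h; apply: bigcupT_measurable => n.
  by apply: sub_gen_smallest; exists (c n a).
have low (z : R) (w : R) : exists n, - n%:R < z /\ - n%:R < w.
  exists (`|Num.ceil `|z| |%N + `|Num.ceil `|w| |%N).+1.
  have H (t : R) k : `|t| <= k%:R -> forall m, (k < m)%N -> - m%:R < t.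
    move=> tk m km; rewrite ltrNl (@le_lt_trans _ _ `|t|)//.
      by rewrite -normrN ler_norm.
    by rewrite (le_lt_trans tk)// ltr_nat.
  have C (t : R) : `|t| <= `|Num.ceil `|t| |%N%:R.
    by rewrite natr_absz (le_trans (Num.Theory.ceil_ge _))// ler_int ler_norm.
  by split; apply: H (C _) _ _; rewrite ltnS ?leq_addr ?leq_addl.
rewrite (_ : (fun x : T => (x : R3 R)) =
    (fun x : T => ((x : R3 R).1.1, (x : R3 R).1.2, (x : R3 R).2))); last first.
  by apply/funext => -[[]].
apply: (@measurable_fun_pair _ _ _ _ _ _ (fun x : T => ((x : R3 R).1.1, (x : R3 R).1.2))
  (fun x : T => (x : R3 R).2)).
  apply: (@measurable_fun_pair _ _ _ _ _ _ (fun x : T => (x : R3 R).1.1)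
    (fun x : T => (x : R3 R).1.2)).
- apply: (key _ (fun n r => (r, - n%:R, - n%:R))) => r.
  apply/seteqP; split => x /=; last by case=> n _ [].
  by move=> rx; have [n [h1 h2]] := low x.1.2 x.2; exists n.
- apply: (key _ (fun n r => (- n%:R, r, - n%:R))) => r.
  apply/seteqP; split => x /=; last by case=> n _ [].
  by move=> rx; have [n [h1 h2]] := low x.1.1 x.2; exists n.
- apply: (key _ (fun n r => (- n%:R, - n%:R, r))) => r.
  apply/seteqP; split => x /=; last by case=> n _ [].
  by move=> rx; have [n [h1 h2]] := low x.1.1 x.1.2; exists n.
Qed.

Lemma corner_setI_closed : setI_closed (range corner).
Proof.
move=> _ _ [a _ <-] [b _ <-].
exists (Num.max a.1.1 b.1.1, Num.max a.1.2 b.1.2, Num.max a.2 b.2) => //.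
apply/seteqP; split => x; rewrite /corner /= !gt_max.
  by move=> [/andP[? ?] /andP[? ?] /andP[? ?]].
by move=> [[? ? ?] [? ? ?]]; split; apply/andP.
Qed.

Definition bump (a : R3 R) n (x : R3 R) : R :=
  ramp (n%:R * (x.1.1 - a.1.1)) * ramp (n%:R * (x.1.2 - a.1.2)) *
  ramp (n%:R * (x.2 - a.2)).

Lemma bump_bound a n x : `|bump a n x| <= 1.
Proof.
rewrite ger0_norm ?mulr_ge0 ?ramp_ge0//.
by rewrite !mulr_ile1 ?mulr_ge0 ?ramp_ge0 ?ramp_le1.
Qed.

Lemma bump_continuous a n : continuous (bump a n).
Proof.
have c11 (x : R3 R) : (y.1.1 : R) @[y --> x] --> x.1.1.
  by apply: (cvg_comp _ fst); [exact: cvg_fst|exact: cvg_fst].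
have c12 (x : R3 R) : (y.1.2 : R) @[y --> x] --> x.1.2.
  by apply: (cvg_comp _ snd); [exact: cvg_fst|exact: cvg_snd].
have c2 (x : R3 R) : (y.2 : R) @[y --> x] --> x.2 by exact: cvg_snd.
have H (g : R3 R -> R) b : continuous g -> continuous (fun x => ramp (n%:R * (g x - b))).
  move=> cg x; apply: (@continuous_comp _ _ _ (fun x => n%:R * (g x - b)) ramp); last exact: ramp_continuous.
  by apply: cvgMr; apply: cvgB; [exact: cg|exact: cvg_cst].
by move=> x; apply: cvgM; [apply: cvgM|]; exact: H.
Qed.

Lemma bump_cvg a x : bump a n x @[n --> \oo] --> (\1_(corner a) x : R).
Proof.
have -> : (\1_(corner a) x : R) = (0 < x.1.1 - a.1.1)%R%:R * (0 < x.1.2 - a.1.2)%R%:R *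
    (0 < x.2 - a.2)%R%:R :> R.
  rewrite !subr_gt0 indicE -!natrM !mulnb; congr (_%:R); congr nat_of_bool.
  apply/idP/idP.
    by rewrite inE => -[-> -> ->].
  by move=> /andP[/andP[h1 h2] h3]; rewrite inE; split.
by apply: cvgM; [apply: cvgM|]; exact: ramp_cvg.
Qed.

Lemma measurable_corner a : measurable (corner a).
Proof. by rewrite measurable_corners; apply: sub_gen_smallest; exists a. Qed.

Context d (T : measurableType d) (mu : {measure set T -> \bar R}).
Local Open Scope ereal_scope.

Lemma corner_limit (Phi : T -> R3 R) (h : T -> R) a :
  measurable_fun setT Phi -> mu.-integrable setT (EFin \o h) ->
  \int[mu]_t (bump a n (Phi t) * h t)%:E @[n --> \oo] -->
  \int[mu]_(t in Phi @^-1` (corner a)) (h t)%:E.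
Proof.
move=> mPhi ih; rewrite integral_mkcond.
have mh : measurable_fun setT h.
  by apply/measurable_EFinP; exact: (measurable_int mu).
have mb n : measurable_fun setT (bump a n).
  by apply: within_continuous_measurable3 => // x _; exact: bump_continuous.
have mA : measurable (Phi @^-1` corner a).
  by rewrite -[X in measurable X]setTI; apply: mPhi => //; exact: measurable_corner.
have [|||||] := @dominated_convergence _ T R mu setT measurableT
  (fun n t => (bump a n (Phi t) * h t)%:E)
  ((fun t => (h t)%:E) \_ (Phi @^-1` corner a)) (fun t => `|(h t)%:E|).
- move=> n; apply/measurable_EFinP; apply: measurable_funM => //.
  exact: measurableT_comp.
- by apply/(measurable_restrictT _ _).1 => //; apply: measurable_funTS; exact/measurable_EFinP.
- apply: aeW => t _; rewrite patchE.
  have -> : (if t \in Phi @^-1` corner a then (h t)%:E else 0) =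
      (\1_(corner a) (Phi t) * h t)%:E.
    rewrite indicE -[t \in _]/(Phi t \in corner a).
    by case: (_ \in _); rewrite ?mul1r ?mul0r.
  have c : (bump a n (Phi t) * h t)%R @[n --> \oo] --> (\1_(corner a) (Phi t) * h t)%R.
    by apply: cvgM; [exact: bump_cvg|exact: cvg_cst].
  by apply/fine_cvgP; split; [exact: nearW|exact: c].
- exact: integrable_abse.
- apply: aeW => t n _ /=; rewrite lee_fin normrM ler_piMl//.
  exact: bump_bound.
- by [].
Qed.

End Separation.

Section Separation2.
Context {R : realType} d (T : measurableType d) (mu : {measure set T -> \bar R}).
Local Open Scope ereal_scope.

(* The corners ]a1, +oo[ x ]a2, +oo[ x ]a3, +oo[ form a pi-system generating the
   Borel sets, and their indicators are limits of products of ramps. *)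
Lemma pushforward_separation (Phi1 Phi2 : T -> R3 R) (h1 h2 : T -> R) :
  measurable_fun setT Phi1 -> measurable_fun setT Phi2 ->
  mu.-integrable setT (EFin \o h1) -> mu.-integrable setT (EFin \o h2) ->
  (forall f : R3 R -> R, continuous f -> (forall x, (`|f x| <= 1)%R) ->
    \int[mu]_t (f (Phi1 t) * h1 t)%:E = \int[mu]_t (f (Phi2 t) * h2 t)%:E) ->
  forall A, measurable A ->
    \int[mu]_(t in Phi1 @^-1` A) (h1 t)%:E =
    \int[mu]_(t in Phi2 @^-1` A) (h2 t)%:E.
Proof.
move=> m1 m2 i1 i2 H A mA.
have mpre (Phi : T -> R3 R) B : measurable_fun setT Phi -> measurable B ->
    measurable (Phi @^-1` B).
  by move=> m mB; rewrite -[X in measurable X]setTI; exact: m.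
have fin h (B : set T) : mu.-integrable setT (EFin \o h) -> measurable B ->
    \int[mu]_(t in B) (h t)%:E \is a fin_num.
  move=> ih mB; apply: integrable_fin_num => //; exact: integrableS ih.
have := mA; rewrite measurable_corners; move: A mA => A0 _.
apply: (dynkin_induction measurable_corners corner_setI_closed
  (P := fun A => \int[mu]_(t in Phi1 @^-1` A) (h1 t)%:E =
    \int[mu]_(t in Phi2 @^-1` A) (h2 t)%:E)).
- have := H (cst 1%R) _ _; rewrite !preimage_setT.
  under eq_integral do rewrite mul1r.
  under [RHS]eq_integral do rewrite mul1r.
  apply; first exact: cst_continuous.
  by move=> x; rewrite normr1.
- move=> _ [a _ <-].
  have := @corner_limit R _ T mu Phi1 h1 a m1 i1.
  have := @corner_limit R _ T mu Phi2 h2 a m2 i2.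
  move=> c2 c1; have E n : \int[mu]_t (bump a n (Phi2 t) * h2 t)%:E =
      \int[mu]_t (bump a n (Phi1 t) * h1 t)%:E.
    by rewrite -H//; [exact: bump_continuous|exact: bump_bound].
  rewrite (funext E) in c2.
  by apply: (cvg_unique _ c1 c2).
(* The densities may change sign, so the integral over a complement is obtained as a difference of
   finite integrals; the totals agree by testing with the constant 1. *)
- move=> S mS E.
  have S1 (Phi : T -> R3 R) h : measurable_fun setT Phi -> mu.-integrable setT (EFin \o h) ->
    \int[mu]_(t in Phi @^-1` (~` S)) (h t)%:E =
    \int[mu]_t (h t)%:E - \int[mu]_(t in Phi @^-1` S) (h t)%:E.
    move=> mP ih.
    have -> : \int[mu]_t (h t)%:E =
        \int[mu]_(t in Phi @^-1` S `|` Phi @^-1` (~` S)) (h t)%:E.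
      by rewrite -preimage_setU setUv preimage_setT.
    have mh : measurable_fun setT h.
      by apply/measurable_EFinP; exact: (measurable_int mu).
    rewrite integral_setU //.
    + by rewrite addeAC subee ?add0e//; apply: fin => //; exact: mpre.
    + exact: mpre.
    + by apply: mpre => //; exact: measurableC.
    + by apply: measurable_funTS; exact/measurable_EFinP.
    + by apply/disj_setPRL => t; rewrite preimage_setC.
  rewrite !S1// E; congr (_ - _).
  have := H (cst 1%R) _ _.
  under eq_integral do rewrite mul1r.
  under [RHS]eq_integral do rewrite mul1r.
  apply; first exact: cst_continuous.
  by move=> x; rewrite normr1.
- move=> F mF tF E.
  have S1 (Phi : T -> R3 R) h : measurable_fun setT Phi -> mu.-integrable setT (EFin \o h) ->
    \int[mu]_(t in Phi @^-1` (\bigcup_k F k)) (h t)%:E =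
    \sum_(i <oo) \int[mu]_(t in Phi @^-1` (F i)) (h t)%:E.
    move=> mP ih; rewrite preimage_bigcup integral_bigcup//.
    + move=> i j _ _ [t [/= Fi Fj]]; apply: (tF i j) => //.
      by exists (Phi t).
    + by move=> i; exact: mpre.
    + apply: integrableS ih => //; apply: bigcupT_measurable => i; exact: mpre.
  by rewrite !S1//; apply: eq_eseriesr => i _; exact: E.
Qed.

End Separation2.

(** * Continuously differentiable functions on R^3 *)

Section C1.
Context {R : realType}.
Local Notation p1 x := (x.1.1).
Local Notation p2 x := (x.1.2).
Local Notation p3 x := (x.2).

Lemma dotE (x y : R3 R) : dot x y = x.1.1 * y.1.1 + x.1.2 * y.1.2 + x.2 * y.2.
Proof. by rewrite /dot !big_ord_recl big_ord0 /coord3 /= addr0 addrA. Qed.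

(** The regularity clause of [C1_tangent_field]. As a neighbourhood condition, it passes from [p] to
    all nearby points. *)
Definition C1 (W : normedModType R) (f : R3 R -> W) (p : R3 R) : Prop :=
  \forall x \near p, differentiable f x /\ forall v, {for x, continuous ('D_v f)}.

Lemma C1_near (W : normedModType R) (f : R3 R -> W) p :
  C1 f p -> \forall x \near p, C1 f x.
Proof. by move=> /near_join. Qed.

Lemma C1_diff (W : normedModType R) (f : R3 R -> W) p :
  C1 f p -> differentiable f p.
Proof. by move=> /nbhs_singleton[]. Qed.

Lemma C1_cont (W : normedModType R) (f : R3 R -> W) p :
  C1 f p -> f x @[x --> p] --> f p.
Proof. by move=> /C1_diff; exact: differentiable_continuous. Qed.

Lemma C1_dcont (W : normedModType R) (f : R3 R -> W) p v :
  C1 f p -> 'D_v f x @[x --> p] --> 'D_v f p.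
Proof. by move=> /nbhs_singleton[_ c]; exact: c. Qed.
Arguments C1_dcont {W f p} v _.

Lemma near_continuous (W : normedModType R) (f g : R3 R -> W) p :
  (\forall x \near p, f x = g x) -> {for p, continuous g} -> {for p, continuous f}.
Proof.
move=> fg cg; have e := nbhs_singleton fg; rewrite /prop_for /continuous_at e.
apply: cvg_trans cg; apply: near_eq_cvg.
by apply: filterS fg => x ->.
Qed.

(** Continuity at x passes from [df v] to ['D_v f] only if the two agree on a whole neighbourhood of
    x, and this for every x near [p]; that is what [near_join] supplies. *)
Lemma C1_intro (W : normedModType R) (f : R3 R -> W) (df : R3 R -> R3 R -> W) p :
  (\forall x \near p, differentiable f x /\
     (forall v, 'D_v f x = df v x) /\ (forall v, {for x, continuous (df v)})) ->
  C1 f p.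
Proof.
move=> /near_join H; rewrite /C1; apply: filterS H => x H.
have [? [_ c]] := nbhs_singleton H; split => // v.
apply: near_continuous (c v).
by apply: filterS H => y [_ []].
Qed.

Lemma C1_cst (W : normedModType R) (a : W) p : C1 (cst a) p.
Proof.
apply: (C1_intro (df := fun _ _ => 0)); apply: (@nearW _ (nbhs p)) => x.
split; first exact: differentiable_cst.
split => v; first exact: derive_cst.
exact: cst_continuous.
Qed.

Lemma C1D (W : normedModType R) (f g : R3 R -> W) p :
  C1 f p -> C1 g p -> C1 (fun x => f x + g x) p.
Proof.
move=> /C1_near Cf /C1_near Cg.
apply: (C1_intro (df := fun v x => 'D_v f x + 'D_v g x)).
apply: filterS2 Cf Cg => x Cf Cg; have [df dg] := (C1_diff Cf, C1_diff Cg).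
split; first exact: differentiableD.
split => v; first by rewrite -deriveD//; exact: diff_derivable.
exact: (cvgD (C1_dcont v Cf) (C1_dcont v Cg)).
Qed.

Lemma C1N (W : normedModType R) (f : R3 R -> W) p : C1 f p -> C1 (fun x => - f x) p.
Proof.
move=> /C1_near Cf; apply: (C1_intro (df := fun v x => - 'D_v f x)).
apply: filterS Cf => x Cf; have df := C1_diff Cf.
split; first exact: differentiableN.
split => v; first by rewrite -deriveN//; exact: diff_derivable.
exact: (cvgN (C1_dcont v Cf)).
Qed.

Lemma C1B (W : normedModType R) (f g : R3 R -> W) p :
  C1 f p -> C1 g p -> C1 (fun x => f x - g x) p.
Proof. by move=> Cf /C1N; exact: C1D. Qed.

Lemma C1M (f g : R3 R -> R) p : C1 f p -> C1 g p -> C1 (fun x => f x * g x) p.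
Proof.
move=> /C1_near Cf /C1_near Cg.
apply: (C1_intro (df := fun v x => f x * 'D_v g x + g x * 'D_v f x)).
apply: filterS2 Cf Cg => x Cf Cg; have [df dg] := (C1_diff Cf, C1_diff Cg).
split; first exact: differentiableM.
split => v; first by rewrite deriveM//; exact: diff_derivable.
exact: (cvgD (cvgM (C1_cont Cf) (C1_dcont v Cg)) (cvgM (C1_cont Cg) (C1_dcont v Cf))).
Qed.

Lemma C1V (f : R3 R -> R) p : f p != 0 -> C1 f p -> C1 (fun x => (f x)^-1) p.
Proof.
move=> fp0 Cf.
have Nf : \forall x \near p, f x != 0.
  have := C1_cont Cf => /cvgr_neq0; exact.
apply: (C1_intro (df := fun v x => - (f x) ^- 2 * 'D_v f x)).
apply: filterS2 Nf (C1_near Cf) => x fx0 {}Cf; have df := C1_diff Cf.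
split; first exact: differentiableV.
split => v; first by rewrite deriveV//; exact: diff_derivable.
apply: cvgM; last exact: (C1_dcont v Cf).
apply: cvgN; apply: cvgV; first by rewrite expf_neq0.
by apply: cvgM; exact: (C1_cont Cf).
Qed.

Lemma C1_pair (V W : normedModType R) (f : R3 R -> V) (g : R3 R -> W) p :
  C1 f p -> C1 g p -> C1 (fun x => (f x, g x)) p.
Proof.
move=> /C1_near Cf /C1_near Cg.
apply: (C1_intro (df := fun v x => ('D_v f x, 'D_v g x))).
apply: filterS2 Cf Cg => x Cf Cg; have [df dg] := (C1_diff Cf, C1_diff Cg).
split; first exact: differentiable_pair.
split => v.
  rewrite deriveE; last exact: differentiable_pair.
  by rewrite diff_pair// !deriveE.
exact: (cvg_pair (C1_dcont v Cf) (C1_dcont v Cg)).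
Qed.

Lemma derive_fst (V W : normedModType R) (X : R3 R -> V * W) x v : differentiable X x ->
  differentiable (fun y => (X y).1) x /\ 'D_v (fun y => (X y).1) x = ('D_v X x).1.
Proof.
move=> dX; have df : differentiable (fst : V * W -> V) (X x).
  by apply: (linear_differentiable (f := fst)) => z; exact: cvg_fst.
have d1 : differentiable (fun y => (X y).1) x by exact: (differentiable_comp dX df).
split => //; rewrite !deriveE// (diff_comp dX df).
by rewrite (diff_lin (f := fst))//= => z; exact: cvg_fst.
Qed.

Lemma derive_snd (V W : normedModType R) (X : R3 R -> V * W) x v : differentiable X x ->
  differentiable (fun y => (X y).2) x /\ 'D_v (fun y => (X y).2) x = ('D_v X x).2.
Proof.
move=> dX; have df : differentiable (snd : V * W -> W) (X x).
  by apply: (linear_differentiable (f := snd)) => z; exact: cvg_snd.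
have d1 : differentiable (fun y => (X y).2) x by exact: (differentiable_comp dX df).
split => //; rewrite !deriveE// (diff_comp dX df).
by rewrite (diff_lin (f := snd))//= => z; exact: cvg_snd.
Qed.

Lemma C1_fst (V W : normedModType R) (X : R3 R -> V * W) p :
  C1 X p -> C1 (fun x => (X x).1) p.
Proof.
move=> /C1_near CX; apply: (C1_intro (df := fun v x => ('D_v X x).1)).
apply: filterS CX => x CX; have dX := C1_diff CX.
split; first by have [] := derive_fst 0 dX.
split => v; first by have [] := derive_fst v dX.
by apply: (cvg_comp _ fst (C1_dcont v CX)); exact: cvg_fst.
Qed.

Lemma C1_snd (V W : normedModType R) (X : R3 R -> V * W) p :
  C1 X p -> C1 (fun x => (X x).2) p.
Proof.
move=> /C1_near CX; apply: (C1_intro (df := fun v x => ('D_v X x).2)).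
apply: filterS CX => x CX; have dX := C1_diff CX.
split; first by have [] := derive_snd 0 dX.
split => v; first by have [] := derive_snd v dX.
by apply: (cvg_comp _ snd (C1_dcont v CX)); exact: cvg_snd.
Qed.

Lemma differentiable_idR3 (x : R3 R) : differentiable (fun x : R3 R => x) x.
Proof. by apply: (@ex_diff _ _ _ _ _ id); exact: is_diff_id. Qed.

Lemma C1_id p : C1 (fun x : R3 R => x) p.
Proof.
apply: (C1_intro (df := fun v _ => v)); apply: (@nearW _ (nbhs p)) => x.
split; first exact: differentiable_idR3.
split => v; first exact: derive_id.
exact: cst_continuous.
Qed.

Lemma C1_x1 p : C1 (fun x : R3 R => x.1.1) p.
Proof. by do 2 apply: C1_fst; exact: C1_id. Qed.

Lemma C1_x2 p : C1 (fun x : R3 R => x.1.2) p.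
Proof. by apply: C1_snd; apply: C1_fst; exact: C1_id. Qed.

Lemma C1_x3 p : C1 (fun x : R3 R => x.2) p.
Proof. by apply: C1_snd; exact: C1_id. Qed.

Lemma derive_x1 (x v : R3 R) : 'D_v (fun x : R3 R => x.1.1) x = v.1.1.
Proof.
have [d e] := @derive_fst _ _ (fun x : R3 R => x) x v (differentiable_idR3 _).
by have [_ ->] := derive_fst v d; rewrite e derive_id.
Qed.

Lemma derive_x2 (x v : R3 R) : 'D_v (fun x : R3 R => x.1.2) x = v.1.2.
Proof.
have [d e] := @derive_fst _ _ (fun x : R3 R => x) x v (differentiable_idR3 _).
by have [_ ->] := derive_snd v d; rewrite e derive_id.
Qed.

Lemma derive_x3 (x v : R3 R) : 'D_v (fun x : R3 R => x.2) x = v.2.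
Proof.
by have [_ ->] := @derive_snd _ _ (fun x : R3 R => x) x v (differentiable_idR3 _);
  rewrite derive_id.
Qed.

Lemma derive_std (W : normedModType R) (f : R3 R -> W) x v : differentiable f x ->
  'D_v f x = v.1.1 *: 'D_(std_basis 0) f x + v.1.2 *: 'D_(std_basis 1) f x +
    v.2 *: 'D_(std_basis 2) f x.
Proof.
move=> df; rewrite !deriveE// -!linearZ -!linearD; congr ('d f x _).
case: v => -[a b] c; rewrite /std_basis /=.
by apply/pair_equal_spec; split; [apply/pair_equal_spec; split|];
  rewrite /= /GRing.scale /=; ring.
Qed.

Lemma derive_compose (W : normedModType R) (f : R3 R -> W) (s : R3 R -> R3 R) (x v : R3 R) :
  differentiable s x -> differentiable f (s x) ->
  differentiable (fun y => f (s y)) x /\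
  'D_v (fun y => f (s y)) x = 'D_('D_v s x) f (s x).
Proof.
move=> ds df; have d : differentiable (fun y => f (s y)) x by exact: (differentiable_comp ds df).
split; first exact: d.
have e1 : 'D_v (fun y => f (s y)) x = 'd (f \o s) x v := deriveE v d.
have e2 := congr1 (fun h => h v) (diff_comp ds df).
rewrite e1 e2 /=.
have e3 := deriveE v ds.
have e4 := deriveE ('D_v s x) df.
by rewrite e4 e3.
Qed.

(** The chain rule gives ['D_('D_v s x) f (s x)], whose direction moves with [x]. Expanding it over
    [std_basis] leaves three fixed directions, and in these continuity is part of the hypothesis on
    [f]. *)
Lemma C1_compose (W : normedModType R) (f : R3 R -> W) (s : R3 R -> R3 R) p :
  C1 s p -> C1 f (s p) -> C1 (fun x => f (s x)) p.
Proof.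
move=> Cs Cf.
have Cfs : \forall x \near p, C1 f (s x) by exact: (C1_cont Cs (C1_near Cf)).
apply: (C1_intro (df := fun v x => ('D_v s x).1.1 *: 'D_(std_basis 0) f (s x) +
   ('D_v s x).1.2 *: 'D_(std_basis 1) f (s x) + ('D_v s x).2 *: 'D_(std_basis 2) f (s x))).
apply: filterS2 (C1_near Cs) Cfs => x {}Cs {}Cf.
have [ds df] := (C1_diff Cs, C1_diff Cf).
split; first by have [] := derive_compose 0 ds df.
split => v; first by have [_ ->] := derive_compose v ds df; exact: derive_std.
have cD w : 'D_w f (s y) @[y --> x] --> 'D_w f (s x).
  by apply: (cvg_comp s ('D_w f) (C1_cont Cs)); exact: (C1_dcont w Cf).
have c3 : ('D_v s y : R3 R) @[y --> x] --> 'D_v s x by exact: (C1_dcont v Cs).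
have c12 : (('D_v s y).1 : R * R) @[y --> x] --> ('D_v s x).1.
  by apply: (cvg_comp _ fst c3); exact: cvg_fst.
by apply: cvgD; first apply: cvgD; apply: cvgZ => //;
  [apply: (cvg_comp _ fst c12); exact: cvg_fst|
   apply: (cvg_comp _ snd c12); exact: cvg_snd|
   apply: (cvg_comp _ snd c3); exact: cvg_snd].
Qed.

Lemma derive_ln (f : R3 R -> R) x v : 0 < f x -> differentiable f x ->
  'D_v (fun x => ln (f x)) x = (f x)^-1 * 'D_v f x.
Proof.
move=> fx0 df.
have dl : differentiable (@ln R) (f x).
  by apply/derivable1_diffP; have [] := is_derive1_ln fx0.
have dlf : differentiable (fun x => ln (f x)) x by exact: (differentiable_comp df dl).
rewrite deriveE// (diff_comp df dl) /= diff1E//= -deriveE// /GRing.scale /= mulrC.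
by rewrite derive1E; have [_ ->] := is_derive1_ln fx0.
Qed.

Lemma C1_ln (f : R3 R -> R) p : 0 < f p -> C1 f p ->
  C1 (fun x => ln (f x)) p.
Proof.
move=> fp0 Cf.
have Nf : \forall x \near p, 0 < f x.
  by have := C1_cont Cf => /cvgr_gt; apply.
apply: (C1_intro (df := fun v x => (f x)^-1 * 'D_v f x)).
apply: filterS2 Nf (C1_near Cf) => x fx0 {}Cf; have df := C1_diff Cf.
have dl : differentiable (@ln R) (f x).
  by apply/derivable1_diffP; have [] := is_derive1_ln fx0.
have dlf : differentiable (fun x => ln (f x)) x by exact: (differentiable_comp df dl).
split => //; split => v; first exact: derive_ln.
apply: cvgM; last exact: (C1_dcont v Cf).
by apply: cvgV; [rewrite gt_eqF|exact: (C1_cont Cf)].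
Qed.

End C1.

(** * Integration over the sphere in cylindrical coordinates *)

Lemma ge0_integral_mrestr d (T : measurableType d) (R : realType)
    (mu : {measure set T -> \bar R}) (D : set T) (mD : measurable D)
    (f : T -> \bar R) : measurable_fun setT f -> (forall x, (0 <= f x)%E) ->
  (\int[mrestr mu mD]_x f x = \int[mu]_(x in D) f x)%E.
Proof.
move=> mf f0.
rewrite -[X in (integral _ X _)](setUv D) ge0_integral_setU//; last 3 first.
- exact: measurableC.
- by rewrite setUv.
- by apply/disj_setPRL.
rewrite [X in (_ + X)%E]null_set_integral ?adde0//; last 3 first.
- exact: measurableC.
- exact: measurable_funTS.
- by rewrite /= /mrestr setICl measure0.
apply: eq_measure_integral => A mA AD.
by rewrite /= /mrestr; congr (mu _); apply/setIidl.
Qed.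

Section SphereMeasure.
Context {R : realType}.
Local Notation lam := (@lebesgue_measure R).
Local Open Scope ereal_scope.

Lemma measurable_dot (y : R3 R) : measurable_fun setT (fun x : R3 R => dot x y).
Proof.
rewrite (_ : (fun x => _) = (fun x : R3 R => x.1.1 * y.1.1 + x.1.2 * y.1.2 + x.2 * y.2)%R).
  by apply: within_continuous_measurable3 => // x _; apply: C1_cont;
    apply: C1D; [apply: C1D|]; (apply: C1M; last exact: C1_cst);
    [exact: C1_x1|exact: C1_x2|exact: C1_x3].
by apply/funext => x; rewrite dotE.
Qed.

Lemma dot_continuous (f g : R3 R -> R3 R) p : {for p, continuous f} ->
  {for p, continuous g} -> {for p, continuous (fun x => dot (f x) (g x))}.
Proof.
move=> cf cg.
rewrite (_ : (fun x => _) = (fun x : R3 R => (f x).1.1 * (g x).1.1 +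
  (f x).1.2 * (g x).1.2 + (f x).2 * (g x).2)%R); last first.
  by apply/funext => x; rewrite dotE.
have c1 (h : R3 R -> R3 R) : {for p, continuous h} -> (h x).1 @[x --> p] --> (h p).1.
  by move=> c; apply: (cvg_comp _ fst c); exact: cvg_fst.
have c11 (h : R3 R -> R3 R) : {for p, continuous h} -> (h x).1.1 @[x --> p] --> (h p).1.1.
  by move=> c; apply: (cvg_comp _ fst (c1 _ c)); exact: cvg_fst.
have c12 (h : R3 R -> R3 R) : {for p, continuous h} -> (h x).1.2 @[x --> p] --> (h p).1.2.
  by move=> c; apply: (cvg_comp _ snd (c1 _ c)); exact: cvg_snd.
have c2 (h : R3 R -> R3 R) : {for p, continuous h} -> (h x).2 @[x --> p] --> (h p).2.
  by move=> c; apply: (cvg_comp _ snd c); exact: cvg_snd.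
exact: (cvgD (cvgD (cvgM (c11 _ cf) (c11 _ cg)) (cvgM (c12 _ cf) (c12 _ cg)))
  (cvgM (c2 _ cf) (c2 _ cg))).
Qed.

Lemma measurable_S2 : measurable (@S2 R).
Proof.
have -> : @S2 R = setT `&` (fun x => dot x x) @^-1` [set 1%R].
  by rewrite setTI; apply/seteqP; split.
have m : measurable_fun setT (fun x : R3 R => dot x x).
  apply: within_continuous_measurable3 => // x _.
  by apply: dot_continuous; exact: cvg_id.
exact: m.
Qed.
Local Hint Resolve measurable_S2 : core.

Lemma cylindrical_S2 (p : R * R) : coord_domain p -> S2 (cylindrical p).
Proof.
case: p => t z [_ /=]; rewrite in_itv /= => /andP[z1 z2].
rewrite /S2 /= dotE /=.
have z2' : (0 <= 1 - z ^+ 2)%R.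
  by rewrite subr_ge0 -[(z ^+ 2)%R]real_normK ?num_real// expr_le1// ler_norml z1.
have := sqr_sqrtr z2'; have := cos2Dsin2 t.
set s := Num.sqrt _ => e2 e1.
transitivity (s ^+ 2 * (cos t ^+ 2 + sin t ^+ 2) + z ^+ 2)%R; last first.
  by rewrite e2 mulr1 e1 subrK.
by rewrite -/s; ring.
Qed.

Lemma domega_integral (f : R3 R -> \bar R) : measurable_fun setT f ->
  (forall x, 0 <= f x) ->
  \int[domega]_x f x =
  ((4 * pi)^-1)%:E * \int[(lam \x lam)]_(p in coord_domain) f (cylindrical p).
Proof.
move=> mf f0; rewrite /domega ge0_integral_mscale//=; congr (_ * _).
pose m0 := [the {measure set _ -> \bar R} of
  mrestr (lam \x lam) (@measurable_coord_domain R)].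
have f0' : {in [set: R3 R], forall y, 0 <= f y} by move=> y _.
have h mc := @ge0_integral_pushforward _ _ (measurableTypeR R * measurableTypeR R)%type
  (R3 R) R (@cylindrical R) mc m0 setT f measurableT mf f0'.
have {}h := h (@measurable_cylindrical R).
rewrite preimage_setT in h; transitivity (\int[m0]_x (f \o @cylindrical R) x).
  by rewrite -h.
have mfc : measurable_fun setT (f \o @cylindrical R).
  by apply: measurableT_comp => //; exact: measurable_cylindrical.
have h2 := @ge0_integral_mrestr _ (measurableTypeR R * measurableTypeR R)%type R
  (lam \x lam) (@coord_domain R) (@measurable_coord_domain R) (f \o @cylindrical R).
by apply: h2 => // x; exact: f0.
Qed.

(** The coordinates map [coord_domain] into the sphere, so the measure has no mass off it. *)
Lemma domega_setT : domega [set: R3 R] = 1.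
Proof.
have H (A : set (R3 R)) : measurable A -> domega A =
    ((4 * pi)^-1)%:E * \int[lam \x lam]_(p in coord_domain) (\1_A (cylindrical p))%:E.
  move=> mA; rewrite -(domega_integral (f := EFin \o \1_A)).
  - have -> := integral_indic domega measurableT mA; by rewrite setIT.
  - by apply/measurable_EFinP; exact: measurable_indic.
  - by move=> x; rewrite /= lee_fin.
rewrite -[RHS](@domega_S2 R) !H//.
congr (_ * _); apply: eq_integral => p /set_mem pD.
by rewrite !indicE !mem_set//; exact: cylindrical_S2.
Qed.

(** A copy of [domega] that carries the probability structure; products [sph \x sph] and Fubini need
    the sigma-finiteness it provides. *)
Definition sph : set (R3 R) -> \bar R := domega.
HB.instance Definition _ := isMeasure.Build _ _ R sph
  (measure0 domega) (measure_ge0 domega) (@measure_semi_sigma_additive _ _ _ domega).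
Lemma sph_setT : sph setT = 1. Proof. exact: domega_setT. Qed.
HB.instance Definition _ := @Measure_isProbability.Build _ _ R sph sph_setT.

Lemma domega_S2C : domega (~` (@S2 R)) = 0.
Proof.
have h := probability_setC sph measurable_S2.
have e : sph (@S2 R) = 1 := @domega_S2 R.
by apply: (etrans h); rewrite [X in (1 - X)%E](@domega_S2 R) subee//.
Qed.

Lemma domega_integral_fubini (f : R3 R -> \bar R) : measurable_fun setT f ->
  (forall x, 0 <= f x) ->
  \int[domega]_x f x = ((4 * pi)^-1)%:E *
    \int[lam]_(z in `[(-1)%R, 1%R]) \int[lam]_(t in `[0%R, (2 * pi)%R]) f (cylindrical (t, z)).
Proof.
move=> mf f0; rewrite domega_integral//; congr (_ * _).
have mfc : measurable_fun setT (f \o @cylindrical R).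
  by apply: measurableT_comp => //; exact: measurable_cylindrical.
rewrite integral_mkcond fubini_tonelli2; last 2 first.
- apply/(measurable_restrictT _ _).1; first exact: measurable_coord_domain.
  exact: measurable_funTS.
- by move=> p; apply: erestrict_ge0.
rewrite [RHS]integral_mkcond; apply: eq_integral => z _.
rewrite /fubini_G patchE.
case: ifPn => [/set_mem zD|zD]; last first.
  apply: integral0_eq => t _; rewrite patchE memNset// => -[_ /= h].
  by move/negP : zD; apply; rewrite inE.
rewrite [RHS]integral_mkcond; apply: eq_integral => t _; rewrite !patchE.
rewrite (_ : ((t, z) \in coord_domain) = (t \in `[0%R, (2 * pi)%R]%classic))//.
by apply/idP/idP => [/set_mem[? _]|/set_mem h]; apply/mem_set.
Qed.

Lemma integral_S2 (f : R3 R -> \bar R) : measurable_fun setT f ->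
  \int[domega]_(x in S2) f x = \int[domega]_x f x.
Proof.
move=> mf; rewrite -[in RHS](setUv (@S2 R)) integral_setU//; last 3 first.
- exact: measurableC.
- by rewrite setUv.
- by apply/disj_setPRL.
rewrite [X in _ + X]null_set_integral ?adde0//.
- exact: measurableC.
- exact: measurable_funTS.
- exact: domega_S2C.
Qed.

Lemma bounded_integrable_S2 (f : R3 R -> R) (C : R) : measurable_fun S2 f ->
  (forall x, S2 x -> (`|f x| <= C)%R) -> domega.-integrable S2 (EFin \o f).
Proof.
move=> mf fC; apply: measurable_bounded_integrable => //.
  by rewrite [X in X < _](@domega_S2 R) ltry.
exists C; split; first exact: num_real.
by move=> M CM x Sx; apply: (le_trans (fC x Sx)); exact: ltW.
Qed.

Lemma S2_coord_le1 (x : R3 R) : S2 x ->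
  [/\ (`|x.1.1| <= 1)%R, (`|x.1.2| <= 1)%R & (`|x.2| <= 1)%R].
Proof.
rewrite /S2 /= dotE => e.
have H (a : R) : (a * a <= 1)%R -> (`|a| <= 1)%R.
  by move=> a1; rewrite -(@expr_le1 _ 2)// real_normK ?num_real// expr2.
have sq (a : R) : (0 <= a * a)%R by rewrite -expr2 sqr_ge0.
have := (sq x.1.1, sq x.1.2, sq x.2).
by move=> [[? ?] ?]; split; apply: H; lra.
Qed.

Lemma S2_compact : compact (@S2 R).
Proof.
pose B : set (R3 R) := (`[(-1)%R, 1%R]%classic `*` `[(-1)%R, 1%R]%classic) `*` `[(-1)%R, 1%R]%classic.
apply: (@subclosed_compact _ _ B).
- have -> : @S2 R = (fun x => dot x x) @^-1` [set 1%R] by apply/seteqP; split.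
  apply: closed_comp; last exact: closed_eq.
  by move=> x _; apply: dot_continuous; exact: cvg_id.
- apply: compact_setX; last exact: segment_compact.
  by apply: compact_setX; exact: segment_compact.
- move=> x /S2_coord_le1[]; rewrite !ler_norml => a b c.
  by split; [split|]; rewrite /= in_itv.
Qed.

Lemma S2_neq0 : (@S2 R) !=set0.
Proof. by exists (0, 0, 1)%R; rewrite /S2 /= dotE /=; ring. Qed.

Lemma continuous_S2_bounded (f : R3 R -> R) :
  (forall x, S2 x -> {for x, continuous f}) ->
  exists2 C : R, (0 <= C)%R & forall x, S2 x -> (`|f x| <= C)%R.
Proof.
move=> cf.
have cn : {within @S2 R, continuous (fun x => `|f x|%R)}.
  apply: continuous_in_subspaceT => x /set_mem Sx.
  by apply: (@cvg_norm _ _ _ _ _ f (f x)); exact: cf.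
have [c _ h] := compact_EVT_max S2_neq0 S2_compact cn.
by exists `|f c|%R => // x Sx; apply: h; rewrite inE.
Qed.

Lemma continuous_integrable_S2 (f : R3 R -> R) :
  (forall x, S2 x -> {for x, continuous f}) ->
  domega.-integrable S2 (EFin \o f).
Proof.
move=> cf; have [C _ h] := continuous_S2_bounded cf.
by apply: (bounded_integrable_S2 _ h); exact: within_continuous_measurable3.
Qed.

End SphereMeasure.
#[global] Hint Resolve measurable_S2 : core.

Arguments C1_dcont {R W f p} v _.

(** * Curves in the sphere and the tangential divergence *)

Section Curves.
Context {R : realType}.

Lemma is_derive_curve (f : R3 R -> R) (g1 g2 g3 : R -> R) (t w1 w2 w3 : R) :
  is_derive t 1 g1 w1 -> is_derive t 1 g2 w2 -> is_derive t 1 g3 w3 ->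
  differentiable f (g1 t, g2 t, g3 t) ->
  is_derive t 1 (fun s => f (g1 s, g2 s, g3 s))
    ('D_((w1, w2, w3) : R3 R) f (g1 t, g2 t, g3 t)).
Proof.
move=> [d1 e1] [d2 e2] [d3 e3] df.
have D1 : differentiable g1 t by apply/derivable1_diffP; exact: d1.
have D2 : differentiable g2 t by apply/derivable1_diffP; exact: d2.
have D3 : differentiable g3 t by apply/derivable1_diffP; exact: d3.
pose g (s : R) : R3 R := (g1 s, g2 s, g3 s).
have D12 := differentiable_pair D1 D2.
have Dg : differentiable g t by exact: (differentiable_pair D12 D3).
have Dfg : differentiable (f \o g) t by exact: differentiable_comp.
have e : 'D_1 g t = (w1, w2, w3).
  rewrite deriveE// (diff_pair D12 D3) (diff_pair D1 D2) /=.
  by rewrite -e1 -e2 -e3 (deriveE _ D1) (deriveE _ D2) (deriveE _ D3).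
apply: DeriveDef; first by apply: diff_derivable; exact: Dfg.
have -> : 'D_1 (fun s => f (g1 s, g2 s, g3 s)) t = 'd (f \o g) t 1 := deriveE _ Dfg.
rewrite (congr1 (fun h => h 1) (diff_comp Dg df)) /= -(deriveE _ df).
by rewrite -(deriveE _ Dg) e.
Qed.

Definition X1 (X : R3 R -> R3 R) x := (X x).1.1.
Definition X2 (X : R3 R -> R3 R) x := (X x).1.2.
Definition X3 (X : R3 R -> R3 R) x := (X x).2.

Lemma C1_comps (X : R3 R -> R3 R) p : C1 X p -> [/\ C1 (X1 X) p, C1 (X2 X) p & C1 (X3 X) p].
Proof.
by move=> c; split; [apply: C1_fst; exact: C1_fst|apply: C1_snd; exact: C1_fst|exact: C1_snd].
Qed.

Lemma derive_comps (X : R3 R -> R3 R) p v : differentiable X p ->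
  'D_v X p = ('D_v (X1 X) p, 'D_v (X2 X) p, 'D_v (X3 X) p).
Proof.
move=> d; have [d1 e1] := derive_fst v d; have [_ e3] := derive_snd v d.
have [_ e11] := derive_fst v d1; have [_ e12] := derive_snd v d1.
by rewrite /X1 /X2 /X3 e11 e12 e1 e3; case: ('D_v X p) => -[].
Qed.

Local Notation E i := (std_basis i : R3 R).

(** A 3 x 3 matrix is given by its columns [A i], the derivatives of a field along [std_basis];
    [lcomb A v] is then the matrix applied to [v]. *)
Definition trace (A : 'I_3 -> R3 R) : R := (A 0).1.1 + (A 1).1.2 + (A 2).2.
Definition lcomb (A : 'I_3 -> R3 R) (v : R3 R) : R3 R :=
  v.1.1 *: A 0 + v.1.2 *: A 1 + v.2 *: A 2.

Lemma sphere_divE (X : R3 R -> R3 R) x : differentiable X x ->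
  sphere_div X x = let A i := 'D_(E i) X x in trace A - dot x (lcomb A x).
Proof.
move=> d; rewrite /sphere_div [in 'D_x X x](derive_std x d) /=; congr (_ - _).
rewrite !big_ord_recl big_ord0 /= /coord3 /= addr0 addrA /trace.
by congr (_ + _ + _); congr (_ _); congr ('D__ X x); rewrite /std_basis.
Qed.

Lemma lcombE (X : R3 R -> R3 R) x v : differentiable X x ->
  'D_v X x = lcomb (fun i => 'D_(E i) X x) v.
Proof. exact: derive_std. Qed.

Lemma sphere_div_continuous (X : R3 R -> R3 R) p : C1 X p ->
  {for p, continuous (sphere_div X)}.
Proof.
move=> C.
have N : \forall x \near p, sphere_div X x =
    let A i := 'D_(E i) X x in trace A - dot x (lcomb A x).
  by apply: filterS (C1_near C) => x /C1_diff; exact: sphere_divE.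
apply: near_continuous N _.
have c v := C1_dcont v C.
have c12 v : ('D_v X x).1 @[x --> p] --> ('D_v X p).1.
  by apply: (cvg_comp _ fst (c v)); exact: cvg_fst.
have cl : lcomb (fun i => 'D_(E i) X x) x @[x --> p] --> lcomb (fun i => 'D_(E i) X p) p.
  by apply: cvgD; first apply: cvgD; apply: cvgZ => //; apply: C1_cont;
    [exact: C1_x1|exact: C1_x2|exact: C1_x3].
have ct : trace (fun i => 'D_(E i) X x) @[x --> p] --> trace (fun i => 'D_(E i) X p).
  apply: cvgD; first apply: cvgD.
  - by apply: (cvg_comp _ fst (c12 _)); exact: cvg_fst.
  - by apply: (cvg_comp _ snd (c12 _)); exact: cvg_snd.
  - by apply: (cvg_comp _ snd (c _)); exact: cvg_snd.
have cd := @dot_continuous R (fun x => x) (fun x => lcomb (fun i => 'D_(E i) X x) x) p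
  cvg_id cl.
exact: (cvgB ct cd).
Qed.

(** One coordinate of the rational parametrization of a great circle: for a unit vector p, w
    orthogonal to p and k = |w|^2 / 4, the curve has norm 1 for every s, starts at p and has initial
    velocity w. *)
Lemma is_derive_quad (k p w : R) :
  is_derive (0 : R) 1 (fun s => ((1 - k * s ^+ 2) * p + s * w) / (1 + k * s ^+ 2)) w.
Proof.
have n0 : 1 + k * 0 ^+ 2 != 0 :> R by rewrite expr0n /= mulr0 addr0 oner_neq0.
have dV := fun t => @is_deriveV R (fun s : R => 1 + k * s ^+ 2) 0 t 1 n0.
have d1 : is_derive (0:R) 1 (fun s : R => s ^+ 2) 0.
  apply: (is_derive_eq (is_deriveM (is_derive_id (0:R) 1) (is_derive_id (0:R) 1))).
  by rewrite /GRing.scale /= mul0r addr0.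
have d2 : is_derive (0:R) 1 (fun s : R => k * s ^+ 2) 0.
  apply: (is_derive_eq (is_deriveM (is_derive_cst k (0:R) 1) d1)); by rewrite /GRing.scale /= !mulr0 addr0.
have d3 : is_derive (0:R) 1 (fun s : R => 1 + k * s ^+ 2) 0.
  apply: (is_derive_eq (is_deriveD (is_derive_cst (1:R) (0:R) 1) d2)); by rewrite addr0.
have d4 : is_derive (0:R) 1 (fun s : R => 1 - k * s ^+ 2) 0.
  apply: (is_derive_eq (is_deriveB (is_derive_cst (1:R) (0:R) 1) d2)); by rewrite subr0.
have d5 : is_derive (0:R) 1 (fun s : R => (1 - k * s ^+ 2) * p + s * w) w.
  apply: (is_derive_eq (is_deriveD (is_deriveM d4 (is_derive_cst p (0:R) 1))
    (is_deriveM (is_derive_id (0:R) 1) (is_derive_cst w (0:R) 1)))).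
  rewrite /GRing.scale /=; ring.
apply: (is_derive_eq (is_deriveM d5 (dV _ d3))).
rewrite /GRing.scale /=; field.
by [].
Qed.

(** Differentiate [dot x (X x) = 0] along a curve with velocity [w]. The relation holds only on the
    sphere, so the curve must not leave it. *)
Lemma tangent_derive (X : R3 R -> R3 R) p w : C1_tangent_field X -> S2 p ->
  dot p w = 0 -> dot p ('D_w X p) = - dot w (X p).
Proof.
move=> [tX dX] Sp pw; have [C1a C2a C3a] := C1_comps (dX p Sp).
have dXp := C1_diff (dX p Sp).
pose k := dot w w / 4.
pose g p w (s : R) := ((1 - k * s ^+ 2) * p + s * w) / (1 + k * s ^+ 2).
have d1 := is_derive_quad k p.1.1 w.1.1.
have d2 := is_derive_quad k p.1.2 w.1.2.
have d3 := is_derive_quad k p.2 w.2.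
have g0 q v : g q v 0 = q.
  by rewrite /g expr0n /= mulr0 subr0 addr0 mul0r addr0 mul1r divr1.
pose gg s : R3 R := (g p.1.1 w.1.1 s, g p.1.2 w.1.2 s, g p.2 w.2 s).
have gg0 : gg 0 = p by rewrite /gg !g0; case: (p) => -[].
have k0 : 0 <= k by rewrite /k dotE divr_ge0// !addr_ge0 ?sqr_ge0// -expr2 sqr_ge0.
have Sg s : S2 (gg s).
  rewrite /S2 /= dotE /gg /g /=.
  have n0 : 1 + k * s ^+ 2 != 0 by rewrite gt_eqF// ltr_wpDr// mulr_ge0// sqr_ge0.
  have ek : w.1.1 * w.1.1 + w.1.2 * w.1.2 + w.2 * w.2 = 4 * k.
    by rewrite /k dotE; field.
  have := Sp; rewrite /S2 /= dotE => ep; move: pw; rewrite dotE => pw.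
  set D := 1 + k * s ^+ 2; set a := 1 - k * s ^+ 2.
  transitivity ((a ^+ 2 * (p.1.1 * p.1.1 + p.1.2 * p.1.2 + p.2 * p.2) +
    2 * a * s * (p.1.1 * w.1.1 + p.1.2 * w.1.2 + p.2 * w.2) +
    s ^+ 2 * (w.1.1 * w.1.1 + w.1.2 * w.1.2 + w.2 * w.2)) / D ^+ 2).
    by field.
  by rewrite ep pw ek /D /a; field.
have ew : ((w.1.1, w.1.2, w.2) : R3 R) = w by case: (w) => -[].
have D1 : is_derive (0 : R) 1 (fun s => X1 X (gg s)) ('D_w (X1 X) p).
  have := @is_derive_curve (X1 X) _ _ _ _ _ _ _ d1 d2 d3.
  rewrite -/(gg 0) gg0 ew; apply; exact: (C1_diff C1a).
have D2 : is_derive (0 : R) 1 (fun s => X2 X (gg s)) ('D_w (X2 X) p).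
  have := @is_derive_curve (X2 X) _ _ _ _ _ _ _ d1 d2 d3.
  rewrite -/(gg 0) gg0 ew; apply; exact: (C1_diff C2a).
have D3 : is_derive (0 : R) 1 (fun s => X3 X (gg s)) ('D_w (X3 X) p).
  have := @is_derive_curve (X3 X) _ _ _ _ _ _ _ d1 d2 d3.
  rewrite -/(gg 0) gg0 ew; apply; exact: (C1_diff C3a).
have Z : is_derive (0 : R) 1 (fun s => g p.1.1 w.1.1 s * X1 X (gg s) +
    g p.1.2 w.1.2 s * X2 X (gg s) + g p.2 w.2 s * X3 X (gg s)) 0.
  have -> : (fun s => g p.1.1 w.1.1 s * X1 X (gg s) +
    g p.1.2 w.1.2 s * X2 X (gg s) + g p.2 w.2 s * X3 X (gg s)) = cst 0.
    by apply/funext => s; rewrite /= -[RHS](tX _ (Sg s)) dotE.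
  exact: is_derive_cst.
have [_ z] := Z.
have [_ z'] := is_deriveD (is_deriveD (is_deriveM d1 D1) (is_deriveM d2 D2)) (is_deriveM d3 D3).
have := etrans (esym z') z.
rewrite /= -/(g p.1.1 w.1.1 0) -/(g p.1.2 w.1.2 0) -/(g p.2 w.2 0) !g0 gg0.
rewrite /GRing.scale /= derive_comps// !dotE /= => e.
apply/eqP; rewrite -addr_eq0 -[X in _ == X]e /X1 /X2 /X3; apply/eqP; ring.
Qed.

End Curves.

(** * The divergence theorem on the sphere *)

Section DivergenceTheorem.
Context {R : realType}.
Local Notation lam := (@lebesgue_measure R).

Lemma Rintegral_cst_S2 (C : R) : \int[domega]_(x in (@S2 R)) C = C.
Proof.
rewrite Rintegral_cst; last exact: measurable_S2.
by rewrite [X in fine X](@domega_S2 R) mulr1.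
Qed.

Lemma lebesgue_measure_itvcc (a b : R) : a < b -> lam `[a, b]%classic = (b - a)%:E.
Proof. by move=> ab; rewrite lebesgue_measure_itv /= lte_fin ab EFinB. Qed.

(** This is div X = d/dz X_3 + (1/s) d/dt (cos t X_2 - sin t X_1), multiplied by s. Here [c], [s0]
    are cos t and sin t, [s] is sqrt(1 - z^2), [A] and [V] are the Jacobian matrix and the value of
    the field, and [w], [e] are the derivatives of the point in z and in t. The last two hypotheses
    are tangency at [x] and its derivative along [w]. *)
Lemma divergence_identity (A : 'I_3 -> R3 R) (V : R3 R) (c s0 s z : R) :
  c ^+ 2 + s0 ^+ 2 = 1 -> s ^+ 2 + z ^+ 2 = 1 -> s != 0 ->
  let x : R3 R := (s * c, s * s0, z) in
  let w : R3 R := (- (z / s) * c, - (z / s) * s0, 1) in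
  dot x V = 0 -> dot x (lcomb A w) = - dot w V ->
  let e : R3 R := (- (s * s0), s * c, 0) in
  c * (lcomb A e).1.2 - s0 * (lcomb A e).1.1 - s0 * V.1.2 - c * V.1.1 =
  s * (trace A - dot x (lcomb A x) - (lcomb A w).2).
Proof.
move=> q1 q2 sn0 x w; rewrite /trace /lcomb.
case: (A 0) => -[a11 a21] a31; case: (A 1) => -[a12 a22] a32.
case: (A 2) => -[a13 a23] a33; case: V => -[v1 v2] v3.
have sc (a b : R) : a *: b = a * b by [].
rewrite !dotE /x /w /= !sc => h1 h2.
have ek : z / s * s = z by rewrite divfK.
move: (z / s) ek h1 h2 => k ek h1 h2.
apply: subr0_eq.
have H1 : s * c * v1 + s * s0 * v2 + z * v3 = 0 by [].
have H2 := h2; move/eqP : H2; rewrite -subr_eq0 => /eqP H2.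
have Q : s ^+ 2 + z ^+ 2 - 1 = 0 by rewrite q2 subrr.
have q : c ^+ 2 + s0 ^+ 2 - 1 = 0 by rewrite q1 subrr.
subst z.
set L := LHS; set u := c * v1 + s0 * v2.
set r := c ^+ 2 * a11 + c * s0 * (a12 + a21) + s0 ^+ 2 * a22.
set w3 := - k * c * a31 + - k * s0 * a32 + 1 * a33.
(* The difference of the two sides as an explicit combination of the hypotheses, each brought to the
   form [_ = 0]; [k] stands for [z / s]. *)
transitivity ((s ^+ 2 + (k * s) ^+ 2 - 1) * (u + s * (r + a33) - s * w3)
  - s * (s * c * v1 + s * s0 * v2 + k * s * v3)
  + s * (c ^+ 2 + s0 ^+ 2 - 1) * (a11 + a22) +
  s ^+ 2 * k * (s * c * (- k * c * a11 + - k * s0 * a12 + 1 * a13) +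
    s * s0 * (- k * c * a21 + - k * s0 * a22 + 1 * a23) +
    k * s * (- k * c * a31 + - k * s0 * a32 + 1 * a33) -
    - (- k * c * v1 + - k * s0 * v2 + 1 * v3))).
  by rewrite /L /u /r /w3; ring.
by rewrite Q H1 q H2 !(mul0r, mulr0, subr0, addr0).
Qed.

Lemma weights_le (a b c k : R) : 0 <= a -> 0 <= b -> 0 <= c -> 0 <= k ->
  a * k + b * k + c <= (a + b + c) * (1 + 2 * k).
Proof.
move=> a0 b0 c0 k0; rewrite -subr_ge0.
rewrite (_ : _ - _ = a + b + a * k + b * k + 2 * (c * k)); last by ring.
by rewrite !addr_ge0// !mulr_ge0.
Qed.

(** For |z| > 1 the point [cylindrical (t, z)] is off the sphere, where nothing is known about a
    field. Composing with this projection onto [-1, 1] gives functions of z on the whole line that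
    are continuous at the end points too. *)
Definition clamp (z : R) : R := Num.max (-1) (Num.min 1 z).

Lemma clamp_continuous : continuous clamp.
Proof.
move=> z; apply: (@continuous_max R R (cst (-1)) (fun z => Num.min 1 z) z).
  exact: cvg_cst.
by apply: (@continuous_min R R (cst 1) id z); [exact: cvg_cst|exact: cvg_id].
Qed.

Lemma clamp_id (z : R) : -1 <= z <= 1 -> clamp z = z.
Proof. by move=> /andP[a b]; rewrite /clamp min_r// max_r. Qed.

Lemma clamp_itv (z : R) : -1 <= clamp z <= 1.
Proof.
rewrite /clamp le_max lexx /= ge_max ge_min lexx /= andbT.
by rewrite (le_trans (lerN10 R))//.
Qed.

Lemma S2_cylindrical (t z : R) : -1 <= z <= 1 -> S2 (cylindrical (t, z) : R3 R).
Proof.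
move=> z1; rewrite /S2 /= dotE /=.
have z2' : 0 <= 1 - z ^+ 2.
  by rewrite subr_ge0 -[z ^+ 2]real_normK ?num_real// expr_le1// ler_norml.
have := sqr_sqrtr z2'; have := cos2Dsin2 t.
set s := Num.sqrt _ => e2 e1.
transitivity (s ^+ 2 * (cos t ^+ 2 + sin t ^+ 2) + z ^+ 2); last first.
  by rewrite e2 mulr1 e1 subrK.
by rewrite -/s; ring.
Qed.

Lemma cylindrical_continuous1 (z : R) : continuous (fun t => cylindrical (t, z) : R3 R).
Proof.
move=> t.
have c1 : Num.sqrt (1 - z ^+ 2) * cos y @[y --> t] --> Num.sqrt (1 - z ^+ 2) * cos t.
  by apply: cvgM; [exact: cvg_cst|exact: continuous_cos].
have c2 : Num.sqrt (1 - z ^+ 2) * sin y @[y --> t] --> Num.sqrt (1 - z ^+ 2) * sin t.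
  by apply: cvgM; [exact: cvg_cst|exact: continuous_sin].
exact: (cvg_pair (cvg_pair c1 c2) (cvg_cst z)).
Qed.

Lemma cylindrical_continuous2 t : continuous (fun z => cylindrical (t, z) : R3 R).
Proof.
move=> z.
have cs : Num.sqrt (1 - y ^+ 2) @[y --> z] --> Num.sqrt (1 - z ^+ 2).
  have c0 : 1 - y ^+ 2 @[y --> z] --> 1 - z ^+ 2.
    by apply: cvgB; [exact: cvg_cst|apply: cvgM; exact: cvg_id].
  by apply: (cvg_comp _ _ c0); exact: sqrt_continuous.
exact: (cvg_pair (cvg_pair (cvgM cs (cvg_cst (cos t))) (cvgM cs (cvg_cst (sin t)))) cvg_id).
Qed.

(** The z-derivative of [cylindrical (t, z)]; it blows up at the poles. *)
Definition meridian (t z : R) : R3 R :=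
  (- (z / Num.sqrt (1 - z ^+ 2)) * cos t, - (z / Num.sqrt (1 - z ^+ 2)) * sin t, 1).

Section Field.
Variables (X : R3 R -> R3 R) (hX : C1_tangent_field X).

Let F t z := X3 X (cylindrical (t, z)).
Let dF t z := ('D_(meridian t z) X (cylindrical (t, z))).2.
Let h t z := sphere_div X (cylindrical (t, z)).

Lemma open_itv_pos (z : R) : -1 < z < 1 -> 0 < 1 - z ^+ 2.
Proof.
by move=> z1; rewrite subr_gt0 -[z ^+ 2]real_normK ?num_real// expr_lt1// ltr_norml.
Qed.

Lemma is_derive_height (t z : R) : -1 < z < 1 -> is_derive z 1 (F t) (dF t z).
Proof.
move=> z1; have p0 := open_itv_pos z1; have s0 : 0 < Num.sqrt (1 - z ^+ 2) by rewrite sqrtr_gt0.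
have zz : -1 <= z <= 1 by move: z1 => /andP[/ltW -> /ltW ->].
have Cp := hX.2 _ (S2_cylindrical t zz).
have [_ _ C3] := C1_comps Cp.
have ds : is_derive z 1 (fun y => Num.sqrt (1 - y ^+ 2)) (- (z / Num.sqrt (1 - z ^+ 2))).
  have d0 : is_derive z 1 (fun y : R => 1 - y ^+ 2) (- (2 * z)).
    apply: (is_derive_eq (is_deriveB (is_derive_cst (1:R) z 1)
      (is_deriveM (is_derive_id z 1) (is_derive_id z 1)))).
    by rewrite /GRing.scale /=; ring.
  have dc := @is_derive1_comp R Num.sqrt (fun y => 1 - y ^+ 2) z _ _ (is_derive1_sqrt p0) d0.
  apply: (is_derive_eq dc).
  by field; rewrite gt_eqF.
have d1 : is_derive z 1 (fun y => Num.sqrt (1 - y ^+ 2) * cos t)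
    (- (z / Num.sqrt (1 - z ^+ 2)) * cos t).
  apply: (is_derive_eq (is_deriveM ds (is_derive_cst (cos t) z 1))).
  by rewrite /GRing.scale /=; ring.
have d2 : is_derive z 1 (fun y => Num.sqrt (1 - y ^+ 2) * sin t)
    (- (z / Num.sqrt (1 - z ^+ 2)) * sin t).
  apply: (is_derive_eq (is_deriveM ds (is_derive_cst (sin t) z 1))).
  by rewrite /GRing.scale /=; ring.
have := is_derive_curve d1 d2 (is_derive_id z 1) (C1_diff C3).
by rewrite /dF [X in X.2](derive_comps _ (C1_diff Cp)).
Qed.

Lemma is_derive_angle (t z : R) : -1 < z < 1 ->
  is_derive t 1 (fun t => cos t * X2 X (cylindrical (t, z)) - sin t * X1 X (cylindrical (t, z)))
    (Num.sqrt (1 - z ^+ 2) * (h t z - dF t z)).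
Proof.
move=> z1; have p0 := open_itv_pos z1; have s0 : 0 < Num.sqrt (1 - z ^+ 2) by rewrite sqrtr_gt0.
have zz : -1 <= z <= 1 by move: z1 => /andP[/ltW -> /ltW ->].
have Sp := S2_cylindrical t zz.
have Cp := hX.2 _ Sp.
have [C1' C2' _] := C1_comps Cp.
set s := Num.sqrt (1 - z ^+ 2) in s0 *.
have d1 : is_derive t 1 (fun y => s * cos y) (- (s * sin t)).
  apply: (is_derive_eq (is_deriveM (is_derive_cst s t 1) (is_derive_cos t))).
  by rewrite /GRing.scale /=; ring.
have d2 : is_derive t 1 (fun y => s * sin y) (s * cos t).
  apply: (is_derive_eq (is_deriveM (is_derive_cst s t 1) (is_derive_sin t))).
  by rewrite /GRing.scale /=; ring.
have D1 := is_derive_curve d1 d2 (is_derive_cst z t 1) (C1_diff C1').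
have D2 := is_derive_curve d1 d2 (is_derive_cst z t 1) (C1_diff C2').
apply: (is_derive_eq (is_deriveB (is_deriveM (is_derive_cos t) D2) (is_deriveM (is_derive_sin t) D1))).
have q1 := cos2Dsin2 t.
have q2 : s ^+ 2 + z ^+ 2 = 1 by rewrite sqr_sqrtr ?subrK// ltW.
have sn0 : s != 0 by rewrite gt_eqF.
have dX := C1_diff Cp.
pose A i := 'D_(std_basis i) X (cylindrical (t, z)).
have t1 : dot (cylindrical (t, z)) (meridian t z) = 0.
  rewrite dotE /meridian /= -/s.
  transitivity (z * (1 - (cos t ^+ 2 + sin t ^+ 2))); first by field.
  by rewrite q1 subrr mulr0.
have I := @divergence_identity A (X (cylindrical (t, z))) (cos t) (sin t) s z q1 q2 sn0
  (hX.1 _ Sp).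
have := tangent_derive hX Sp t1; rewrite [X in dot _ X](lcombE _ dX) => /I{}I.
rewrite /dF [X in X.2](lcombE _ dX) /h (sphere_divE dX) /= -I.
pose e : R3 R := (- (s * sin t), s * cos t, 0).
have := lcombE e dX; rewrite (derive_comps _ dX) -/A => <- /=.
by rewrite /GRing.scale /= -/(X1 X _) -/(X2 X _); ring.
Qed.

Lemma div_continuous1 (z : R) : -1 <= z <= 1 -> continuous (h^~ z).
Proof.
move=> z1 t; apply: (@continuous_comp _ _ _ (fun t => cylindrical (t, z)) (sphere_div X)).
  exact: cylindrical_continuous1.
by apply: sphere_div_continuous; exact: (hX.2 _ (S2_cylindrical t z1)).
Qed.

Lemma dFE (t z : R) : -1 <= z <= 1 -> dF t z =
  (- (z / Num.sqrt (1 - z ^+ 2)) * cos t) * ('D_(std_basis 0) X (cylindrical (t, z))).2 +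
  (- (z / Num.sqrt (1 - z ^+ 2)) * sin t) * ('D_(std_basis 1) X (cylindrical (t, z))).2 +
  ('D_(std_basis 2) X (cylindrical (t, z))).2.
Proof.
move=> z1; have dX := C1_diff (hX.2 _ (S2_cylindrical t z1)).
apply: (etrans (congr1 snd (lcombE (meridian t z) dX))).
by rewrite /lcomb [X in (_ + _ + X).2]scale1r.
Qed.

Lemma dX_continuous i p : S2 p -> {for p, continuous (fun x => ('D_(std_basis i) X x).2)}.
Proof.
move=> Sp; have c := C1_dcont (std_basis i) (hX.2 _ Sp).
by apply: (cvg_comp _ snd c); exact: cvg_snd.
Qed.

Lemma dF_continuous1 (z : R) : -1 <= z <= 1 -> continuous (dF^~ z).
Proof.
move=> z1 t; rewrite /continuous_at.
have e : dF^~ z = fun t =>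
  (- (z / Num.sqrt (1 - z ^+ 2)) * cos t) * ('D_(std_basis 0) X (cylindrical (t, z))).2 +
  (- (z / Num.sqrt (1 - z ^+ 2)) * sin t) * ('D_(std_basis 1) X (cylindrical (t, z))).2 +
  ('D_(std_basis 2) X (cylindrical (t, z))).2.
  by apply/funext => t'; exact: dFE.
rewrite e (dFE t z1).
have c i : ('D_(std_basis i) X (cylindrical (y, z))).2 @[y --> t] -->
    ('D_(std_basis i) X (cylindrical (t, z))).2.
  apply: (@continuous_comp _ _ _ (fun t => cylindrical (t, z))
    (fun x => ('D_(std_basis i) X x).2)); first exact: cylindrical_continuous1.
  exact: (dX_continuous (S2_cylindrical t z1)).
have cc : (- (z / Num.sqrt (1 - z ^+ 2)) * cos y) @[y --> t] -->
   (- (z / Num.sqrt (1 - z ^+ 2)) * cos t).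
  by apply: cvgM; [exact: cvg_cst|exact: continuous_cos].
have cs : (- (z / Num.sqrt (1 - z ^+ 2)) * sin y) @[y --> t] -->
   (- (z / Num.sqrt (1 - z ^+ 2)) * sin t).
  by apply: cvgM; [exact: cvg_cst|exact: continuous_sin].
exact: (cvgD (cvgD (cvgM cc (c 0)) (cvgM cs (c 1))) (c 2)).
Qed.

Lemma pi2_gt0 : 0 < 2 * pi :> R.
Proof. by rewrite mulr_gt0// pi_gt0. Qed.

Lemma continuous_integrable_itv (f : R -> R) (a b : R) : continuous f ->
  lam.-integrable `[a, b] (EFin \o f).
Proof.
move=> cf; apply: continuous_compact_integrable; first exact: segment_compact.
exact: continuous_subspaceT.
Qed.

(** The t-derivative of a 2 pi-periodic function integrates to 0, and the factor sqrt(1 - z^2) in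
    [is_derive_angle] is positive away from the poles. *)
Lemma integral_div_dF (z : R) : -1 < z < 1 ->
  \int[lam]_(t in `[0, 2 * pi]) h t z = \int[lam]_(t in `[0, 2 * pi]) dF t z.
Proof.
move=> z1; have p0 := open_itv_pos z1; have s0 : 0 < Num.sqrt (1 - z ^+ 2) by rewrite sqrtr_gt0.
have zz : -1 <= z <= 1 by move: z1 => /andP[/ltW -> /ltW ->].
set s := Num.sqrt (1 - z ^+ 2) in s0.
pose G t := cos t * X2 X (cylindrical (t, z)) - sin t * X1 X (cylindrical (t, z)).
have dG (t : R) : is_derive t 1 G (s * (h t z - dF t z)) by exact: is_derive_angle.
have cG : continuous G.
  by move=> t; apply: differentiable_continuous; apply/derivable1_diffP; case: (dG t).
have cg : continuous (fun t => s * (h t z - dF t z)).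
  move=> t; apply: cvgM; first exact: cvg_cst.
  by apply: cvgB; [exact: div_continuous1|exact: dF_continuous1].
have := @continuous_FTC2 R (fun t => s * (h t z - dF t z)) G 0 (2 * pi) pi2_gt0
  (continuous_subspaceT cg).
have -> : G (2 * pi) = G 0.
  rewrite /G /cylindrical /= mulr_natl cos2pi sin2pi.
  by rewrite cos0 sin0.
rewrite -EFinB subrr => H.
have Z : \int[lam]_(t in `[0, 2 * pi]) (s * (h t z - dF t z)) = 0.
  rewrite /Rintegral H//.
    split; first by move=> t _; case: (dG t).
      by apply: cvg_at_right_filter; exact: cG.
    by apply: cvg_at_left_filter; exact: cG.
  by move=> t _; rewrite derive1E; case: (dG t).
have ih := continuous_integrable_itv 0 (2 * pi) (div_continuous1 zz).
have iF := continuous_integrable_itv 0 (2 * pi) (dF_continuous1 zz).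
rewrite RintegralZl// in Z; last first.
  apply: continuous_integrable_itv => t.
  by apply: cvgB; [exact: div_continuous1|exact: dF_continuous1].
move/eqP : Z; rewrite mulf_eq0 gt_eqF//= RintegralB// => /eqP.
by move/subr0_eq.
Qed.

Let B := `[0, 2 * pi : R]%classic.

(** [dF] is unbounded near the poles. A uniform bound on each strip [m <= 1 - z ^+ 2] is enough to
    differentiate under the integral. *)
Lemma merid_bound : exists2 C : R, 0 <= C & forall t z m : R, 0 < m -> m <= 1 - z ^+ 2 ->
  -1 < z < 1 -> `|dF t z| <= C * (1 + 2 / Num.sqrt m).
Proof.
have [C0 C00 h0] := @continuous_S2_bounded R _ (@dX_continuous 0).
have [C1 C10 h1] := @continuous_S2_bounded R _ (@dX_continuous 1).
have [C2 C20 h2] := @continuous_S2_bounded R _ (@dX_continuous 2).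
exists (C0 + C1 + C2); first by rewrite !addr_ge0.
move=> t z m m0 mz z1.
have zz : -1 <= z <= 1 by move: z1 => /andP[/ltW -> /ltW ->].
have S := S2_cylindrical t zz.
rewrite dFE//.
have sm0 : 0 < Num.sqrt m by rewrite sqrtr_gt0.
have k1 : `|- (z / Num.sqrt (1 - z ^+ 2))| <= (Num.sqrt m)^-1.
  rewrite normrN normrM -[X in _ <= X]mul1r ler_pM//; first by rewrite ler_norml.
  rewrite normfV ger0_norm ?sqrtr_ge0// lef_pV2 ?posrE ?sqrtr_gt0//; last exact: open_itv_pos.
  by rewrite ler_sqrt// ltW// open_itv_pos.
have B1 (a b c d : R) : `|a| <= (Num.sqrt m)^-1 -> `|b| <= 1 -> `|c| <= d -> `|a * b * c| <= d / Num.sqrt m.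
  move=> ha hb hc; rewrite !normrM [X in _ <= X]mulrC; apply: ler_pM => //.
  by rewrite -[X in _ <= X]mulr1; apply: ler_pM.
have c1 : `|cos t| <= 1 by rewrite ler_norml cos_geN1 cos_le1.
have s1 : `|sin t| <= 1 by rewrite ler_norml sin_geN1 sin_le1.
have b0 := B1 _ _ _ _ k1 c1 (h0 _ S).
have b1 := B1 _ _ _ _ k1 s1 (h1 _ S).
rewrite (le_trans (ler_normD _ _))// (le_trans (lerD (ler_normD _ _) (h2 _ S)))//.
rewrite (le_trans (lerD (lerD b0 b1) (lexx _)))//.
have i0 : 0 <= (Num.sqrt m)^-1 by rewrite invr_ge0 ltW.
exact: weights_le.
Qed.

(** Differentiation under the integral produces the t-integral of [dF], which [integral_div_dF]
    exchanges for that of the divergence. *)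
Lemma is_derive_flux (z : R) : -1 < z < 1 ->
  is_derive z 1 (fun z => \int[lam]_(t in B) F t (clamp z)) (\int[lam]_(t in B) h t z).
Proof.
move=> z1.
(* The midpoint of |z| and 1: the interval from -a to a contains z and stays away from the poles. *)
pose a := (1 + `|z|) / 2.
have az : `|z| < a by rewrite /a ltr_pdivlMr// mulr_natr mulr2n ltrD2r ltr_norml.
have a1 : a < 1 by rewrite /a ltr_pdivrMr// mul1r [X in _ < X](_ : _ = 1 + 1)// ltrD2l ltr_norml.
have a0 : 0 < a by rewrite (le_lt_trans _ az).
have Iz : `]- a, a[%classic z by rewrite /= in_itv/= -ltr_norml.
have I1 x : `]- a, a[%classic x -> -1 < x < 1.
  by rewrite /= in_itv/= => /andP[u v]; rewrite (lt_trans v a1) (lt_trans _ u)// ltrN2.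
have I2 x : `]- a, a[%classic x -> -1 <= x <= 1.
  by move=> /I1/andP[/ltW -> /ltW ->].
pose m := 1 - a ^+ 2.
have m0 : 0 < m by rewrite /m subr_gt0 expr_lt1// ltW.
have [C C0 hC] := merid_bound.
have iF (x : R) : `]- a, a[%classic x -> lam.-integrable B (EFin \o (F^~ x)).
  move=> /I2 xx; apply: continuous_integrable_itv => t.
  apply: (@continuous_comp _ _ _ (fun t => cylindrical (t, x)) (X3 X)).
    exact: cylindrical_continuous1.
  by have [_ _ /C1_cont] := C1_comps (hX.2 _ (S2_cylindrical t xx)).
have dFx (x t : R) : `]- a, a[%classic x -> B t -> derivable (F t) x 1.
  by move=> /I1 xx _; case: (is_derive_height t xx).
have pE (x t : R) : `]- a, a[%classic x -> partial1of2 (fun z t => F t z) x t = dF t x.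
  by move=> /I1 xx; rewrite partial1of2E; case: (is_derive_height t xx).
have iG : lam.-integrable B (EFin \o (fun=> C * (1 + 2 / Num.sqrt m))).
  by apply: continuous_integrable_itv; exact: cst_continuous.
have G0 (t : R) : 0 <= C * (1 + 2 / Num.sqrt m).
  by rewrite mulr_ge0// addr_ge0// divr_ge0// sqrtr_ge0.
have Gub (x t : R) : `]- a, a[%classic x -> B t ->
    `|partial1of2 (fun z t => F t z) x t| <= C * (1 + 2 / Num.sqrt m).
  move=> xx _; rewrite pE//; apply: hC => //; last exact: I1.
  have : `|x| < a by move: xx; rewrite /= in_itv/= -ltr_norml.
  rewrite /m lerD2l lerN2 -[x ^+ 2]real_normK ?num_real// => /ltW xa.
  by rewrite lerXn2r// nnegrE ltW.
have D := @derivable_under_integral R _ _ lam (fun z t => F t z) B (measurable_itv _) z (- a) a Iz iF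
  dFx _ G0 iG Gub.
have E := @differentiation_under_integral R _ _ lam (fun z t => F t z) B (measurable_itv _) z (- a) a Iz iF
  dFx _ G0 iG Gub.
apply: (@near_eq_is_derive _ _ _ (fun z => \int[lam]_(t in B) F t z)).
  near=> x; rewrite clamp_id//; apply: I2.
  by near: x; apply: open_nbhs_nbhs; split => //; exact: itv_open.
apply: DeriveDef; first exact: D.
rewrite -derive1E E integral_div_dF//.
by apply: eq_Rintegral => t _; rewrite pE.
Unshelve. all: by end_near. Qed.

Lemma clamp_integral_continuous (f : R3 R -> R) :
  (forall p, S2 p -> {for p, continuous f}) ->
  forall z : R, -1 <= z <= 1 ->
  {for z, continuous (fun z : R => \int[lam]_(t in B) f (cylindrical (t, clamp z)))}.
Proof.
move=> cf z z1.
have [C C0 hC] := continuous_S2_bounded cf.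
have S t z' := S2_cylindrical t (clamp_itv z').
(* An open interval with [-1, 1] inside, so that the end points are covered; [clamp] makes the
   integrand meaningful on all of it. *)
have Iz : z \in `]-2, 2[%classic.
  rewrite inE /= in_itv /=; move: z1 => /andP[? ?].
  by apply/andP; split; lra.
apply: (@continuity_under_integral R _ _ lam (fun z t => f (cylindrical (t, clamp z))) B
  (measurable_itv _) (-2) 2 _ _ (fun=> C) _ _ z Iz).
- move=> x _; apply: continuous_integrable_itv => t.
  apply: (@continuous_comp _ _ _ (fun t => cylindrical (t, clamp x)) f).
    exact: cylindrical_continuous1.
  exact: cf.
- apply: aeW => t _ x _.
  apply: (@continuous_comp _ _ _ clamp (fun z => f (cylindrical (t, z)))).
    exact: clamp_continuous.
  apply: (@continuous_comp _ _ _ (fun z => cylindrical (t, z)) f).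
    exact: cylindrical_continuous2.
  exact: cf.
- by apply: continuous_integrable_itv; exact: cst_continuous.
- by move=> x _; apply: aeW => t _; exact: hC.
Qed.

(** At a pole the first two coordinates vanish, and tangency reads [z * X_3 = 0]. *)
Lemma flux_pole (t z : R) : z ^+ 2 = 1 -> F t z = 0.
Proof.
move=> z1; have zz : -1 <= z <= 1 by rewrite -ler_norml -(@expr_le1 _ 2)// real_normK ?num_real// z1.
have := hX.1 _ (S2_cylindrical t zz); rewrite dotE /cylindrical /= z1 subrr sqrtr0 !mul0r !add0r.
move/eqP; rewrite mulf_eq0 => /orP[/eqP z0|/eqP h0].
  by move: z1; rewrite z0 expr0n /= => /esym/eqP; rewrite oner_eq0.
by rewrite /F /X3 /cylindrical /= z1 subrr sqrtr0 !mul0r.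
Qed.

(** By [is_derive_flux] the integral is the difference of the fluxes of X_3 at the two poles, and
    both vanish. The fundamental theorem asks for the derivative only inside the interval and for
    continuity at its ends, which avoids the blow-up of [dF]. *)
Lemma iterated_divergence :
  (\int[lam]_(z in `[(-1)%R, 1%R]) (\int[lam]_(t in B) h t (clamp z))%R%:E = 0)%E.
Proof.
have ch (p : R3 R) : S2 p -> {for p, continuous (sphere_div X)}.
  by move=> Sp; apply: sphere_div_continuous; exact: hX.2.
have cF (p : R3 R) : S2 p -> {for p, continuous (X3 X)}.
  by move=> Sp; have [_ _ /C1_cont] := C1_comps (hX.2 _ Sp).
have cK := clamp_integral_continuous ch.
have cL := clamp_integral_continuous cF.
have i1 : -1 <= (1 : R) <= 1 by apply/andP; split; lra.
have i2 : -1 <= (-1 : R) <= 1 by apply/andP; split; lra.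
have lt11 : -1 < (1 : R) by lra.
pose L z := \int[lam]_(t in B) F t (clamp z).
have L1 : L 1 = 0.
  rewrite /L clamp_id// -[RHS](@Rintegral_set0 _ _ _ lam (fun=> 0)).
  rewrite Rintegral_set0 -[RHS](mul0r (fine (lam B))) -Rintegral_cst; last exact: measurable_itv.
  by apply: eq_Rintegral => t _; rewrite flux_pole// expr1n.
have L2 : L (-1) = 0.
  rewrite /L clamp_id// -[RHS](mul0r (fine (lam B))) -Rintegral_cst; last exact: measurable_itv.
  by apply: eq_Rintegral => t _; rewrite flux_pole// sqrrN expr1n.
rewrite (@continuous_FTC2 R (fun z => \int[lam]_(t in B) h t (clamp z)) L (-1) 1)//.
- by rewrite L1 L2 subee.
- apply: continuous_in_subspaceT => z /set_mem /=; rewrite in_itv /=; exact: cK.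
- split.
  + by move=> z; rewrite in_itv/= => z1; case: (is_derive_flux z1).
  + by apply: cvg_at_right_filter; exact: cL.
  + by apply: cvg_at_left_filter; exact: cL.
- move=> z; rewrite in_itv/= => z1; rewrite derive1E.
  have [_ ->] := is_derive_flux z1; rewrite clamp_id//.
  by move: z1 => /andP[/ltW -> /ltW ->].
Qed.

Theorem divergence_theorem : \int[domega]_(x in S2) sphere_div X x = 0.
Proof.
have ch (p : R3 R) : S2 p -> {for p, continuous (sphere_div X)}.
  by move=> Sp; apply: sphere_div_continuous; exact: hX.2.
have [C C0 hC] := continuous_S2_bounded ch.
(* The iterated formula is for nonnegative functions, so a bound [C] of the divergence is added; the
   integral is then computed in two ways. *)
pose f : R3 R -> \bar R := (fun x => (sphere_div X x + C)%:E) \_ S2.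
have mh : measurable_fun S2 (sphere_div X).
  exact: within_continuous_measurable3.
have mf : measurable_fun setT f.
  apply/(measurable_restrictT _ _).1; first exact: measurable_S2.
  by apply/measurable_EFinP; apply: measurable_funD.
have f0 x : (0 <= f x)%E.
  apply: erestrict_ge0 => y Sy; rewrite lee_fin.
  by have := hC y Sy; rewrite ler_norml => /andP[u v]; lra.
have ih := continuous_integrable_S2 ch.
have iC : domega.-integrable (@S2 R) (EFin \o cst C).
  by apply: continuous_integrable_S2 => p _; exact: cst_continuous.
have E1 : (\int[domega]_x f x = (\int[domega]_(x in S2) sphere_div X x + C)%:E)%E.
  rewrite /f -integral_mkcond -[in RHS](Rintegral_cst_S2 C).
  rewrite -(RintegralD measurable_S2 ih iC).
  rewrite /Rintegral fineK//; apply: integrable_fin_num => //.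
    exact: measurable_S2.
  exact: (integrableD measurable_S2 ih iC).
have E2 : (\int[domega]_x f x = C%:E)%E.
  rewrite domega_integral_fubini//.
  have -> : (\int[lam]_(z in `[(-1)%R, 1%R]) \int[lam]_(t in `[0%R, (2 * pi)%R]) f (cylindrical (t, z)) =
     \int[lam]_(z in `[(-1)%R, 1%R]) ((\int[lam]_(t in B) h t (clamp z))%R%:E + (2 * pi * C)%:E))%E.
    apply: eq_integral => z; rewrite inE /= in_itv /= => z1.
    rewrite clamp_id//.
    transitivity (\int[lam]_(t in B) ((h t z)%:E + C%:E))%E.
      apply: eq_integral => t _; rewrite /f patchE mem_set//; exact: S2_cylindrical.
    have ih1 := continuous_integrable_itv 0 (2 * pi) (div_continuous1 z1).
    have ic1 := continuous_integrable_itv 0 (2 * pi) (@cst_continuous R R C).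
    rewrite [LHS](integralD _ ih1 ic1); last exact: measurable_itv.
    congr (_ + _)%E.
      by rewrite /Rintegral fineK//; apply: integrable_fin_num => //; exact: measurable_itv.
    rewrite integral_cst; last exact: measurable_itv.
    by rewrite [X in (_ * X)%E](lebesgue_measure_itvcc pi2_gt0) subr0 -EFinM mulrC.
  have iK : lam.-integrable `[-1, 1] (fun z => (\int[lam]_(t in B) h t (clamp z))%R%:E).
    apply: (continuous_compact_integrable (f := fun z => \int[lam]_(t in B) h t (clamp z))).
      exact: segment_compact.
    apply: continuous_in_subspaceT => z /set_mem /=; rewrite in_itv /=.
    exact: clamp_integral_continuous.
  have iC2 := continuous_integrable_itv (-1) 1 (@cst_continuous R R (2 * pi * C)).
  rewrite [X in (_ * X)%E](integralD _ iK iC2); last exact: measurable_itv.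
  rewrite iterated_divergence add0e integral_cst; last exact: measurable_itv.
  have lt11 : -1 < (1 : R) by lra.
  rewrite [X in (_ * (_ * X))%E](lebesgue_measure_itvcc lt11) -!EFinM opprK; congr EFin.
  by have := @pi_gt0 R; move: pi => p p0; field; rewrite gt_eqF.
by move: E1; rewrite E2 => -[] /esym/eqP; rewrite -subr_eq0 addrK => /eqP.
Qed.

End Field.
End DivergenceTheorem.

(** * Explicit differentials *)

Section Differentials.
Context {R : realType}.
Implicit Types (f g : R3 R -> R) (p v : R3 R).

(** Pairs differentiability with a formula for the derivative in every direction, so that the
    formula for a compound expression is assembled by unification, rule by rule. *)
Definition has_diff f p (df : R3 R -> R) : Prop :=
  differentiable f p /\ forall v, 'D_v f p = df v.

Lemma has_diff_eq f p df df' : has_diff f p df -> (forall v, df v = df' v) -> has_diff f p df'.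
Proof. by move=> [d e] h; split => // v; rewrite e. Qed.

Lemma has_diff_cst (c : R) p : has_diff (fun=> c) p (fun=> 0).
Proof. by split => [|v]; [exact: differentiable_cst|exact: derive_cst]. Qed.

Lemma has_diff_x1 p : has_diff (fun x => x.1.1) p (fun v => v.1.1).
Proof. by split => [|v]; [exact: (C1_diff (C1_x1 p))|exact: derive_x1]. Qed.

Lemma has_diff_x2 p : has_diff (fun x => x.1.2) p (fun v => v.1.2).
Proof. by split => [|v]; [exact: (C1_diff (C1_x2 p))|exact: derive_x2]. Qed.

Lemma has_diff_x3 p : has_diff (fun x => x.2) p (fun v => v.2).
Proof. by split => [|v]; [exact: (C1_diff (C1_x3 p))|exact: derive_x3]. Qed.

Lemma has_diffD f g p df dg : has_diff f p df -> has_diff g p dg ->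
  has_diff (fun x => f x + g x) p (fun v => df v + dg v).
Proof.
move=> [d1 e1] [d2 e2]; split; first exact: differentiableD.
by move=> v; rewrite -e1 -e2 -deriveD//; exact: diff_derivable.
Qed.

Lemma has_diffB f g p df dg : has_diff f p df -> has_diff g p dg ->
  has_diff (fun x => f x - g x) p (fun v => df v - dg v).
Proof.
move=> [d1 e1] [d2 e2]; split; first exact: differentiableB.
by move=> v; rewrite -e1 -e2 -deriveB//; exact: diff_derivable.
Qed.

Lemma has_diffM f g p df dg : has_diff f p df -> has_diff g p dg ->
  has_diff (fun x => f x * g x) p (fun v => f p * dg v + g p * df v).
Proof.
move=> [d1 e1] [d2 e2]; split; first exact: differentiableM.
by move=> v; rewrite -e1 -e2 deriveM//; exact: diff_derivable.
Qed.

Lemma has_diff_div f g p df dg : g p != 0 -> has_diff f p df -> has_diff g p dg ->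
  has_diff (fun x => f x / g x) p (fun v => df v / g p - f p / g p * (dg v / g p)).
Proof.
move=> gp [d1 e1] [d2 e2].
have dV : differentiable (fun x => (g x)^-1) p by exact: differentiableV.
split; first exact: differentiableM.
move=> v; rewrite deriveM//; [|exact: diff_derivable|exact: diff_derivable].
rewrite deriveV//; last exact: diff_derivable.
by rewrite e1 e2 /GRing.scale /=; field.
Qed.

Lemma has_diff_dot (l : R3 R) p : has_diff (fun x => dot l x) p (fun v => dot l v).
Proof.
have -> : (fun x => dot l x) = (fun x : R3 R => l.1.1 * x.1.1 + l.1.2 * x.1.2 + l.2 * x.2).
  by apply/funext => x; rewrite dotE.
apply: has_diff_eq.
  by apply: has_diffD; first apply: has_diffD; apply: has_diffM;
    [exact: has_diff_cst|exact: has_diff_x1|exact: has_diff_cst|exact: has_diff_x2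
    |exact: has_diff_cst|exact: has_diff_x3].
by move=> v; rewrite /= !mulr0 !addr0.
Qed.

Lemma C1_dot (l : R3 R) p : C1 (fun x => dot l x) p.
Proof.
have -> : (fun x => dot l x) = (fun x : R3 R => l.1.1 * x.1.1 + l.1.2 * x.1.2 + l.2 * x.2).
  by apply/funext => x; rewrite dotE.
by apply: C1D; first apply: C1D; apply: C1M;
  [exact: C1_cst|exact: C1_x1|exact: C1_cst|exact: C1_x2|exact: C1_cst|exact: C1_x3].
Qed.

Lemma has_diff_compose f (s : R3 R -> R3 R) p ds1 ds2 ds3 :
  has_diff (X1 s) p ds1 -> has_diff (X2 s) p ds2 -> has_diff (X3 s) p ds3 ->
  differentiable f (s p) ->
  has_diff (fun x => f (s x)) p (fun v =>
    'D_(std_basis 0) f (s p) * ds1 v + 'D_(std_basis 1) f (s p) * ds2 v +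
    'D_(std_basis 2) f (s p) * ds3 v).
Proof.
move=> [d1 e1] [d2 e2] [d3 e3] df.
have ds : differentiable s p.
  have -> : s = (fun x => (X1 s x, X2 s x, X3 s x)).
    by apply/funext => x; rewrite /X1 /X2 /X3; case: (s x) => -[].
  exact: differentiable_pair (differentiable_pair d1 d2) d3.
split; first by have [] := derive_compose 0 ds df.
move=> v; have [_ ->] := derive_compose v ds df.
rewrite (derive_std _ df) (derive_comps _ ds) /= e1 e2 e3 /GRing.scale /=.
by rewrite !(mulrC (ds1 v)) !(mulrC (ds2 v)) !(mulrC (ds3 v)).
Qed.

Lemma sphere_div_diff (X : R3 R -> R3 R) p d1 d2 d3 :
  has_diff (X1 X) p d1 -> has_diff (X2 X) p d2 -> has_diff (X3 X) p d3 ->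
  sphere_div X p = d1 (std_basis 0) + d2 (std_basis 1) + d3 (std_basis 2) -
    (p.1.1 * d1 p + p.1.2 * d2 p + p.2 * d3 p).
Proof.
move=> [D1 e1] [D2 e2] [D3 e3].
have dX : differentiable X p.
  have -> : X = (fun x => (X1 X x, X2 X x, X3 X x)).
    by apply/funext => x; rewrite /X1 /X2 /X3; case: (X x) => -[].
  exact: differentiable_pair (differentiable_pair D1 D2) D3.
rewrite (sphere_divE dX) /= -(lcombE p dX) !(derive_comps _ dX) /trace dotE /=.
rewrite (derive_comps (std_basis 0) dX) (derive_comps (std_basis 1) dX).
by rewrite (derive_comps (std_basis 2) dX) /= !e1 !e2 !e3.
Qed.

Lemma C1_field (X : R3 R -> R3 R) p : C1 (X1 X) p -> C1 (X2 X) p -> C1 (X3 X) p -> C1 X p.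
Proof.
move=> c1 c2 c3.
have -> : X = (fun x => (X1 X x, X2 X x, X3 X x)).
  by apply/funext => x; rewrite /X1 /X2 /X3; case: (X x) => -[].
exact: C1_pair (C1_pair c1 c2) c3.
Qed.

End Differentials.

(** * Gradients of logarithms of affine functions *)

Section PolarField.
Context {R : realType}.

(** The gradient on the sphere of ln(a + l.x): the tangential part of l divided by a + l.x. *)
Definition polar_field (a : R) (l : R3 R) (x : R3 R) : R3 R :=
  ((l.1.1 - dot l x * x.1.1) / (a + dot l x),
   (l.1.2 - dot l x * x.1.2) / (a + dot l x),
   (l.2 - dot l x * x.2) / (a + dot l x)).

Lemma std_basisE : (std_basis 0 = (1, 0, 0) :> R3 R) * (std_basis 1 = (0, 1, 0) :> R3 R) *
  (std_basis 2 = (0, 0, 1) :> R3 R).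
Proof. by []. Qed.

Lemma polar_field_div a l x : S2 x -> a + dot l x != 0 ->
  sphere_div (polar_field a l) x = (a ^+ 2 - dot l l) / (a + dot l x) ^+ 2 - 1.
Proof.
move=> Sx n0.
have D c (y : R3 R -> R) dy : has_diff y x dy ->
  has_diff (fun x => (c - dot l x * y x) / (a + dot l x)) x (fun v =>
    (0 - (dot l x * dy v + y x * dot l v)) / (a + dot l x) -
    (c - dot l x * y x) / (a + dot l x) * ((0 + dot l v) / (a + dot l x))).
  move=> hy; apply: has_diff_div; first exact: n0.
    apply: has_diffB; first exact: has_diff_cst.
    by apply: has_diffM; [exact: has_diff_dot|exact: hy].
  by apply: has_diffD; [exact: has_diff_cst|exact: has_diff_dot].
rewrite (@sphere_div_diff R (polar_field a l) x _ _ _ (D l.1.1 _ _ (has_diff_x1 x))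
  (D l.1.2 _ _ (has_diff_x2 x)) (D l.2 _ _ (has_diff_x3 x))).
move: Sx n0; rewrite /S2 /= !std_basisE !dotE /=.
case: x D => -[x1 x2] x3 _; case: l => -[l1 l2] l3 /= e n0.
have n : 1 - (x1 * x1 + x2 * x2 + x3 * x3) = 0 by rewrite e subrr.
pose t := l1 * x1 + l2 * x2 + l3 * x3.
(* The ambient formula differs from the claim by a multiple of 1 - |x|^2. *)
transitivity ((a ^+ 2 - (l1 * l1 + l2 * l2 + l3 * l3)) / (a + t) ^+ 2 - 1 +
  (1 - (x1 * x1 + x2 * x2 + x3 * x3)) * (t ^+ 2 / (a + t) ^+ 2 - 2 * t / (a + t))).
  by rewrite /t; field.
by rewrite n mul0r addr0.
Qed.

Lemma polar_field_tangent a l : (forall x, S2 x -> a + dot l x != 0) ->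
  C1_tangent_field (polar_field a l).
Proof.
move=> n0; split => [p Sp|p Sp].
  rewrite [dot p _]dotE /polar_field /=.
  have e := Sp; rewrite /S2 /= dotE in e.
  transitivity (dot l p * (1 - (p.1.1 * p.1.1 + p.1.2 * p.1.2 + p.2 * p.2)) / (a + dot l p)).
    by move: (n0 p Sp); rewrite !dotE => np; field.
  by rewrite e subrr mulr0 mul0r.
have C c (y : R3 R -> R) : C1 y p -> C1 (fun x => (c - dot l x * y x) / (a + dot l x)) p.
  move=> cy; apply: C1M.
    exact: (C1B (C1_cst _ _) (C1M (C1_dot _ _) cy)).
  exact: (C1V (n0 _ Sp) (C1D (C1_cst _ _) (C1_dot _ _))).
by apply: C1_field; apply: C; [exact: C1_x1|exact: C1_x2|exact: C1_x3].
Qed.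

Lemma dot_sqr_le (x y : R3 R) : dot x y ^+ 2 <= dot x x * dot y y.
Proof.
rewrite -subr_ge0 !dotE; case: x => -[x1 x2] x3; case: y => -[y1 y2] y3 /=.
rewrite (_ : _ - _ = (x1 * y2 - x2 * y1) ^+ 2 + (x1 * y3 - x3 * y1) ^+ 2 +
  (x2 * y3 - x3 * y2) ^+ 2); last by ring.
by rewrite !addr_ge0// sqr_ge0.
Qed.

Lemma affine_pos (a : R) (l x : R3 R) : 0 < a -> dot l l < a ^+ 2 -> S2 x -> 0 < a + dot l x.
Proof.
move=> a0 la Sx; have := dot_sqr_le l x; rewrite [dot x x]Sx mulr1 => h.
have : `|dot l x| < a.
  rewrite -(@ltr_pXn2r _ 2)// ?nnegrE ?ltW// real_normK ?num_real//.
  exact: le_lt_trans la.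
by rewrite ltr_norml => /andP[+ _]; rewrite -subr_gt0 opprK addrC.
Qed.

(** The divergence theorem applied to [polar_field a l], whose divergence is the integrand minus
    1. *)
Lemma poisson_mean (a : R) (l : R3 R) : 0 < a -> dot l l < a ^+ 2 ->
  \int[domega]_(x in S2) ((a ^+ 2 - dot l l) / (a + dot l x) ^+ 2) = 1.
Proof.
move=> a0 la.
have n0 x : S2 x -> a + dot l x != 0 by move=> Sx; rewrite gt_eqF// affine_pos.
have tX := polar_field_tangent n0.
have := divergence_theorem tX.
have -> : \int[domega]_(x in S2) sphere_div (polar_field a l) x =
   \int[domega]_(x in S2) ((a ^+ 2 - dot l l) / (a + dot l x) ^+ 2 - 1).
  by apply: eq_Rintegral => x /set_mem Sx; rewrite polar_field_div// n0.
have i1 : domega.-integrable (@S2 R) (EFin \o (fun x => (a ^+ 2 - dot l l) / (a + dot l x) ^+ 2)).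
  apply: continuous_integrable_S2 => p Sp; apply: C1_cont.
  apply: C1M; first exact: C1_cst.
  have Ca : C1 (fun x => a + dot l x) p by exact: (C1D (C1_cst _ _) (C1_dot _ _)).
  apply: C1V; first by rewrite expf_neq0// n0.
  exact: (C1M Ca Ca).
have i2 : domega.-integrable (@S2 R) (EFin \o (fun=> 1)).
  by apply: continuous_integrable_S2 => p Sp; exact: cst_continuous.
by rewrite (RintegralB measurable_S2 i1 i2) Rintegral_cst_S2 => /subr0_eq.
Qed.

End PolarField.

(** * Lorentz matrices and their action on the sphere *)

Section Lorentz.
Context {R : realType}.

(* The matrix L = [[la, ll], [lN, M]], where M has rows m1, m2, m3.  With
   eta = diag(1, -1, -1, -1), linv L is eta L^T eta and lorentz_rows L says that
   L eta L^T = eta. *)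
Record lorentz := Lorentz {
  la : R; ll : R3 R; lN : R3 R; m1 : R3 R; m2 : R3 R; m3 : R3 R }.

Definition linv (L : lorentz) : lorentz :=
  {| la := la L;
     ll := (- (lN L).1.1, - (lN L).1.2, - (lN L).2);
     lN := (- (ll L).1.1, - (ll L).1.2, - (ll L).2);
     m1 := ((m1 L).1.1, (m2 L).1.1, (m3 L).1.1);
     m2 := ((m1 L).1.2, (m2 L).1.2, (m3 L).1.2);
     m3 := ((m1 L).2, (m2 L).2, (m3 L).2) |}.

Record lorentz_rows (L : lorentz) : Prop := LorentzRows {
  row00 : dot (ll L) (ll L) = la L ^+ 2 - 1;
  row01 : dot (ll L) (m1 L) = la L * (lN L).1.1;
  row02 : dot (ll L) (m2 L) = la L * (lN L).1.2;
  row03 : dot (ll L) (m3 L) = la L * (lN L).2;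
  row11 : dot (m1 L) (m1 L) = 1 + (lN L).1.1 * (lN L).1.1;
  row12 : dot (m1 L) (m2 L) = (lN L).1.1 * (lN L).1.2;
  row13 : dot (m1 L) (m3 L) = (lN L).1.1 * (lN L).2;
  row22 : dot (m2 L) (m2 L) = 1 + (lN L).1.2 * (lN L).1.2;
  row23 : dot (m2 L) (m3 L) = (lN L).1.2 * (lN L).2;
  row33 : dot (m3 L) (m3 L) = 1 + (lN L).2 * (lN L).2 }.

(** The rows of [linv L] are, up to signs, the columns of L. Both L eta L^T = eta and L^T eta L =
    eta are thus at hand, and the condition is symmetric under inversion. *)
Definition is_lorentz (L : lorentz) : Prop :=
  [/\ 0 < la L, lorentz_rows L & lorentz_rows (linv L)].

Definition ell (L : lorentz) (x : R3 R) : R := la L + dot (ll L) x.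

Definition act (L : lorentz) (x : R3 R) : R3 R :=
  (((lN L).1.1 + dot (m1 L) x) / ell L x,
   ((lN L).1.2 + dot (m2 L) x) / ell L x,
   ((lN L).2 + dot (m3 L) x) / ell L x).

Lemma linvK L : linv (linv L) = L.
Proof.
case: L => a [[l1 l2] l3] [[n1 n2] n3] [[a1 a2] a3] [[b1 b2] b3] [[c1 c2] c3].
by rewrite /linv /= !opprK.
Qed.

Lemma is_lorentz_inv L : is_lorentz L -> is_lorentz (linv L).
Proof. by move=> [a r s]; split => //; rewrite linvK. Qed.

Lemma ll_lt L : is_lorentz L -> dot (ll L) (ll L) < la L ^+ 2.
Proof. by move=> [_ [-> _ _ _ _ _ _ _ _ _] _]; rewrite ltrBlDr ltrDl. Qed.

Lemma ell_gt0 L x : is_lorentz L -> S2 x -> 0 < ell L x.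
Proof. by move=> hL Sx; apply: affine_pos => //; [case: hL|exact: ll_lt]. Qed.

(** The relations L^T eta L = eta, expanded into the very sums that the computations below
    isolate. *)
Lemma lorentz_cols L : is_lorentz L -> let: Lorentz a l n p q r := L in
  [/\ dot n n = a ^+ 2 - 1,
   [/\ n.1.1 * p.1.1 + n.1.2 * q.1.1 + n.2 * r.1.1 = a * l.1.1,
    n.1.1 * p.1.2 + n.1.2 * q.1.2 + n.2 * r.1.2 = a * l.1.2 &
    n.1.1 * p.2 + n.1.2 * q.2 + n.2 * r.2 = a * l.2],
   [/\ p.1.1 * p.1.1 + q.1.1 * q.1.1 + r.1.1 * r.1.1 = 1 + l.1.1 * l.1.1,
    p.1.2 * p.1.2 + q.1.2 * q.1.2 + r.1.2 * r.1.2 = 1 + l.1.2 * l.1.2 &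
    p.2 * p.2 + q.2 * q.2 + r.2 * r.2 = 1 + l.2 * l.2] &
   [/\ p.1.1 * p.1.2 + q.1.1 * q.1.2 + r.1.1 * r.1.2 = l.1.1 * l.1.2,
    p.1.1 * p.2 + q.1.1 * q.2 + r.1.1 * r.2 = l.1.1 * l.2 &
    p.1.2 * p.2 + q.1.2 * q.2 + r.1.2 * r.2 = l.1.2 * l.2]].
Proof.
case: L => a [[l1 l2] l3] [[n1 n2] n3] [[a1 a2] a3] [[b1 b2] b3] [[c1 c2] c3] [_ _].
rewrite /linv /= => -[] /=; rewrite !dotE /= => h00 h01 h02 h03 h11 h12 h13 h22 h23 h33.
split; first by rewrite -h00; ring.
- by split; apply: oppr_inj; rewrite -mulrN -?h01 -?h02 -?h03; ring.
- by split; rewrite ?h11 ?h22 ?h33; ring.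
- by split; rewrite ?h12 ?h13 ?h23; ring.
Qed.

(** For a unit vector x, (1, x) is a null vector; L sends it to [ell L x] times (1, [act L x]),
    which is null again. *)
Lemma act_S2 L x : is_lorentz L -> S2 x -> S2 (act L x).
Proof.
move=> hL Sx; have := ell_gt0 hL Sx; have := lorentz_cols hL; move: Sx.
case: L hL => a l n p q r _; rewrite /act /ell /S2 /= !dotE /=.
move=> e [h [h1 h2 h3] [h11 h22 h33] [h12 h13 h23]] g0.
set g := a + (l.1.1 * x.1.1 + l.1.2 * x.1.2 + l.2 * x.2) in g0 *; have gn0 : g != 0 by rewrite gt_eqF.
transitivity ((n.1.1 * n.1.1 + n.1.2 * n.1.2 + n.2 * n.2 +
 2 * (x.1.1 * (n.1.1 * p.1.1 + n.1.2 * q.1.1 + n.2 * r.1.1) +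
      x.1.2 * (n.1.1 * p.1.2 + n.1.2 * q.1.2 + n.2 * r.1.2) +
      x.2 * (n.1.1 * p.2 + n.1.2 * q.2 + n.2 * r.2)) +
 x.1.1 * x.1.1 * (p.1.1 * p.1.1 + q.1.1 * q.1.1 + r.1.1 * r.1.1) +
 x.1.2 * x.1.2 * (p.1.2 * p.1.2 + q.1.2 * q.1.2 + r.1.2 * r.1.2) +
 x.2 * x.2 * (p.2 * p.2 + q.2 * q.2 + r.2 * r.2) +
 2 * (x.1.1 * x.1.2 * (p.1.1 * p.1.2 + q.1.1 * q.1.2 + r.1.1 * r.1.2) +
      x.1.1 * x.2 * (p.1.1 * p.2 + q.1.1 * q.2 + r.1.1 * r.2) +
      x.1.2 * x.2 * (p.1.2 * p.2 + q.1.2 * q.2 + r.1.2 * r.2))) / g ^+ 2).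
  by field.
rewrite h1 h2 h3 h11 h22 h33 h12 h13 h23 h.
transitivity ((g ^+ 2 + (x.1.1 * x.1.1 + x.1.2 * x.1.2 + x.2 * x.2 - 1)) / g ^+ 2).
  by congr (_ / _); rewrite /g; ring.
by rewrite e subrr addr0 divff// expf_neq0.
Qed.

(** The time component of L^-1 (1, act x) = (1, x) / ell(x). The space components of the same
    identity give [actK]. *)
Lemma ell_act L x : is_lorentz L -> S2 x -> ell (linv L) (act L x) = (ell L x)^-1.
Proof.
move=> hL Sx; have := ell_gt0 hL Sx; have := lorentz_cols hL; move: Sx.
case: L hL => a l n p q r _; rewrite /act /ell /S2 /= !dotE /=.
move=> e [h [h1 h2 h3] _ _] g0.
set g := a + (l.1.1 * x.1.1 + l.1.2 * x.1.2 + l.2 * x.2) in g0 *; have gn0 : g != 0 by rewrite gt_eqF.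
transitivity ((a * g - (n.1.1 * n.1.1 + n.1.2 * n.1.2 + n.2 * n.2) -
  (x.1.1 * (n.1.1 * p.1.1 + n.1.2 * q.1.1 + n.2 * r.1.1) +
      x.1.2 * (n.1.1 * p.1.2 + n.1.2 * q.1.2 + n.2 * r.1.2) +
      x.2 * (n.1.1 * p.2 + n.1.2 * q.2 + n.2 * r.2))) / g); first by field.
by rewrite h1 h2 h3 h -[RHS]mul1r; congr (_ / _); rewrite /g; ring.
Qed.

Lemma actK L x : is_lorentz L -> S2 x -> act (linv L) (act L x) = x.
Proof.
move=> hL Sx; rewrite /act ell_act// invrK; have := ell_gt0 hL Sx.
have := lorentz_cols hL; move: Sx.
case: L hL => a l n p q r _; case: x => -[x1 x2] x3; rewrite /act /ell /S2 /= !dotE /=.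
move=> e [h [h1 h2 h3] [h11 h22 h33] [h12 h13 h23]] g0.
set g := a + (l.1.1 * x1 + l.1.2 * x2 + l.2 * x3) in g0 *; have gn0 : g != 0 by rewrite gt_eqF.
congr (_, _, _).
- transitivity (- l.1.1 * g + (n.1.1 * p.1.1 + n.1.2 * q.1.1 + n.2 * r.1.1) +
    x1 * (p.1.1 * p.1.1 + q.1.1 * q.1.1 + r.1.1 * r.1.1) +
    x2 * (p.1.1 * p.1.2 + q.1.1 * q.1.2 + r.1.1 * r.1.2) +
    x3 * (p.1.1 * p.2 + q.1.1 * q.2 + r.1.1 * r.2)); first by field.
  by rewrite h1 h11 h12 h13 /g; ring.
- transitivity (- l.1.2 * g + (n.1.1 * p.1.2 + n.1.2 * q.1.2 + n.2 * r.1.2) +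
    x1 * (p.1.1 * p.1.2 + q.1.1 * q.1.2 + r.1.1 * r.1.2) +
    x2 * (p.1.2 * p.1.2 + q.1.2 * q.1.2 + r.1.2 * r.1.2) +
    x3 * (p.1.2 * p.2 + q.1.2 * q.2 + r.1.2 * r.2)); first by field.
  by rewrite h2 h22 h12 h23 /g; ring.
- transitivity (- l.2 * g + (n.1.1 * p.2 + n.1.2 * q.2 + n.2 * r.2) +
    x1 * (p.1.1 * p.2 + q.1.1 * q.2 + r.1.1 * r.2) +
    x2 * (p.1.2 * p.2 + q.1.2 * q.2 + r.1.2 * r.2) +
    x3 * (p.2 * p.2 + q.2 * q.2 + r.2 * r.2)); first by field.
  by rewrite h3 h33 h13 h23 /g; ring.
Qed.

(* M^T X(act y) + (lN . X(act y)) y, divided by ell y: up to the conformal factor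
   this is the pull-back of the field X by [act L]. *)
Definition pull_vec (L : lorentz) (y V : R3 R) : R3 R :=
  let k := dot (lN L) V in
  (((m1 L).1.1 * V.1.1 + (m2 L).1.1 * V.1.2 + (m3 L).1.1 * V.2 + k * y.1.1) / ell L y,
   ((m1 L).1.2 * V.1.1 + (m2 L).1.2 * V.1.2 + (m3 L).1.2 * V.2 + k * y.1.2) / ell L y,
   ((m1 L).2 * V.1.1 + (m2 L).2 * V.1.2 + (m3 L).2 * V.2 + k * y.2) / ell L y).

Definition pull_field (L : lorentz) (X : R3 R -> R3 R) (y : R3 R) : R3 R :=
  pull_vec L y (X (act L y)).

Lemma C1_ell L p : C1 (ell L) p.
Proof. exact: (C1D (C1_cst _ _) (C1_dot _ _)). Qed.

Lemma C1_act L p : ell L p != 0 -> C1 (act L) p.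
Proof.
move=> n0; have cV := C1V n0 (C1_ell L p).
by apply: C1_field; apply: (C1M _ cV); exact: (C1D (C1_cst _ _) (C1_dot _ _)).
Qed.

Lemma pull_vec_tangent L y V : is_lorentz L -> S2 y -> dot (act L y) V = 0 ->
  dot y (pull_vec L y V) = 0.
Proof.
move=> hL Sy tV; have g0 := ell_gt0 hL Sy.
rewrite /pull_vec /= dotE /=.
have gn0 : ell L y != 0 by rewrite gt_eqF.
move: Sy; rewrite /S2 /= dotE => e.
transitivity (dot (act L y) V + dot (lN L) V * (y.1.1 * y.1.1 + y.1.2 * y.1.2 + y.2 * y.2 - 1) / ell L y).
  by rewrite /act [dot (_, _, _) V]dotE (dotE (lN L)) (dotE (m1 L)) (dotE (m2 L)) (dotE (m3 L)) /=; field.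
by rewrite tV e subrr mulr0 mul0r addr0.
Qed.

Lemma pull_field_tangent L X : is_lorentz L -> C1_tangent_field X ->
  C1_tangent_field (pull_field L X).
Proof.
move=> hL [tX dX]; split => [y Sy|y Sy].
  by apply: pull_vec_tangent => //; apply: tX; exact: act_S2.
have n0 : ell L y != 0 by rewrite gt_eqF// ell_gt0.
have [c1 c2 c3] := C1_comps (C1_compose (C1_act n0) (dX _ (act_S2 hL Sy))).
have ck : C1 (fun y => dot (lN L) (X (act L y))) y.
  exact: (C1_compose (C1_compose (C1_act n0) (dX _ (act_S2 hL Sy))) (C1_dot _ _)).
have cV := C1V n0 (C1_ell L y).
have C a b c (z : R3 R -> R) : C1 z y -> C1 (fun y => (a * X1 (fun y => X (act L y)) y +
    b * X2 (fun y => X (act L y)) y + c * X3 (fun y => X (act L y)) y +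
    dot (lN L) (X (act L y)) * z y) / ell L y) y.
  move=> cz; apply: (C1M _ cV).
  exact: (C1D (C1D (C1D (C1M (C1_cst a y) c1) (C1M (C1_cst b y) c2))
    (C1M (C1_cst c y) c3)) (C1M ck cz)).
by apply: C1_field; [exact: (C _ _ _ _ (C1_x1 y))|exact: (C _ _ _ _ (C1_x2 y))|
  exact: (C _ _ _ _ (C1_x3 y))].
Qed.

End Lorentz.

(** * The divergence of a pulled-back field *)

Section Piola.
Context {R : realType}.

(** [pull_field_div] in coordinates: e is [ell L y]; l, n and p, q, r are [ll], [lN] and the rows of
    M; s is [act L y], V the field at s and (a_ij) its Jacobian matrix there. [w1], [w2], [w3] are
    the derivatives of [act L] in a direction v, the [B] those of the field along it, and [d]
    differentiates one component of the pulled-back field. *)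
Lemma piola_identity (a e l1 l2 l3 n1 n2 n3 p1 p2 p3 q1 q2 q3 r1 r2 r3 y1 y2 y3 s1 s2 s3
    V1 V2 V3 a11 a12 a13 a21 a22 a23 a31 a32 a33 : R) :
  let iv := e^-1 in
  e != 0 -> l1 * y1 + l2 * y2 + l3 * y3 = e - a ->
  p1 * y1 + p2 * y2 + p3 * y3 = e * s1 - n1 ->
  q1 * y1 + q2 * y2 + q3 * y3 = e * s2 - n2 ->
  r1 * y1 + r2 * y2 + r3 * y3 = e * s3 - n3 ->
  l1 * p1 + l2 * p2 + l3 * p3 = a * n1 ->
  l1 * q1 + l2 * q2 + l3 * q3 = a * n2 ->
  l1 * r1 + l2 * r2 + l3 * r3 = a * n3 ->
  p1 * p1 + p2 * p2 + p3 * p3 = 1 + n1 * n1 ->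
  p1 * q1 + p2 * q2 + p3 * q3 = n1 * n2 ->
  p1 * r1 + p2 * r2 + p3 * r3 = n1 * n3 ->
  q1 * q1 + q2 * q2 + q3 * q3 = 1 + n2 * n2 ->
  q1 * r1 + q2 * r2 + q3 * r3 = n2 * n3 ->
  r1 * r1 + r2 * r2 + r3 * r3 = 1 + n3 * n3 ->
  y1 * y1 + y2 * y2 + y3 * y3 = 1 ->
  s1 * V1 + s2 * V2 + s3 * V3 = 0 ->
  let k := n1 * V1 + n2 * V2 + n3 * V3 in
  s1 * (a11 * n1 + a12 * n2 + a13 * n3) + s2 * (a21 * n1 + a22 * n2 + a23 * n3) +
    s3 * (a31 * n1 + a32 * n2 + a33 * n3) =
  (a - iv) * (s1 * (a11 * s1 + a12 * s2 + a13 * s3) + s2 * (a21 * s1 + a22 * s2 + a23 * s3) +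
    s3 * (a31 * s1 + a32 * s2 + a33 * s3)) - k ->
  let L v1 v2 v3 := (l1 * v1 + l2 * v2 + l3 * v3) * iv in
  let w1 v1 v2 v3 := (p1 * v1 + p2 * v2 + p3 * v3) * iv - s1 * L v1 v2 v3 in
  let w2 v1 v2 v3 := (q1 * v1 + q2 * v2 + q3 * v3) * iv - s2 * L v1 v2 v3 in
  let w3 v1 v2 v3 := (r1 * v1 + r2 * v2 + r3 * v3) * iv - s3 * L v1 v2 v3 in
  let B1 v1 v2 v3 := a11 * w1 v1 v2 v3 + a12 * w2 v1 v2 v3 + a13 * w3 v1 v2 v3 in
  let B2 v1 v2 v3 := a21 * w1 v1 v2 v3 + a22 * w2 v1 v2 v3 + a23 * w3 v1 v2 v3 in
  let B3 v1 v2 v3 := a31 * w1 v1 v2 v3 + a32 * w2 v1 v2 v3 + a33 * w3 v1 v2 v3 in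
  let d (b1 b2 b3 y vj v1 v2 v3 : R) :=
    (b1 * B1 v1 v2 v3 + b2 * B2 v1 v2 v3 + b3 * B3 v1 v2 v3 +
     (k * vj + y * (n1 * B1 v1 v2 v3 + n2 * B2 v1 v2 v3 + n3 * B3 v1 v2 v3))) * iv -
    (b1 * V1 + b2 * V2 + b3 * V3 + k * y) * iv * L v1 v2 v3 in
  d p1 q1 r1 y1 1 1 0 0 + d p2 q2 r2 y2 1 0 1 0 + d p3 q3 r3 y3 1 0 0 1 -
  (y1 * d p1 q1 r1 y1 y1 y1 y2 y3 + y2 * d p2 q2 r2 y2 y2 y1 y2 y3 +
   y3 * d p3 q3 r3 y3 y3 y1 y2 y3) =
  iv ^+ 2 * (a11 + a22 + a33 - (s1 * (a11 * s1 + a12 * s2 + a13 * s3) +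
    s2 * (a21 * s1 + a22 * s2 + a23 * s3) + s3 * (a31 * s1 + a32 * s2 + a33 * s3))).
Proof.
move=> iv e0 ly py qy ry lp lq lr pp pq pr qq qr rr yy sV k tang L w1 w2 w3 B1 B2 B3 d.
pose C mm sk lm mi mk := mm - sk * lm - mi * (mk - sk * (l1 * y1 + l2 * y2 + l3 * y3)).
pose lp' := l1 * p1 + l2 * p2 + l3 * p3; pose lq' := l1 * q1 + l2 * q2 + l3 * q3.
pose lr' := l1 * r1 + l2 * r2 + l3 * r3; pose py' := p1 * y1 + p2 * y2 + p3 * y3.
pose qy' := q1 * y1 + q2 * y2 + q3 * y3; pose ry' := r1 * y1 + r2 * y2 + r3 * y3.
pose pq' := p1 * q1 + p2 * q2 + p3 * q3; pose pr' := p1 * r1 + p2 * r2 + p3 * r3.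
pose qr' := q1 * r1 + q2 * r2 + q3 * r3.
(* Groups the expansion so that every sum to which a row relation applies is visible; the last
   summand carries the factor 1 - |y|^2. *)
transitivity (iv ^+ 2 *
  (a11 * C (p1 * p1 + p2 * p2 + p3 * p3) s1 lp' py' py' + a12 * C pq' s2 lp' py' qy' +
   a13 * C pr' s3 lp' py' ry' +
   a21 * C pq' s1 lq' qy' py' + a22 * C (q1 * q1 + q2 * q2 + q3 * q3) s2 lq' qy' qy' +
   a23 * C qr' s3 lq' qy' ry' +
   a31 * C pr' s1 lr' ry' py' + a32 * C qr' s2 lr' ry' qy' +
   a33 * C (r1 * r1 + r2 * r2 + r3 * r3) s3 lr' ry' ry') + 2 * k * iv -
  iv ^+ 2 * (V1 * (lp' - (l1 * y1 + l2 * y2 + l3 * y3) * py') +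
    V2 * (lq' - (l1 * y1 + l2 * y2 + l3 * y3) * qy') +
    V3 * (lr' - (l1 * y1 + l2 * y2 + l3 * y3) * ry')) +
  (1 - (y1 * y1 + y2 * y2 + y3 * y3)) * (k * iv +
   iv * (n1 * B1 y1 y2 y3 + n2 * B2 y1 y2 y3 + n3 * B3 y1 y2 y3) - iv * k * L y1 y2 y3)).
  rewrite /d /B1 /B2 /B3 /w1 /w2 /w3 /L /C /lp' /lq' /lr' /py' /qy' /ry' /pq' /pr' /qr' /k.
  ring.
rewrite /C /lp' /lq' /lr' /py' /qy' /ry' /pq' /pr' /qr' ly py qy ry lp lq lr pp pq pr qq qr rr yy.
rewrite subrr mul0r addr0.
pose Q := s1 * (a11 * s1 + a12 * s2 + a13 * s3) +
    s2 * (a21 * s1 + a22 * s2 + a23 * s3) + s3 * (a31 * s1 + a32 * s2 + a33 * s3).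
pose T := s1 * (a11 * n1 + a12 * n2 + a13 * n3) + s2 * (a21 * n1 + a22 * n2 + a23 * n3) +
    s3 * (a31 * n1 + a32 * n2 + a33 * n3).
pose D := s1 * V1 + s2 * V2 + s3 * V3.
(* After the substitutions only three contractions remain besides the trace and k. Tangency gives D
   = 0, and the differentiated tangency expresses T through Q. *)
transitivity (iv ^+ 2 * (a11 + a22 + a33 - a * e * Q + e * T) + 2 * k * iv -
  iv ^+ 2 * (a * k - (e - a) * (e * D - k))).
  by rewrite /Q /T /D /k; ring.
rewrite /D sV /T tang -/Q mulr0 sub0r /iv; move: (Q) (k) => Q' k'.
by field.
Qed.

(** In its application b is the product of n and p, so n - b p is the tangential part of n at p. The
    derivative of the tangency relation along it is solved for the product of p with A n. *)
Lemma tangent_split (b p1 p2 p3 n1 n2 n3 V1 V2 V3 a11 a12 a13 a21 a22 a23 a31 a32 a33 : R) :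
  p1 * V1 + p2 * V2 + p3 * V3 = 0 ->
  p1 * ((n1 - b * p1) * a11 + (n2 - b * p2) * a12 + (n3 - b * p3) * a13) +
  p2 * ((n1 - b * p1) * a21 + (n2 - b * p2) * a22 + (n3 - b * p3) * a23) +
  p3 * ((n1 - b * p1) * a31 + (n2 - b * p2) * a32 + (n3 - b * p3) * a33) =
  - ((n1 - b * p1) * V1 + (n2 - b * p2) * V2 + (n3 - b * p3) * V3) ->
  p1 * (a11 * n1 + a12 * n2 + a13 * n3) + p2 * (a21 * n1 + a22 * n2 + a23 * n3) +
    p3 * (a31 * n1 + a32 * n2 + a33 * n3) =
  b * (p1 * (a11 * p1 + a12 * p2 + a13 * p3) + p2 * (a21 * p1 + a22 * p2 + a23 * p3) +
    p3 * (a31 * p1 + a32 * p2 + a33 * p3)) - (n1 * V1 + n2 * V2 + n3 * V3).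
Proof.
set Q := p1 * (a11 * p1 + a12 * p2 + a13 * p3) + p2 * (a21 * p1 + a22 * p2 + a23 * p3) +
    p3 * (a31 * p1 + a32 * p2 + a33 * p3).
move=> pV tw; apply: (addrI (- (b * Q))); rewrite addKr.
apply: (etrans _ (etrans tw _)); first by rewrite /Q; ring.
by rewrite -[RHS]addr0 -[X in _ = _ + X](mulr0 b) -pV; ring.
Qed.

(** The differential of [act L] is 1/ell times an isometry of tangent planes, so its adjoint, which
    [pull_vec] computes on tangent vectors, equals the Jacobian ell^-2 times its inverse. Hence the
    pulled-back field is the Piola transform of X, whose divergence is the Jacobian times the
    divergence at the image point. *)
Lemma pull_field_div (L : lorentz) (X : R3 R -> R3 R) y : is_lorentz L ->
  C1_tangent_field X -> S2 y ->
  sphere_div (pull_field L X) y = (ell L y) ^- 2 * sphere_div X (act L y).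
Proof.
move=> hL hX Sy; have e0 := ell_gt0 hL Sy; have en0 : ell L y != 0 by rewrite gt_eqF.
have Sp := act_S2 hL Sy; set p := act L y in Sp *.
have cX := hX.2 _ Sp; have dX := C1_diff cX; have [c1 c2 c3] := C1_comps cX.
have he : has_diff (ell L) y (fun v => dot (ll L) v).
  exact: (has_diff_eq (has_diffD (has_diff_cst (la L) y) (has_diff_dot (ll L) y)) (fun v => add0r _)).
have hs c m : has_diff (fun y => (c + dot m y) / ell L y) y
    (fun v => dot m v / ell L y - (c + dot m y) / ell L y * (dot (ll L) v / ell L y)).
  apply: (has_diff_eq (has_diff_div en0 (has_diffD (has_diff_cst c y) (has_diff_dot m y)) he)).
  by move=> v; rewrite /= add0r.
have hc f (df : differentiable f p) := @has_diff_compose R f (act L) y _ _ _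
  (hs (lN L).1.1 (m1 L)) (hs (lN L).1.2 (m2 L)) (hs (lN L).2 (m3 L)) df.
have h1 := hc _ (C1_diff c1); have h2 := hc _ (C1_diff c2); have h3 := hc _ (C1_diff c3).
have hk := has_diffD (has_diffD (has_diffM (has_diff_cst (lN L).1.1 y) h1)
    (has_diffM (has_diff_cst (lN L).1.2 y) h2)) (has_diffM (has_diff_cst (lN L).2 y) h3).
have ek : (fun y => dot (lN L) (X (act L y))) = (fun y => (lN L).1.1 * X1 X (act L y) +
    (lN L).1.2 * X2 X (act L y) + (lN L).2 * X3 X (act L y)).
  by apply/funext => z; rewrite dotE.
rewrite -ek in hk.
have hY b1 b2 b3 (z : R3 R -> R) dz (hz : has_diff z y dz) := has_diff_div en0
  (has_diffD (has_diffD (has_diffD (has_diffM (has_diff_cst b1 y) h1)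
    (has_diffM (has_diff_cst b2 y) h2)) (has_diffM (has_diff_cst b3 y) h3))
    (has_diffM hk hz)) he.
have H1 := hY (m1 L).1.1 (m2 L).1.1 (m3 L).1.1 _ _ (has_diff_x1 y).
have H2 := hY (m1 L).1.2 (m2 L).1.2 (m3 L).1.2 _ _ (has_diff_x2 y).
have H3 := hY (m1 L).2 (m2 L).2 (m3 L).2 _ _ (has_diff_x3 y).
have [a0 [k00 k01 k02 k03 k11 k12 k13 k22 k23 k33] _] := hL.
have pn : dot (lN L) p = la L - (ell L y)^-1.
  rewrite -(ell_act hL Sy) -/p /ell /linv /= !dotE /=; ring.
(* The tangential part of [lN L] at [p]; the coefficient is their product, known from [ell_act]. *)
pose w : R3 R := ((lN L).1.1 - (la L - (ell L y)^-1) * p.1.1,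
  (lN L).1.2 - (la L - (ell L y)^-1) * p.1.2, (lN L).2 - (la L - (ell L y)^-1) * p.2).
have pp : dot p p = 1 by exact: Sp.
have pw : dot p w = 0.
  transitivity (dot (lN L) p - (la L - (ell L y)^-1) * dot p p).
    by rewrite !dotE /w /=; ring.
  by rewrite pp mulr1 pn subrr.
have pV : dot p (X p) = 0 by exact: hX.1.
have sc (u v : R) : u *: v = u * v by [].
have tw := tangent_derive hX Sp pw.
rewrite (derive_comps _ dX) (derive_std w (C1_diff c1)) (derive_std w (C1_diff c2)) in tw.
rewrite (derive_std w (C1_diff c3)) !sc !dotE /= in tw.
rewrite !dotE in pV.
have tg := @tangent_split (la L - (ell L y)^-1) p.1.1 p.1.2 p.2 (lN L).1.1 (lN L).1.2 (lN L).2
  (X p).1.1 (X p).1.2 (X p).2 _ _ _ _ _ _ _ _ _ pV tw.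
rewrite !dotE in k00 k01 k02 k03 k11 k12 k13 k22 k23 k33.
have Sy' := Sy; rewrite /S2 /= dotE in Sy'.
rewrite (@sphere_div_diff R (pull_field L X) y _ _ _ H1 H2 H3).
rewrite (@sphere_div_diff R X p _ _ _ (conj (C1_diff c1) (fun v => erefl))
  (conj (C1_diff c2) (fun v => erefl)) (conj (C1_diff c3) (fun v => erefl))).
have I := @piola_identity (la L) (ell L y) (ll L).1.1 (ll L).1.2 (ll L).2
  (lN L).1.1 (lN L).1.2 (lN L).2 (m1 L).1.1 (m1 L).1.2 (m1 L).2 (m2 L).1.1 (m2 L).1.2 (m2 L).2
  (m3 L).1.1 (m3 L).1.2 (m3 L).2 y.1.1 y.1.2 y.2 p.1.1 p.1.2 p.2
  (X p).1.1 (X p).1.2 (X p).2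
  ('D_(std_basis 0) (X1 X) p) ('D_(std_basis 1) (X1 X) p) ('D_(std_basis 2) (X1 X) p)
  ('D_(std_basis 0) (X2 X) p) ('D_(std_basis 1) (X2 X) p) ('D_(std_basis 2) (X2 X) p)
  ('D_(std_basis 0) (X3 X) p) ('D_(std_basis 1) (X3 X) p) ('D_(std_basis 2) (X3 X) p) en0.
have en m c : (c + dot m y) / ell L y * ell L y = c + dot m y by rewrite divfK.
have f1 : (ll L).1.1 * y.1.1 + (ll L).1.2 * y.1.2 + (ll L).2 * y.2 = ell L y - la L.
  by rewrite -dotE /ell; ring.
have f2 : (m1 L).1.1 * y.1.1 + (m1 L).1.2 * y.1.2 + (m1 L).2 * y.2 = ell L y * p.1.1 - (lN L).1.1.
  by rewrite -dotE /p /act /= mulrC en; ring.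
have f3 : (m2 L).1.1 * y.1.1 + (m2 L).1.2 * y.1.2 + (m2 L).2 * y.2 = ell L y * p.1.2 - (lN L).1.2.
  by rewrite -dotE /p /act /= mulrC en; ring.
have f4 : (m3 L).1.1 * y.1.1 + (m3 L).1.2 * y.1.2 + (m3 L).2 * y.2 = ell L y * p.2 - (lN L).2.
  by rewrite -dotE /p /act /= mulrC en; ring.
have {}I := I f1 f2 f3 f4 k01 k02 k03 k11 k12 k13 k22 k23 k33 Sy' pV.
have g1 : ((lN L).1.1 + dot (m1 L) y) / ell L y = p.1.1 by [].
have g2 : ((lN L).1.2 + dot (m2 L) y) / ell L y = p.1.2 by [].
have g3 : ((lN L).2 + dot (m3 L) y) / ell L y = p.2 by [].
rewrite !g1 !g2 !g3 -/p.
clear g1 g2 g3 hY H1 H2 H3 hk ek h1 h2 h3 hc hs.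
clearbody p.
rewrite (derive_std p (C1_diff c1)) (derive_std p (C1_diff c2)) (derive_std p (C1_diff c3)) !sc.
rewrite !std_basisE /X1 /X2 /X3 -/(X1 X) -/(X2 X) -/(X3 X) !dotE /= -!std_basisE.
have {}I := I tg.
rewrite -exprVn; move: I.
move: ('D_(std_basis 0) (X1 X) p) ('D_(std_basis 1) (X1 X) p) ('D_(std_basis 2) (X1 X) p)
  ('D_(std_basis 0) (X2 X) p) ('D_(std_basis 1) (X2 X) p) ('D_(std_basis 2) (X2 X) p)
  ('D_(std_basis 0) (X3 X) p) ('D_(std_basis 1) (X3 X) p) ('D_(std_basis 2) (X3 X) p).
move: p y (ell L y)^-1 (m1 L) (m2 L) (m3 L) (ll L) (lN L) (X p) {tw tg Sp cX dX c1 c2 c3 pV pn pp pw w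
  f1 f2 f3 f4 k00 k01 k02 k03 k11 k12 k13 k22 k23 k33 en0 he en e0 Sy Sy'}.
move=> [[s1 s2] s3] [[y1 y2] y3] e [[p1 p2] p3] [[q1 q2] q3] [[r1 r2] r3] [[l1 l2] l3].
move=> [[n1 n2] n3] [[V1 V2] V3] a11 a12 a13 a21 a22 a23 a31 a32 a33 /= I.
apply: (etrans _ (etrans I _)); last by ring.
ring.
Qed.

End Piola.

(** * Fubini on the product of two spheres *)

Section FubiniS2.
Context {R : realType}.
Local Notation D := (@S2 R `*` @S2 R).
Local Open Scope ereal_scope.

Lemma measurable_S2S2 : measurable D.
Proof. by apply: measurableX; exact: measurable_S2. Qed.

Lemma measurable_fst_S2 d (T : measurableType d) (g : R3 R -> T) :
  measurable_fun S2 g -> measurable_fun D (fun p => g p.1).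
Proof.
move=> mg; apply: (measurable_comp measurable_S2 _ mg); first by move=> _ [p [? ?] <-].
by apply: measurable_funTS; exact: measurable_fst.
Qed.

Lemma measurable_snd_S2 d (T : measurableType d) (g : R3 R -> T) :
  measurable_fun S2 g -> measurable_fun D (fun p => g p.2).
Proof.
move=> mg; apply: (measurable_comp measurable_S2 _ mg); first by move=> _ [p [? ?] <-].
by apply: measurable_funTS; exact: measurable_snd.
Qed.

Variable F : R3 R -> R3 R -> R.
Hypothesis mF : measurable_fun D (fun p => F p.1 p.2).
Hypothesis iF : \int[domega]_(x in S2) \int[domega]_(y in S2) `|F x y|%:E < +oo.

(** [F] is controlled only on the spheres; extended by 0 it is measurable on the whole product
    space, as Fubini for [sph \x sph] requires. *)
Let f : R3 R * R3 R -> \bar R := (fun p => (F p.1 p.2)%:E) \_ D.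

Let mf : measurable_fun setT f.
Proof.
apply/(measurable_restrictT _ _).1; first exact: measurable_S2S2.
exact/measurable_EFinP.
Qed.

Let fE x : \int[domega]_y f (x, y) = ((fun x => \int[domega]_(y in S2) (F x y)%:E) \_ S2) x.
Proof.
rewrite patchE; case: ifPn => [/set_mem Sx|Sx].
  rewrite [RHS]integral_mkcond; apply: eq_integral => y _.
  rewrite /f !patchE.
  rewrite (_ : ((x, y) \in D) = (y \in @S2 R))//.
  by apply/idP/idP => [/set_mem[_ ?]|/set_mem ?]; apply/mem_set.
apply: integral0_eq => y _; rewrite /f patchE memNset// => -[/= h _].
by move/negP : Sx; apply; apply/mem_set.
Qed.

Let fE2 y : \int[domega]_x f (x, y) = ((fun y => \int[domega]_(x in S2) (F x y)%:E) \_ S2) y.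
Proof.
rewrite patchE; case: ifPn => [/set_mem Sx|Sx].
  rewrite [RHS]integral_mkcond; apply: eq_integral => x _.
  rewrite /f !patchE.
  rewrite (_ : ((x, y) \in D) = (x \in @S2 R))//.
  by apply/idP/idP => [/set_mem[? _]|/set_mem ?]; apply/mem_set.
apply: integral0_eq => x _; rewrite /f patchE memNset// => -[/= _ h].
by move/negP : Sx; apply; apply/mem_set.
Qed.

Let imf : (sph \x sph).-integrable setT f.
Proof.
apply/(integrable12ltyP sph sph mf).
apply: le_lt_trans iF; rewrite le_eqVlt; apply/orP; left; apply/eqP.
rewrite [RHS]integral_mkcond; apply: eq_integral => x _.
rewrite patchE; case: ifPn => [/set_mem Sx|Sx].
  rewrite [RHS]integral_mkcond; apply: eq_integral => y _.
  rewrite /f !patchE.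
  rewrite (_ : ((x, y) \in D) = (y \in @S2 R)).
    by case: ifPn; rewrite ?abse0.
  by apply/idP/idP => [/set_mem[_ ?]|/set_mem ?]; apply/mem_set.
apply: integral0_eq => y _; rewrite /f patchE memNset ?abse0// => -[/= h _].
by move/negP : Sx; apply; apply/mem_set.
Qed.

Lemma fubini_S2 : \int[domega]_(x in S2) \int[domega]_(y in S2) (F x y)%:E =
  \int[domega]_(y in S2) \int[domega]_(x in S2) (F x y)%:E.
Proof.
have h := Fubini imf; rewrite [RHS]integral_mkcond [LHS]integral_mkcond.
transitivity (\int[domega]_x \int[domega]_y f (x, y)).
  by apply: eq_integral => x _; rewrite fE.
by rewrite [LHS]h; apply: eq_integral => x _; rewrite -fE2.
Qed.

Lemma fubini_integrable1 : domega.-integrable S2 (fun x => \int[domega]_(y in S2) (F x y)%:E).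
Proof.
apply/(integrable_mkcond _ _).2; first exact: measurable_S2.
have h := integrable_fubini_F imf.
have e : fubini_F sph f = (fun x => \int[domega]_(y in S2) (F x y)%:E) \_ S2 := funext fE.
by rewrite e in h; exact: h.
Qed.

End FubiniS2.

(** * Poisson kernels *)

Section Poisson.
Context {R : realType}.

(** With 1 + e = (1 + r^2) / (2 r) and 0 < r < 1 this is the square of (1 - r^2) / (1 - 2 r z.x +
    r^2), the Poisson kernel of hyperbolic 3-space. It concentrates at [z] as e tends to 0. *)
Definition poisson (e : R) (z x : R3 R) : R := ((1 + e) ^+ 2 - 1) / (1 + e - dot z x) ^+ 2.

Lemma dotC (x y : R3 R) : dot x y = dot y x.
Proof. by rewrite !dotE; ring. Qed.

Lemma poissonC (e : R) (z x : R3 R) : poisson e z x = poisson e x z.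
Proof. by rewrite /poisson dotC. Qed.

Lemma dot_le1 (x y : R3 R) : S2 x -> S2 y -> `|dot x y| <= 1.
Proof.
move=> Sx Sy; have := dot_sqr_le x y; rewrite [dot x x]Sx [dot y y]Sy mulr1.
by rewrite -[_ ^+ 2]real_normK ?num_real// expr_le1.
Qed.

Lemma poisson_den e (x y : R3 R) : 0 < e -> S2 x -> S2 y -> e <= 1 + e - dot x y.
Proof.
move=> e0 Sx Sy; have := dot_le1 Sx Sy; rewrite ler_norml => /andP[_ h].
by rewrite -subr_ge0 (_ : _ - _ = 1 - dot x y) ?subr_ge0//; ring.
Qed.

Lemma poisson_ge0 e (x y : R3 R) : 0 < e -> 0 <= poisson e x y.
Proof.
move=> e0; rewrite /poisson divr_ge0 ?sqr_ge0// (_ : _ - 1 = e * (2 + e)); last by ring.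
by rewrite mulr_ge0// ?ltW// addr_gt0.
Qed.

Definition negv (z : R3 R) : R3 R := (- z.1.1, - z.1.2, - z.2).

Lemma poissonE (e : R) (z x : R3 R) : S2 z -> poisson e z x =
  ((1 + e) ^+ 2 - dot (negv z) (negv z)) / (1 + e + dot (negv z) x) ^+ 2.
Proof.
move=> Sz; have -> : dot (negv z) (negv z) = 1 by rewrite -[RHS]Sz !dotE /=; ring.
by congr (_ / _ ^+ 2); rewrite !dotE /=; ring.
Qed.

Lemma negv_lt (e : R) (z : R3 R) : 0 < e -> S2 z -> dot (negv z) (negv z) < (1 + e) ^+ 2.
Proof.
move=> e0 Sz; have -> : dot (negv z) (negv z) = 1 by rewrite -[RHS]Sz !dotE /=; ring.
by rewrite -subr_gt0 (_ : _ - 1 = e * (2 + e)) ?mulr_gt0 ?addr_gt0//; ring.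
Qed.

Lemma poisson_integral (e : R) (z : R3 R) : 0 < e -> S2 z -> \int[domega]_(x in S2) poisson e z x = 1.
Proof.
move=> e0 Sz; rewrite -[RHS](poisson_mean (a := 1 + e) (l := negv z)) ?addr_gt0 ?negv_lt//.
by apply: eq_Rintegral => x _; exact: poissonE.
Qed.

Lemma ell_integral (L : @lorentz R) : is_lorentz L -> \int[domega]_(x in (@S2 R)) (ell L x) ^- 2 = 1.
Proof.
move=> hL; have [a0 [h _ _ _ _ _ _ _ _ _] _] := hL.
rewrite -[RHS](poisson_mean a0 (ll_lt hL)) h.
by apply: eq_Rintegral => x _; rewrite /ell subKr div1r.
Qed.

Lemma C1_poisson e z x : 0 < e -> S2 z -> S2 x -> C1 (poisson e z) x.
Proof.
move=> e0 Sz Sx.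
have Ca : C1 (fun x => 1 + e - dot z x) x by exact: (C1B (C1_cst _ _) (C1_dot _ _)).
apply: (C1M (C1_cst _ _)); apply: C1V; last exact: (C1M Ca Ca).
by rewrite expf_neq0// gt_eqF// (lt_le_trans e0)// poisson_den.
Qed.

Lemma C1_ellV (L : @lorentz R) (p : R3 R) : is_lorentz L -> S2 p -> C1 (fun x => (ell L x) ^- 2) p.
Proof.
move=> hL Sp; apply: C1V; last exact: (C1M (C1_ell L p) (C1_ell L p)).
by rewrite expf_neq0// gt_eqF// ell_gt0.
Qed.

Lemma pull_div_integral (L : @lorentz R) (X : R3 R -> R3 R) : is_lorentz L -> C1_tangent_field X ->
  \int[domega]_(y in S2) ((ell L y) ^- 2 * sphere_div X (act L y)) = 0.
Proof.
move=> hL hX; rewrite -(divergence_theorem (pull_field_tangent hL hX)).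
by apply: eq_Rintegral => y /set_mem Sy; rewrite pull_field_div.
Qed.

Lemma poisson_pull (e : R) (L : @lorentz R) (z : R3 R) : 0 < e -> is_lorentz L -> S2 z ->
  \int[domega]_(y in S2) (poisson e z (act L y) * (ell L y) ^- 2) = 1.
Proof.
move=> e0 hL Sz.
have a0 : 0 < 1 + e by rewrite addr_gt0.
have n0 x : S2 x -> 1 + e + dot (negv z) x != 0.
  by move=> Sx; rewrite gt_eqF// affine_pos// negv_lt.
have := pull_div_integral hL (polar_field_tangent n0).
have -> : \int[domega]_(y in S2) ((ell L y) ^- 2 * sphere_div (polar_field (1 + e) (negv z)) (act L y)) =
  \int[domega]_(y in S2) (poisson e z (act L y) * (ell L y) ^- 2 - (ell L y) ^- 2).
  apply: eq_Rintegral => y /set_mem Sy.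
  rewrite polar_field_div; [|exact: act_S2|by apply: n0; exact: act_S2].
  by rewrite -poissonE//; ring.
have i1 : domega.-integrable (@S2 R) (EFin \o (fun y => poisson e z (act L y) * (ell L y) ^- 2)).
  apply: continuous_integrable_S2 => p Sp; apply: C1_cont.
  have cV := C1_ellV hL Sp; have Sa := act_S2 hL Sp.
  have ca : C1 (act L) p by apply: C1_act; rewrite gt_eqF// ell_gt0.
  exact: (C1M (C1_compose ca (C1_poisson e0 Sz Sa)) cV).
have i2 : domega.-integrable (@S2 R) (EFin \o (fun y => (ell L y) ^- 2)).
  by apply: continuous_integrable_S2 => p Sp; apply: C1_cont; exact: C1_ellV.
by rewrite (RintegralB measurable_S2 i1 i2) ell_integral// => /subr0_eq.
Qed.

Lemma measurable_inv : measurable_fun setT (fun x : R => x^-1).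
Proof.
rewrite (_ : setT = [set 0 : R] `|` ~` [set 0]); last by rewrite setUv.
apply/measurable_funU; [exact: measurable_set1|by apply: measurableC; exact: measurable_set1|].
split; first exact: measurable_fun_set1.
apply: open_continuous_measurable_fun; first exact: closed_openC.
by move=> x /set_mem /eqP x0; exact: inv_continuous.
Qed.

Lemma measurable_funV d (T : measurableType d) (A : set T) (f : T -> R) :
  measurable_fun A f -> measurable_fun A (fun x => (f x)^-1).
Proof. by move=> mf; apply: (measurableT_comp measurable_inv mf). Qed.

End Poisson.

(** * Change of variables for continuous functions *)

Section ChangeOfVariables.
Context {R : realType}.
Local Notation D := (@S2 R `*` @S2 R).

Lemma EFin_Rintegral (f : R3 R -> R) : domega.-integrable S2 (EFin \o f) ->
  (\int[domega]_(x in S2) (f x)%:E)%E = (\int[domega]_(x in S2) f x)%:E.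
Proof.
move=> h; rewrite /Rintegral fineK//; apply: integrable_fin_num => //.
exact: measurable_S2.
Qed.

Lemma dct_S2 (f_ : nat -> R3 R -> R) (f g : R3 R -> R) :
  (forall n, measurable_fun S2 (f_ n)) -> measurable_fun S2 f ->
  (forall x, S2 x -> f_ n x @[n --> \oo] --> f x) ->
  domega.-integrable S2 (EFin \o g) ->
  (forall n x, S2 x -> `|f_ n x| <= g x) ->
  \int[domega]_(x in S2) f_ n x @[n --> \oo] --> \int[domega]_(x in S2) f x.
Proof.
move=> mf_ mf cf ig fg.
have [|||||i _ c] := @dominated_convergence _ _ R (@domega R) S2 measurable_S2
  (fun n => EFin \o f_ n) (EFin \o f) (EFin \o g).
- by move=> n; apply/measurable_EFinP.
- exact/measurable_EFinP.
- apply: aeW => x Sx; apply/fine_cvgP; split; first exact: nearW.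
  exact: cf.
- exact: ig.
- by apply: aeW => x n Sx /=; rewrite lee_fin; exact: fg.
by apply: fine_cvg; move: c; rewrite (EFin_Rintegral i).
Qed.

Lemma bounded_iterated (F : R3 R -> R3 R -> R) (B : R) :
  measurable_fun D (fun p => F p.1 p.2) ->
  (forall x y, S2 x -> S2 y -> `|F x y| <= B) ->
  (\int[domega]_(x in S2) \int[domega]_(y in S2) `|F x y|%:E < +oo)%E.
Proof.
move=> mF hB.
pose f : R3 R * R3 R -> \bar R := (fun p => (F p.1 p.2)%:E) \_ D.
have mD := @measurable_S2S2 R.
have i1 : (sph \x sph)%E.-integrable D (EFin \o (fun p => F p.1 p.2)).
  apply: measurable_bounded_integrable => //.
    rewrite [X in (X < _)%E]product_measure1E; [|exact: measurable_S2|exact: measurable_S2].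
    by rewrite [X in (X * _ < _)%E](@domega_S2 R) [X in (_ * X < _)%E](@domega_S2 R) mule1 ltry.
  exists B; split; first exact: num_real.
  by move=> M BM [x y] [/= Sx Sy]; apply: (le_trans (hB x y Sx Sy)); exact: ltW.
have i2 : (sph \x sph)%E.-integrable setT f by apply/(integrable_mkcond _ mD).1.
have mf : measurable_fun setT f by exact: (measurable_int (sph \x sph)%E).
have := (integrable12ltyP sph sph mf).1 i2.
apply: le_lt_trans; rewrite le_eqVlt; apply/orP; left; apply/eqP.
rewrite [LHS]integral_mkcond; apply: eq_integral => x _.
rewrite patchE; case: ifPn => [/set_mem Sx|Sx].
  rewrite [LHS]integral_mkcond; apply: eq_integral => y _.
  rewrite /f !patchE.
  rewrite (_ : ((x, y) \in D) = (y \in @S2 R)).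
    by case: ifPn; rewrite ?abse0.
  by apply/idP/idP => [/set_mem[_ ?]|/set_mem ?]; apply/mem_set.
apply/esym; apply: integral0_eq => y _; rewrite /f patchE memNset ?abse0// => -[/= h _].
by move/negP : Sx; apply; apply/mem_set.
Qed.

(** For unit vectors |x - y|^2 = 2 - 2 x.y. Balls are those of the product norm, which the Euclidean
    distance dominates. *)
Lemma S2_dist (x y : R3 R) (r : R) : 0 < r -> S2 x -> S2 y -> 1 - dot x y < r ^+ 2 / 2 ->
  ball x r y.
Proof.
move=> r0 Sx Sy h.
have e : (x.1.1 - y.1.1) ^+ 2 + (x.1.2 - y.1.2) ^+ 2 + (x.2 - y.2) ^+ 2 < r ^+ 2.
  have -> : (x.1.1 - y.1.1) ^+ 2 + (x.1.2 - y.1.2) ^+ 2 + (x.2 - y.2) ^+ 2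
      = dot x x + dot y y - 2 * dot x y by rewrite !dotE; ring.
  by rewrite [dot x x]Sx [dot y y]Sy; lra.
have H (a : R) : a ^+ 2 < r ^+ 2 -> `|a| < r.
  by move=> hh; rewrite -(@ltr_pXn2r _ 2)// ?nnegrE ?ltW// real_normK ?num_real.
have := sqr_ge0 (x.1.1 - y.1.1); have := sqr_ge0 (x.1.2 - y.1.2); have := sqr_ge0 (x.2 - y.2).
move=> h1 h2 h3.
by split; [split|]; rewrite /ball /=; apply: H; lra.
Qed.

Lemma poisson_far (e d : R) (x z : R3 R) : 0 < e -> e <= 1 -> 0 < d -> S2 x -> S2 z ->
  d <= 1 - dot x z -> poisson e x z <= 3 * e / d ^+ 2.
Proof.
move=> e0 e1 d0 Sx Sz h; rewrite /poisson; apply: ler_pM.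
- by rewrite (_ : _ - 1 = e * (2 + e)) ?mulr_ge0 ?ltW// ?addr_gt0//; ring.
- by rewrite invr_ge0 sqr_ge0.
- rewrite (_ : _ - 1 = e * (2 + e)); last by ring.
  by rewrite mulrC ler_pM2r//; lra.
- have h' : d <= 1 + e - dot x z by lra.
  rewrite lef_pV2 ?posrE ?exprn_gt0// ?(lt_le_trans d0)//.
  by rewrite lerXn2r ?nnegrE// ltW// (lt_le_trans d0).
Qed.

Lemma poisson_bound (e : R) (x y : R3 R) : 0 < e -> S2 x -> S2 y ->
  `|poisson e x y| <= ((1 + e) ^+ 2 - 1) / e ^+ 2.
Proof.
move=> e0 Sx Sy; rewrite (ger0_norm (poisson_ge0 _ _ e0)) /poisson ler_pM2l; last first.
  by rewrite (_ : _ - 1 = e * (2 + e)) ?mulr_gt0 ?addr_gt0//; ring.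
have hh := poisson_den e0 Sx Sy; have hp := lt_le_trans e0 hh.
by rewrite lef_pV2 ?posrE ?exprn_gt0// lerXn2r ?nnegrE// ltW.
Qed.

Lemma poisson_continuous (e : R) (x z : R3 R) : 0 < e -> S2 x -> S2 z ->
  {for z, continuous (poisson e x)}.
Proof. by move=> e0 Sx Sz; apply: C1_cont; exact: C1_poisson. Qed.

Section Approx.
Variables (f : R3 R -> R) (C : R).
Hypothesis cf : forall x, S2 x -> {for x, continuous f}.
Hypothesis fC : forall x, S2 x -> `|f x| <= C.

Lemma poisson_integrable (e : R) x : 0 < e -> S2 x ->
  domega.-integrable S2 (EFin \o (fun z => poisson e x z * f z)).
Proof.
move=> e0 Sx; apply: continuous_integrable_S2 => z Sz.
by apply: cvgM; [exact: poisson_continuous|exact: cf].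
Qed.

Lemma poisson_le (e : R) x : 0 < e -> S2 x ->
  `|\int[domega]_(z in S2) (poisson e x z * f z)| <= C.
Proof.
move=> e0 Sx; have i := poisson_integrable e0 Sx.
have ip : domega.-integrable S2 (EFin \o (fun z => C * poisson e x z)).
  apply: continuous_integrable_S2 => z Sz.
  by apply: cvgM; [exact: cvg_cst|exact: poisson_continuous].
have ip1 : domega.-integrable S2 (EFin \o poisson e x).
  by apply: continuous_integrable_S2 => z Sz; exact: poisson_continuous.
apply: (le_trans (le_normr_Rintegral measurable_S2 i)).
rewrite -[X in _ <= X]mulr1 -(poisson_integral e0 Sx) -(RintegralZl C measurable_S2 ip1).
apply: (le_Rintegral measurable_S2 _ ip).
  exact: (integrable_norm i).
move=> z Sz; have p0 : 0 <= poisson e x z by exact: poisson_ge0.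
by rewrite normrM mulrC (ger0_norm p0) ler_wpM2r//; exact: fC.
Qed.

Lemma poisson_approx x : S2 x ->
  \int[domega]_(z in S2) (poisson (harmonic n) x z * f z) @[n --> \oo] --> f x.
Proof.
move=> Sx; apply/cvgrPdist_le => eta eta0.
have C0 : 0 <= C by rewrite (le_trans _ (fC Sx)).
have eta2 : 0 < eta / 2 by rewrite divr_gt0.
have /cvgrPdist_lt/(_ _ eta2) := cf Sx.
move=> /nbhs_ballP[r /= r0 hr].
pose d := r ^+ 2 / 2; have d0 : 0 < d by rewrite divr_gt0// exprn_gt0.
(* At distance the kernel is at most [3 * e / d ^+ 2] and f varies by at most [2 * C]; the summand 1
   keeps [K] positive. *)
pose K := 6 * C / d ^+ 2 + 1.
have K0 : 0 < K by rewrite ltr_wpDl// divr_ge0 ?sqr_ge0// mulr_ge0.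
near=> n.
have h0 : 0 < harmonic n :> R by rewrite /harmonic /= invr_gt0.
have h1 : harmonic n <= 1 :> R by rewrite /harmonic /= invf_le1// ler1n.
have hn : harmonic n <= eta / 2 / K.
  near: n; have /cvgrPdist_le/(_ (eta / 2 / K)) := @cvg_harmonic R.
  move=> /(_ (divr_gt0 eta2 K0)); apply: filterS => n.
  by rewrite sub0r normrN ger0_norm// /harmonic /= invr_ge0.
set e := harmonic n in h0 h1 hn *.
have i := poisson_integrable h0 Sx.
have ip1 : domega.-integrable S2 (EFin \o poisson e x).
  by apply: continuous_integrable_S2 => z Sz; exact: poisson_continuous.
have ip k : domega.-integrable S2 (EFin \o (fun z => k * poisson e x z)).
  apply: continuous_integrable_S2 => z Sz.
  by apply: cvgM; [exact: cvg_cst|exact: poisson_continuous].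
have E : f x = \int[domega]_(z in S2) (f x * poisson e x z).
  by rewrite (RintegralZl (f x) measurable_S2 ip1) poisson_integral// mulr1.
rewrite [X in `|X - _|]E -(RintegralB measurable_S2 (ip _) i).
have idf : domega.-integrable S2 (EFin \o (fun z => f x * poisson e x z - poisson e x z * f z)).
  apply: continuous_integrable_S2 => z Sz; have cp := poisson_continuous h0 Sx Sz.
  exact: (cvgB (cvgM (cvg_cst _) cp) (cvgM cp (cf Sz))).
apply: (le_trans (le_normr_Rintegral measurable_S2 idf)).
have ib : domega.-integrable S2 (EFin \o (fun z => eta / 2 * poisson e x z + 6 * C / d ^+ 2 * e)).
  apply: continuous_integrable_S2 => z Sz.
  by apply: cvgD; [apply: cvgM; [exact: cvg_cst|exact: poisson_continuous]|exact: cvg_cst].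
have ic : domega.-integrable S2 (EFin \o (fun z : R3 R => 6 * C / d ^+ 2 * e)).
  by apply: continuous_integrable_S2 => z Sz; exact: cvg_cst.
apply: (@le_trans _ _ (\int[domega]_(z in S2) (eta / 2 * poisson e x z + 6 * C / d ^+ 2 * e))).
  apply: (le_Rintegral measurable_S2 _ ib).
    exact: (integrable_norm idf).
  move=> z Sz; have p0 : 0 <= poisson e x z by exact: poisson_ge0.
  rewrite (mulrC (f x)) -mulrBr normrM (ger0_norm p0).
  have [hd|hd] := ltP (1 - dot x z) d.
    have /hr /= fz := S2_dist r0 Sx Sz hd.
    rewrite ler_wpDr//; last by rewrite mulrC ler_wpM2r ?poisson_ge0// ltW.
    by rewrite mulr_ge0 ?(ltW h0)// divr_ge0 ?sqr_ge0// mulr_ge0.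
  apply: ler_wpDl; first exact: (mulr_ge0 (ltW eta2) p0).
  apply: (@le_trans _ _ (3 * e / d ^+ 2 * (2 * C))).
    apply: ler_pM => //; first exact: poisson_far.
    rewrite (le_trans (ler_normB _ _))// mulr_natl mulr2n lerD//; exact: fC.
  by rewrite le_eqVlt; apply/orP; left; apply/eqP; field; rewrite gt_eqF.
rewrite (RintegralD measurable_S2 (ip _) ic) (RintegralZl _ measurable_S2 ip1).
rewrite poisson_integral// mulr1 Rintegral_cst_S2.
have : (K - 1) * e <= eta / 2.
  apply: (@le_trans _ _ (K * e)); first by rewrite ler_wpM2r ?(ltW h0)//; lra.
  by rewrite mulrC -ler_pdivlMr.
rewrite /K addrK; lra.
Unshelve. all: by end_near. Qed.

End Approx.

Lemma continuous_act (L : @lorentz R) x : is_lorentz L -> S2 x -> {for x, continuous (act L)}.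
Proof.
by move=> hL Sx; apply: C1_cont; apply: C1_act; rewrite gt_eqF// ell_gt0.
Qed.

Lemma continuous_ellV (L : @lorentz R) x : is_lorentz L -> S2 x ->
  {for x, continuous (fun y => (ell L y) ^- 2)}.
Proof. by move=> hL Sx; apply: C1_cont; exact: C1_ellV. Qed.

(* f is the limit of its Poisson integrals, and a Poisson kernel is 1 plus the
   divergence of a tangent field, which the Piola transform pulls back to the
   divergence of a tangent field. *)
Lemma change_var_continuous (L : @lorentz R) (f : R3 R -> R) : is_lorentz L ->
  (forall x, S2 x -> {for x, continuous f}) -> (forall x, S2 x -> `|f x| <= 1) ->
  \int[domega]_(y in S2) (f (act L y) * (ell L y) ^- 2) = \int[domega]_(x in S2) f x.
Proof.
move=> hL cf f1.
have cfa y : S2 y -> {for y, continuous (fun y => f (act L y))}.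
  by move=> Sy; apply: continuous_comp; [exact: continuous_act|apply: cf; exact: act_S2].
have iell : domega.-integrable (@S2 R) (EFin \o (fun y => (ell L y) ^- 2)).
  by apply: continuous_integrable_S2 => y Sy; exact: continuous_ellV.
have ell0 y : 0 <= (ell L y) ^- 2 by rewrite invr_ge0 sqr_ge0.
(* Integrated in z this is the Poisson integral of f at [act L y] times the Jacobian; integrated in
   y it is [f z] by [poisson_pull], for every n. Fubini equates the two, and only the first changes
   in the limit. *)
pose F n y z := poisson (harmonic n) (act L y) z * f z * (ell L y) ^- 2.
have h0 n : 0 < harmonic n :> R by rewrite /harmonic /= invr_gt0.
have mF n : measurable_fun D (fun p => F n p.1 p.2).
  have mc (g : R3 R -> R) : (forall x, S2 x -> {for x, continuous g}) -> measurable_fun S2 g.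
    by move=> cg; apply: within_continuous_measurable3 => //; exact: measurable_S2.
  apply: measurable_funM; last first.
    by apply: (measurable_fst_S2 (g := fun y => (ell L y) ^- 2)); apply: mc => y Sy; exact: continuous_ellV.
  apply: measurable_funM; last by apply: (measurable_snd_S2 (g := f)); exact: mc.
  apply: measurable_funM; first exact: measurable_cst.
  apply: measurable_funV; apply: measurable_funX.
  apply: measurable_funB; first exact: measurable_cst.
  rewrite (_ : (fun p => _) = (fun p : R3 R * R3 R => X1 (act L) p.1 * X1 id p.2 +
    X2 (act L) p.1 * X2 id p.2 + X3 (act L) p.1 * X3 id p.2)); last first.
    by apply/funext => p; rewrite dotE.
  have ma (g : (R3 R -> R3 R) -> R3 R -> R) : (forall Y p, C1 Y p -> C1 (g Y) p) ->
      measurable_fun D (fun p => g (act L) p.1 * g id p.2).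
    move=> cg; apply: measurable_funM.
      apply: (measurable_fst_S2 (g := g (act L))); apply: mc => y Sy; apply: C1_cont.
      by apply: cg; apply: C1_act; rewrite gt_eqF// ell_gt0.
    apply: (measurable_snd_S2 (g := g id)); apply: mc => y Sy; apply: C1_cont.
    by apply: cg; exact: C1_id.
  apply: measurable_funD; first apply: measurable_funD.
  - by apply: (ma (@X1 R)) => Y p /C1_comps[].
  - by apply: (ma (@X2 R)) => Y p /C1_comps[].
  - by apply: (ma (@X3 R)) => Y p /C1_comps[].
have [Ce Ce0 hCe] := continuous_S2_bounded (fun x Sx => continuous_ellV hL Sx).
have bF n y z : S2 y -> S2 z -> `|F n y z| <= ((1 + harmonic n) ^+ 2 - 1) / (harmonic n) ^+ 2 * 1 * Ce.
  move=> Sy Sz; rewrite /F (normrM _ ((ell L y) ^- 2)) (normrM _ (f z)).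
  apply: ler_pM => //; last exact: hCe.
  apply: ler_pM => //; last exact: f1.
  exact: (poisson_bound (h0 n) (act_S2 hL Sy) Sz).
have iF n := bounded_iterated (mF n) (@bF n).
pose K n x := \int[domega]_(z in S2) (poisson (harmonic n) x z * f z).
have R1 n y : S2 y -> (\int[domega]_(z in S2) (F n y z)%:E)%E = (K n (act L y) * (ell L y) ^- 2)%:E.
  move=> Sy; have i := poisson_integrable cf (h0 n) (act_S2 hL Sy).
  rewrite /F (EFin_Rintegral (f := fun z => poisson (harmonic n) (act L y) z * f z * (ell L y) ^- 2)).
    by rewrite (RintegralZr _ measurable_S2 i).
  apply: continuous_integrable_S2 => z Sz; apply: cvgM; last exact: cvg_cst.
  by apply: cvgM; [exact: poisson_continuous (h0 n) (act_S2 hL Sy) Sz|exact: cf].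
have R2 n z : S2 z -> (\int[domega]_(y in S2) (F n y z)%:E)%E = (f z)%:E.
  move=> Sz.
  have i : domega.-integrable (@S2 R) (EFin \o (fun y => poisson (harmonic n) z (act L y) * (ell L y) ^- 2)).
    apply: continuous_integrable_S2 => p Sp; apply: C1_cont.
    have ca : C1 (act L) p by apply: C1_act; rewrite gt_eqF// ell_gt0.
    exact: (C1M (C1_compose ca (C1_poisson (h0 n) Sz (act_S2 hL Sp))) (C1_ellV hL Sp)).
  transitivity (\int[domega]_(y in S2) (f z * (poisson (harmonic n) z (act L y) * (ell L y) ^- 2))%:E)%E.
    by apply: eq_integral => y _; rewrite /F poissonC; congr EFin; ring.
  rewrite EFin_Rintegral; first by rewrite (RintegralZl _ measurable_S2 i) poisson_pull// mulr1.
  exact: (integrableZl measurable_S2 (f z) i).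
have ifz : domega.-integrable S2 (EFin \o f) by exact: continuous_integrable_S2.
have iK n : domega.-integrable S2 (EFin \o (fun y => K n (act L y) * (ell L y) ^- 2)).
  apply: (eq_integrable measurable_S2 _ _ _ (fubini_integrable1 (mF n) (iF n))) => y /set_mem Sy.
  exact: R1.
have EQ n : \int[domega]_(y in S2) (K n (act L y) * (ell L y) ^- 2) = \int[domega]_(x in S2) f x.
  have := fubini_S2 (mF n) (iF n).
  have -> : (\int[domega]_(y in S2) \int[domega]_(z in S2) (F n y z)%:E =
    \int[domega]_(y in S2) (K n (act L y) * (ell L y) ^- 2)%:E)%E.
    by apply: eq_integral => y /set_mem Sy; exact: R1.
  have -> : (\int[domega]_(z in S2) \int[domega]_(y in S2) (F n y z)%:E =
    \int[domega]_(z in S2) (f z)%:E)%E.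
    by apply: eq_integral => z /set_mem Sz; exact: R2.
  by rewrite (EFin_Rintegral (iK n)) (EFin_Rintegral ifz) => -[].
have c := @dct_S2 (fun n y => K n (act L y) * (ell L y) ^- 2) (fun y => f (act L y) * (ell L y) ^- 2)
  (fun y => (ell L y) ^- 2).
have mK n : measurable_fun S2 (fun y => K n (act L y) * (ell L y) ^- 2).
  by apply/measurable_EFinP; exact: (measurable_int domega (iK n)).
have {}c := c mK.
have {}c := c _ _ iell _.
rewrite -[LHS](cvg_lim (@Rhausdorff R) (c _ _ _)); first last.
- move=> n y Sy; rewrite normrM [X in _ * X]ger0_norm// ler_piMl//.
  exact: (poisson_le cf f1 (h0 n) (act_S2 hL Sy)).
- move=> y Sy; apply: cvgM; last exact: cvg_cst.
  exact: (poisson_approx cf f1 (act_S2 hL Sy)).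
- apply: within_continuous_measurable3; last exact: measurable_S2.
  by move=> y Sy; apply: cvgM; [exact: cfa|exact: continuous_ellV].
by rewrite (funext EQ); apply: (cvg_lim (@Rhausdorff R)); exact: cvg_cst.
Qed.

End ChangeOfVariables.

(** * Change of variables for integrable functions *)

Section Density.
Context {R : realType} d d' (T : measurableType d) (Y : measurableType d').
Variable mu : {measure set T -> \bar R}.
Local Open Scope ereal_scope.
Import HBNNSimple.

(** The right-hand side involves [Phi] and [h] only through the integrals of [h] over preimages
    under [Phi]. Two such pairs with the same integrals over preimages therefore agree against every
    nonnegative [f]. *)
Lemma ge0_integral_density (Phi : T -> Y) (h : T -> R) (f : Y -> R)
    (mf : measurable_fun setT (EFin \o f)) :
  measurable_fun setT Phi -> measurable_fun setT h ->
  (forall t, 0 <= h t)%R -> (forall y, 0 <= f y)%R ->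
  \int[mu]_t (f (Phi t) * h t)%:E =
  limn (fun n => \sum_(r \in range (nnsfun_approx measurableT mf n))
    r%:E * \int[mu]_(t in Phi @^-1` (nnsfun_approx measurableT mf n @^-1` [set r])) (h t)%:E).
Proof.
move=> mPhi mh h0 f0; set f_ := nnsfun_approx measurableT mf.
have mpre B : measurable B -> measurable (Phi @^-1` B).
  by move=> mB; rewrite -[X in measurable X]setTI; exact: mPhi.
have mg n : measurable_fun setT (fun t => f_ n (Phi t)).
  by apply: measurableT_comp mPhi; exact: measurable_funP.
have mhh : measurable_fun setT (EFin \o h) by exact/measurable_EFinP.
transitivity (limn (fun n => \int[mu]_t (f_ n (Phi t) * h t)%:E)).
  rewrite -monotone_convergence//.
  - apply: eq_integral => t _; apply/esym/cvg_lim => //.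
    apply/fine_cvgP; split; first exact: nearW.
    apply: cvgM; last exact: cvg_cst.
    have f0' y : [set: Y] y -> 0 <= (EFin \o f) y by rewrite lee_fin.
    exact: (fine_cvg (cvg_nnsfun_approx measurableT mf f0' (x := Phi t) I)).
  - by move=> n; apply/measurable_EFinP; exact: measurable_funM.
  - by move=> n t _; rewrite lee_fin mulr_ge0.
  - move=> t _ m n mn; rewrite lee_fin ler_wpM2r//.
    by have /lefP := nd_nnsfun_approx measurableT mf mn; exact.
congr (limn _); apply/funext => n.
have mk r : measurable (f_ n @^-1` [set r]) by exact: measurable_sfunP.
transitivity (\int[mu]_t \sum_(r \in range (f_ n)) (r * \1_(f_ n @^-1` [set r]) (Phi t) * h t)%:E).
  apply: eq_integral => t _; rewrite fsumEFin// -mulr_fsuml//.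
  by rewrite [in LHS]fimfunE.
have m1 r : measurable_fun setT (fun t => r * \1_(f_ n @^-1` [set r]) (Phi t) * h t)%R.
  apply: measurable_funM => //; apply: measurable_funM => //.
  by apply: measurableT_comp mPhi; exact: measurable_indic.
rewrite ge0_integral_fsum//; last 2 first.
- by move=> r; exact/measurable_EFinP.
- by move=> r t _; rewrite lee_fin mulr_ge0// -lee_fin EFinM nnfun_muleindic_ge0.
apply: eq_fsbigr => r /set_mem[y _ ry].
have r0 : (0 <= r)%R by rewrite -ry.
under eq_integral do rewrite -mulrA EFinM.
rewrite ge0_integralZl//; last 2 first.
- apply/measurable_EFinP; apply: measurable_funM => //.
  by apply: measurableT_comp mPhi; exact: measurable_indic.
- by move=> t _; rewrite lee_fin mulr_ge0.
congr (_ * _); rewrite [RHS]integral_mkcond; apply: eq_integral => t _.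
rewrite patchE indicE.
rewrite (_ : (Phi t \in f_ n @^-1` [set r]) = (t \in Phi @^-1` (f_ n @^-1` [set r]))).
  by case: ifPn => _; rewrite ?mul1r ?mul0r.
by apply/idP/idP => /set_mem H; apply/mem_set.
Qed.

End Density.

Section ChangeOfVariablesGeneral.
Context {R : realType}.
Local Open Scope ereal_scope.
Import HBNNSimple.

Lemma integral_indic_S2 (g : R3 R -> R) :
  \int[domega]_t (g t * \1_S2 t)%:E = \int[domega]_(t in S2) (g t)%:E.
Proof.
rewrite [RHS]integral_mkcond; apply: eq_integral => t _.
by rewrite patchE indicE; case: ifPn => _; rewrite ?mulr1 ?mulr0.
Qed.

Lemma integrable_indic_S2 (g : R3 R -> R) : domega.-integrable S2 (EFin \o g) ->
  domega.-integrable setT (EFin \o (fun t => g t * \1_S2 t)%R).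
Proof.
move=> i; have := (integrable_mkcond _ measurable_S2).1 i.
apply: eq_integrable => // t _.
by rewrite patchE /= indicE; case: ifPn => _; rewrite ?mulr1 ?mulr0.
Qed.

Lemma measurable_ell (L : @lorentz R) : measurable_fun setT (ell L).
Proof.
apply: measurable_funD; first exact: measurable_cst.
by rewrite (funext (dotC _)); exact: measurable_dot.
Qed.

Lemma measurable_act (L : @lorentz R) : measurable_fun setT (act L).
Proof.
have H (a : R) (v : R3 R) : measurable_fun setT (fun x => (a + dot v x) / ell L x)%R.
  apply: measurable_funM; last by apply: measurable_funV; exact: measurable_ell.
  apply: measurable_funD; first exact: measurable_cst.
  by rewrite (funext (dotC _)); exact: measurable_dot.
by apply: measurable_fun_pair; first apply: measurable_fun_pair; exact: H.
Qed.

Lemma measurable_S2_act (L : @lorentz R) d (T : measurableType d) (f : R3 R -> T) :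
  is_lorentz L -> measurable_fun S2 f -> measurable_fun S2 (fun y => f (act L y)).
Proof.
move=> hL mf; apply: (measurable_comp measurable_S2 _ mf).
  by move=> _ [y Sy <-]; exact: act_S2.
by apply: measurable_funTS; exact: measurable_act.
Qed.

Lemma ellV_integrable (L : @lorentz R) : is_lorentz L ->
  domega.-integrable (@S2 R) (EFin \o (fun y => (ell L y) ^- 2)%R).
Proof. by move=> hL; apply: continuous_integrable_S2 => y Sy; exact: continuous_ellV. Qed.

Lemma ellV_ge0 (L : @lorentz R) y : (0 <= (ell L y) ^- 2)%R.
Proof. by rewrite invr_ge0 sqr_ge0. Qed.

Lemma measurable_ellV (L : @lorentz R) : measurable_fun setT (fun y => (ell L y) ^- 2)%R.
Proof. by apply: measurable_funV; apply: measurable_funX; exact: measurable_ell. Qed.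

(** [pushforward_separation] extends the formula from bounded continuous functions to Borel sets;
    the indicator of the sphere confines both densities to it. *)
Lemma change_var_set (L : @lorentz R) A : is_lorentz L -> measurable A ->
  \int[domega]_(y in act L @^-1` A) ((ell L y) ^- 2 * \1_S2 y)%:E =
  \int[domega]_(y in A) (\1_S2 y)%:E.
Proof.
move=> hL mA; apply: (pushforward_separation (Phi1 := act L) (Phi2 := id)) => //.
- exact: measurable_act.
- by apply: integrable_indic_S2; exact: ellV_integrable.
- have : domega.-integrable (@S2 R) (EFin \o (fun=> 1%R)).
    by apply: continuous_integrable_S2 => y Sy; exact: cvg_cst.
  move=> /integrable_indic_S2; apply: eq_integrable => // t _ /=.
  by rewrite mul1r.
move=> f cf f1.
under eq_integral do rewrite mulrA.
rewrite (integral_indic_S2 (fun y => f (act L y) * (ell L y) ^- 2)%R) integral_indic_S2.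
have cf' x : S2 x -> {for x, continuous f} by move=> _; exact: cf.
rewrite !EFin_Rintegral; first by rewrite change_var_continuous.
  exact: continuous_integrable_S2.
apply: continuous_integrable_S2 => y Sy.
apply: cvgM; last exact: continuous_ellV.
by apply: continuous_comp; [exact: continuous_act|exact: cf].
Qed.

Lemma change_var_ge0 (L : @lorentz R) (f : R3 R -> R) : is_lorentz L ->
  measurable_fun S2 f -> (forall x, S2 x -> 0 <= f x)%R ->
  \int[domega]_(y in S2) (f (act L y) * (ell L y) ^- 2)%:E =
  \int[domega]_(x in S2) (f x)%:E.
Proof.
move=> hL mf f0.
pose g x := (f x * \1_S2 x)%R.
have g0 x : (0 <= g x)%R.
  rewrite /g indicE; case: (boolP (x \in S2)) => [/set_mem/f0|_]; first by rewrite mulr1.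
  by rewrite mulr0.
have mg : measurable_fun setT (EFin \o g).
  have := (measurable_restrictT (EFin \o f) (@measurable_S2 R)).1 ((measurable_EFinP _ _).2 mf).
  congr (measurable_fun _ _); apply/funext => x.
  by rewrite patchE /g /= indicE; case: ifPn => _; rewrite ?mulr1 ?mulr0.
transitivity (\int[domega]_y (g (act L y) * ((ell L y) ^- 2 * \1_S2 y))%:E).
  rewrite -integral_indic_S2; apply: eq_integral => y _; rewrite /g !indicE.
  case: (boolP (y \in S2)) => [/set_mem Sy|]; last by rewrite !mulr0.
  by rewrite (mem_set (act_S2 hL Sy)) !mulr1.
transitivity (\int[domega]_y (g y * \1_S2 y)%:E); last first.
  rewrite -integral_indic_S2; apply: eq_integral => y _.
  by rewrite /g indicE; case: (y \in S2); rewrite ?mulr1 ?mulr0.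
have m1 : measurable_fun setT (fun y : R3 R => (ell L y) ^- 2 * \1_S2 y)%R.
  by apply: measurable_funM; [exact: measurable_ellV|apply: measurable_indic; exact: measurable_S2].
have m2 : measurable_fun setT (\1_(@S2 R) : R3 R -> R).
  by apply: measurable_indic; exact: measurable_S2.
have p1 y : (0 <= (ell L y) ^- 2 * \1_S2 y :> R)%R by rewrite mulr_ge0 ?ellV_ge0.
rewrite (ge0_integral_density domega mg (measurable_act L) m1 p1 g0).
rewrite (ge0_integral_density domega (Phi := id) mg (@measurable_id _ _ _) m2 _ g0)//.
congr (limn _); apply/funext => n; apply: eq_fsbigr => r _; congr (_ * _).
have mA : measurable (nnsfun_approx measurableT mg n @^-1` [set r]) by exact: measurable_sfunP.
exact: (change_var_set hL mA).
Qed.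

Lemma change_var_integrable (L : @lorentz R) (f : R3 R -> R) : is_lorentz L ->
  domega.-integrable S2 (EFin \o f) ->
  domega.-integrable S2 (EFin \o (fun y => f (act L y) * (ell L y) ^- 2)%R).
Proof.
move=> hL i; have mf : measurable_fun S2 f by apply/measurable_EFinP; exact: (measurable_int domega i).
apply/integrableP; split.
  apply/measurable_EFinP; apply: measurable_funM; first exact: measurable_S2_act.
  by apply: measurable_funTS; exact: measurable_ellV.
under eq_integral do rewrite /= normrM (ger0_norm (ellV_ge0 _ _)).
rewrite (change_var_ge0 (f := fun x => `|f x|%R) hL)//; last exact: measurableT_comp.
by have /integrableP[] := i.
Qed.

(** f = (|f| + f) - |f|, a difference of nonnegative integrable functions. *)
Lemma change_var (L : @lorentz R) (f : R3 R -> R) : is_lorentz L ->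
  domega.-integrable S2 (EFin \o f) ->
  (\int[domega]_(y in S2) (f (act L y) * (ell L y) ^- 2) = \int[domega]_(x in S2) f x)%R.
Proof.
move=> hL i.
have H (g : R3 R -> R) : domega.-integrable S2 (EFin \o g) -> (forall x, S2 x -> 0 <= g x)%R ->
  (\int[domega]_(y in S2) (g (act L y) * (ell L y) ^- 2) = \int[domega]_(x in S2) g x)%R.
  move=> ig g0; congr fine; apply: change_var_ge0 => //.
  by apply/measurable_EFinP; exact: (measurable_int domega ig).
have ia : domega.-integrable S2 (EFin \o (fun x => `|f x|%R)) := integrable_norm i.
have is_ : domega.-integrable S2 (EFin \o (fun x => `|f x| + f x)%R).
  by have := integrableD measurable_S2 ia i.
transitivity (\int[domega]_(y in S2) ((`|f (act L y)| + f (act L y)) * (ell L y) ^- 2 - `|f (act L y)| * (ell L y) ^- 2))%R.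
  by congr fine; apply: eq_integral => y _; rewrite mulrDl addrC addKr.
rewrite (RintegralB measurable_S2 (change_var_integrable hL is_) (change_var_integrable hL ia)).
rewrite (H _ is_) ?(H _ ia)//; last by move=> x _; rewrite -lerBlDr sub0r -normrN ler_norm.
rewrite -(RintegralB measurable_S2 is_ ia); congr fine; apply: eq_integral => y _.
by rewrite addrC addKr.
Qed.

(** Comparing the density [h] with the density 0 by [pushforward_separation] shows that the integral
    of [h] over every Borel set vanishes. *)
Lemma ae_zero_S2 (h : R3 R -> R) : domega.-integrable S2 (EFin \o h) ->
  (forall f : R3 R -> R, continuous f -> (forall x, (`|f x| <= 1)%R) ->
    (\int[domega]_(x in S2) (f x * h x) = 0)%R) ->
  {ae domega, forall x, S2 x -> h x = 0%R}.
Proof.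
move=> ih H.
have ih1 := integrable_indic_S2 ih.
have K A : measurable A -> \int[domega]_(t in A) (h t * \1_S2 t)%:E = 0.
  move=> mA.
  have z : domega.-integrable setT (EFin \o (fun _ : R3 R => 0%R : R)) by exact: integrable0.
  rewrite (pushforward_separation (Phi1 := id) (Phi2 := id) _ _ ih1 z) ?integral0//.
  move=> f cf f1.
  under eq_integral do rewrite mulrA.
  rewrite (integral_indic_S2 (fun x => f x * h x)%R) EFin_Rintegral; last first.
    apply: (le_integrable measurable_S2 _ _ ih).
      apply/measurable_EFinP; apply: measurable_funM.
        by apply: measurable_funTS; apply: within_continuous_measurable3 => // x _; exact: cf.
      by apply/measurable_EFinP; exact: (measurable_int domega ih).
    by move=> x _; rewrite /= lee_fin normrM ler_piMl.
  by rewrite H//; apply/esym; apply: integral0_eq => x _; rewrite mulr0.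
have := integral_ae_eq measurable_S2 ih (measurable_cst (0 : \bar R)).
have e E : E `<=` @S2 R -> measurable E ->
    \int[domega]_(x in E) (EFin \o h) x = \int[domega]_(x in E) cst 0 x.
  move=> ES mE; rewrite integral0 -(K _ mE); apply: eq_integral => x /set_mem Ex.
  by rewrite indicE (mem_set (ES _ Ex)) mulr1.
move=> /(_ e); apply: filterS => x hx Sx.
by have := hx Sx => -[].
Qed.

End ChangeOfVariablesGeneral.

(** * Conformal maps as Lorentz matrices *)

Section MobiusLorentz.
Context {R : realType}.
Local Notation C := R[i].
Local Open Scope complex_scope.

(* The action of [[a, b], [c, d]] on Hermitian matrices H by g H g^*, read in
   the coordinates (t + x3, x1 + i x2; x1 - i x2, t - x3) of H. *)
Definition mobius_lorentz (a b c d : C) : @lorentz R :=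
  let: (a1 +i* a2) := a in let: (b1 +i* b2) := b in
  let: (c1 +i* c2) := c in let: (d1 +i* d2) := d in
  let A := a1 * a1 + a2 * a2 in let B := b1 * b1 + b2 * b2 in
  let G := c1 * c1 + c2 * c2 in let D := d1 * d1 + d2 * d2 in
  {| la := (A + B + G + D) / 2;
     ll := (a1 * b1 + a2 * b2 + (c1 * d1 + c2 * d2),
            - (a2 * b1 - a1 * b2 + (c2 * d1 - c1 * d2)),
            (A - B + G - D) / 2);
     lN := (a1 * c1 + a2 * c2 + (b1 * d1 + b2 * d2),
            a2 * c1 - a1 * c2 + (b2 * d1 - b1 * d2),
            (A + B - G - D) / 2);
     m1 := (a1 * d1 + a2 * d2 + (b1 * c1 + b2 * c2),
            - (a2 * d1 - a1 * d2 - (b2 * c1 - b1 * c2)),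
            a1 * c1 + a2 * c2 - (b1 * d1 + b2 * d2));
     m2 := (a2 * d1 - a1 * d2 + (b2 * c1 - b1 * c2),
            a1 * d1 + a2 * d2 - (b1 * c1 + b2 * c2),
            a2 * c1 - a1 * c2 - (b2 * d1 - b1 * d2));
     m3 := (a1 * b1 + a2 * b2 - (c1 * d1 + c2 * d2),
            - (a2 * b1 - a1 * b2 - (c2 * d1 - c1 * d2)),
            (A - B - G + D) / 2) |}.

Lemma mobius_is_lorentz (a b c d : C) : a * d - b * c = 1 ->
  is_lorentz (mobius_lorentz a b c d).
Proof.
case: a b c d => [a1 a2] [b1 b2] [c1 c2] [d1 d2] /eqP.
rewrite eq_complex /= => /andP[/eqP h1 /eqP h2].
(* |ad - bc|^2 - 1. The two sides of each Lorentz relation differ by 1, -1 or 0 times this quantity,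
   hence the three alternatives used for every relation. *)
have D : (a1 * d1 - a2 * d2 - (b1 * c1 - b2 * c2)) ^+ 2 +
    (a1 * d2 + a2 * d1 - (b1 * c2 + b2 * c1)) ^+ 2 - 1 = 0.
  by rewrite h1 h2; ring.
have Z (x y e : R) : x - y = e * 0 -> x = y by rewrite mulr0 => /eqP; rewrite subr_eq0 => /eqP.
split.
- rewrite /= lt_neqAle; apply/andP; split; last first.
    by rewrite divr_ge0// !addr_ge0// -?expr2 ?sqr_ge0.
  (* With a vanishing time entry the relation la^2 - |ll|^2 = 1 would make 1 the opposite of a sum
     of squares. *)
  apply/eqP => e; suff : 1 <= (0 : R) by rewrite ler10.
  have -> : 1 = 0 ^+ 2 - ((a1 * b1 + a2 * b2 + (c1 * d1 + c2 * d2)) ^+ 2 +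
    (a2 * b1 - a1 * b2 + (c2 * d1 - c1 * d2)) ^+ 2 +
    ((a1 * a1 + a2 * a2 - (b1 * b1 + b2 * b2) + (c1 * c1 + c2 * c2) - (d1 * d1 + d2 * d2)) / 2) ^+ 2).
    by rewrite {1}e; apply/esym; apply: (Z _ _ 1); rewrite -D; field.
  by rewrite expr0n /= sub0r oppr_le0 !addr_ge0 ?sqr_ge0.
- by split; rewrite /= !dotE /=; (apply: (Z _ _ 1); rewrite -D; field) || (apply: (Z _ _ (-1)); rewrite -D; field) || (apply: (Z _ _ 0); rewrite mul0r; field).
- by split; rewrite /= !dotE /=; (apply: (Z _ _ 1); rewrite -D; field) || (apply: (Z _ _ (-1)); rewrite -D; field) || (apply: (Z _ _ 0); rewrite mul0r; field).
Qed.

(** The height is recovered from the projection s + i t by 1 - x3 = 2 / (s^2 + t^2 + 1), and the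
    other coordinates follow. *)
Lemma stereographic_inj (x y : R3 R) : S2 x -> S2 y ->
  stereographic x = stereographic y -> x = y.
Proof.
case: x => [[x1 x2] x3]; case: y => [[y1 y2] y3]; rewrite /S2 /= !dotE /stereographic /=.
have sq0 (a b c : R) : a * a + b * b + c * c = 1 -> c = 1 -> a = 0 /\ b = 0.
  move=> e c1; have : a ^+ 2 + b ^+ 2 == 0 by apply/eqP; move: e; rewrite c1; lra.
  by rewrite paddr_eq0 ?sqr_ge0// !sqrf_eq0 => /andP[/eqP -> /eqP ->].
have [-> Sx|nx] := eqVneq x3 1; have [-> Sy|ny] := eqVneq y3 1 => //.
  by have [-> ->] := sq0 _ _ _ Sx erefl; have [-> ->] := sq0 _ _ _ Sy erefl.
move=> Sx Sy [e1 e2].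
have kx : 1 - x3 != 0 by rewrite subr_eq0 eq_sym.
have ky : 1 - y3 != 0 by rewrite subr_eq0 eq_sym.
set s := x1 / (1 - x3) in e1; set t := x2 / (1 - x3) in e2.
have H (a b c : R) : 1 - c != 0 -> a * a + b * b + c * c = 1 ->
    a / (1 - c) = s -> b / (1 - c) = t -> 1 - c = 2 / (s ^+ 2 + t ^+ 2 + 1).
  move=> k e as_ bt; have k0 : s ^+ 2 + t ^+ 2 + 1 != 0.
    by rewrite gt_eqF// ltr_wpDl// addr_ge0 ?sqr_ge0.
  apply: (mulIf k0); rewrite divfK//; apply: (mulIf k).
  rewrite -as_ -bt.
  transitivity (a * a + b * b + (1 - c) * (1 - c)); first by field.
  by move: e; lra.
have := H _ _ _ kx Sx erefl erefl; rewrite -(H _ _ _ ky Sy (esym e1) (esym e2)).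
move=> ek; have e3 : x3 = y3 by lra.
move: e1 e2; rewrite /s /t -e3 => /(mulIf (invr_neq0 kx)) -> /(mulIf (invr_neq0 kx)) ->.
by rewrite e3.
Qed.

(** Put k = 1 - x3, xi = x1 + i x2, p = a xi + b k and q = c xi + d k. On the sphere the numerators
    satisfy N1 + i N2 = p conj(q) / k and l - N3 = |q|^2 / k, so the projection of the image is p /
    q. The north pole, where k = 0, is treated apart. *)
Lemma stereographic_mobius (a b c d : C) (x : R3 R) : a * d - b * c = 1 -> S2 x ->
  stereographic (act (mobius_lorentz a b c d) x) = mobius a b c d (stereographic x).
Proof.
move=> /mobius_is_lorentz hL Sx; have l0 := ell_gt0 hL Sx; move: {hL} l0 Sx.
case: a b c d => [a1 a2] [b1 b2] [c1 c2] [d1 d2]; case: x => [[x1 x2] x3].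
set L := mobius_lorentz _ _ _ _; rewrite /act.
set l := ell L _ => l0; have ln0 : l != 0 by rewrite gt_eqF.
rewrite /S2 /= dotE /= => Sx.
set N1 := (lN L).1.1 + _; set N2 := (lN L).1.2 + _; set N3 := (lN L).2 + _.
pose K := l - N3.
have st : stereographic (N1 / l, N2 / l, N3 / l) =
    if K == 0 then None else Some ((N1 / K) +i* (N2 / K)).
  rewrite /stereographic /= (_ : (N3 / l == 1) = (K == 0)); last first.
    by rewrite -(inj_eq (mulIf ln0)) divfK// mul1r /K subr_eq0 eq_sym.
  case: ifPn => // K0; congr (Some (_ +i* _)); move: K0; rewrite /K => K0; field.
    by rewrite K0 ln0.
  by rewrite K0 ln0.
rewrite st => {st}.
have EK : K = (c1 * c1 + c2 * c2) * (1 + x3) + (d1 * d1 + d2 * d2) * (1 - x3) +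
    2 * ((c1 * d1 + c2 * d2) * x1 - (c2 * d1 - c1 * d2) * x2).
  by rewrite /K /l /N3 /ell !dotE /=; field.
have E1 : N1 = (a1 * c1 + a2 * c2) * (1 + x3) + (b1 * d1 + b2 * d2) * (1 - x3) +
    (a1 * d1 + a2 * d2) * x1 - (a2 * d1 - a1 * d2) * x2 +
    (b1 * c1 + b2 * c2) * x1 + (b2 * c1 - b1 * c2) * x2.
  by rewrite /N1 !dotE /=; ring.
have E2 : N2 = (a2 * c1 - a1 * c2) * (1 + x3) + (b2 * d1 - b1 * d2) * (1 - x3) +
    (a2 * d1 - a1 * d2) * x1 + (a1 * d1 + a2 * d2) * x2 +
    (b2 * c1 - b1 * c2) * x1 - (b1 * c1 + b2 * c2) * x2.
  by rewrite /N2 !dotE /=; ring.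
move: K N1 N2 EK E1 E2 => K N1 N2 EK E1 E2; clear l l0 ln0 N3 L.
rewrite /stereographic /=.
have [x31|nx] := eqVneq x3 1.
  have [x10 x20] : x1 = 0 /\ x2 = 0.
    have : x1 ^+ 2 + x2 ^+ 2 == 0 by apply/eqP; move: Sx; rewrite x31; lra.
    by rewrite paddr_eq0 ?sqr_ge0// !sqrf_eq0 => /andP[/eqP -> /eqP ->].
  rewrite /= eq_complex /=.
  have -> : (K == 0) = (c1 == 0) && (c2 == 0).
    rewrite EK x31 x10 x20 (_ : _ + _ = 2 * (c1 ^+ 2 + c2 ^+ 2)); last by ring.
    by rewrite mulf_eq0 pnatr_eq0 /= paddr_eq0 ?sqr_ge0// !sqrf_eq0.
  case: ifPn => // c0; congr Some.
  have c0' : c1 +i* c2 != 0 by rewrite eq_complex.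
  have n0 : c1 * c1 + c2 * c2 != 0.
    by rewrite -!expr2 paddr_eq0 ?sqr_ge0// !sqrf_eq0.
  apply: (mulIf c0'); rewrite divfK//; apply/eqP; rewrite eq_complex /=.
  by apply/andP; split; apply/eqP; rewrite E1 E2 EK x31 x10 x20; field; rewrite ?n0.
have kx : 1 - x3 != 0 by rewrite subr_eq0 eq_sym.
set k := 1 - x3 in kx *.
pose p1 := a1 * x1 - a2 * x2 + b1 * k; pose p2 := a1 * x2 + a2 * x1 + b2 * k.
pose q1 := c1 * x1 - c2 * x2 + d1 * k; pose q2 := c1 * x2 + c2 * x1 + d2 * k.
have Sx' : x1 * x1 + x2 * x2 - (1 + x3) * k = 0 by rewrite /k; move: Sx; lra.
have K' : K = (q1 * q1 + q2 * q2) / k.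
  apply: (mulIf kx); rewrite divfK//; apply/eqP; rewrite eq_sym -subr_eq0; apply/eqP.
  transitivity ((c1 * c1 + c2 * c2) * (x1 * x1 + x2 * x2 - (1 + x3) * k)); last by rewrite Sx' mulr0.
  by rewrite EK -/k /q1 /q2; ring.
have N1' : N1 = (p1 * q1 + p2 * q2) / k.
  apply: (mulIf kx); rewrite divfK//; apply/eqP; rewrite eq_sym -subr_eq0; apply/eqP.
  transitivity ((a1 * c1 + a2 * c2) * (x1 * x1 + x2 * x2 - (1 + x3) * k)); last by rewrite Sx' mulr0.
  by rewrite E1 -/k /q1 /q2 /p1 /p2; ring.
have N2' : N2 = (p2 * q1 - p1 * q2) / k.
  apply: (mulIf kx); rewrite divfK//; apply/eqP; rewrite eq_sym -subr_eq0; apply/eqP.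
  transitivity ((a2 * c1 - a1 * c2) * (x1 * x1 + x2 * x2 - (1 + x3) * k)); last by rewrite Sx' mulr0.
  by rewrite E2 -/k /q1 /q2 /p1 /p2; ring.
have qE : (c1 +i* c2) * (x1 / k +i* (x2 / k)) + (d1 +i* d2) = (q1 / k) +i* (q2 / k).
  by apply/eqP; rewrite eq_complex /=; apply/andP; split; apply/eqP; rewrite /q1 /q2; field.
have pE : (a1 +i* a2) * (x1 / k +i* (x2 / k)) + (b1 +i* b2) = (p1 / k) +i* (p2 / k).
  by apply/eqP; rewrite eq_complex /=; apply/andP; split; apply/eqP; rewrite /p1 /p2; field.
rewrite /mobius qE pE eq_complex /=.
have dk (q : R) : (q / k == 0) = (q == 0) by rewrite mulf_eq0 invr_eq0 (negPf kx) orbF.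
rewrite !dk.
have -> : (K == 0) = (q1 == 0) && (q2 == 0).
  by rewrite K' dk -!expr2 paddr_eq0 ?sqr_ge0// !sqrf_eq0.
case: ifPn => // q0; congr Some.
have n0 : q1 * q1 + q2 * q2 != 0 by rewrite -!expr2 paddr_eq0 ?sqr_ge0// !sqrf_eq0.
have q0' : (q1 / k) +i* (q2 / k) != 0 by rewrite eq_complex /= !dk.
apply: (mulIf q0'); rewrite divfK// N1' N2' K'; apply/eqP; rewrite eq_complex /=.
by apply/andP; split; apply/eqP; move: (p1) (p2) (q1) (q2) n0 => u v w z n0; field; rewrite kx n0.
Qed.

Definition flip2 (x : R3 R) : R3 R := (x.1.1, - x.1.2, x.2).

(** L times diag(1, 1, -1, 1): precomposition with complex conjugation. *)
Definition lorentz_flip (L : @lorentz R) : lorentz :=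
  {| la := la L; ll := flip2 (ll L); lN := lN L;
     m1 := flip2 (m1 L); m2 := flip2 (m2 L); m3 := flip2 (m3 L) |}.

Lemma flip_is_lorentz L : is_lorentz L -> is_lorentz (lorentz_flip L).
Proof.
case: L => a l n p q r [a0 r1 r2]; split => //.
- by case: r1; rewrite /= !dotE /= => *; split; rewrite /= !dotE /= !mulrNN.
- case: r2; rewrite /= !dotE /= => h0 h1 h2 h3 h4 h5 h6 h7 h8 h9.
  split; rewrite /= !dotE /=; [clear -h0|clear -h1|clear -h2|clear -h3|clear -h4|
    clear -h5|clear -h6|clear -h7|clear -h8|clear -h9]; lra.
Qed.

Lemma act_flip L x : act (lorentz_flip L) x = act L (flip2 x).
Proof. by rewrite /act /ell /flip2 /= !dotE /= !mulNr !mulrN. Qed.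

Lemma stereographic_flip (x : R3 R) :
  stereographic (flip2 x) = omap (@conjc R) (stereographic x).
Proof.
by rewrite /stereographic /=; case: ifPn => //= _; rewrite mulNr.
Qed.

Lemma flip2_S2 x : S2 x -> S2 (flip2 x).
Proof. by rewrite /S2 /= !dotE /= mulrNN. Qed.

Lemma conformal_lorentz (tau : R3 R -> R3 R) : conformal tau ->
  exists2 L, is_lorentz L & forall x, S2 x -> tau x = act L x.
Proof.
move=> [tS [a [b [c [d [det [h|h]]]]]]].
  exists (mobius_lorentz a b c d); first exact: mobius_is_lorentz.
  move=> x Sx; apply: stereographic_inj; first exact: tS.
    by apply: act_S2 => //; exact: mobius_is_lorentz.
  by rewrite h// stereographic_mobius.
exists (lorentz_flip (mobius_lorentz a b c d)).
  by apply: flip_is_lorentz; exact: mobius_is_lorentz.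
move=> x Sx; rewrite act_flip; apply: stereographic_inj; first exact: tS.
  by apply: act_S2; [exact: mobius_is_lorentz|exact: flip2_S2].
by rewrite h// stereographic_mobius ?stereographic_flip//; exact: flip2_S2.
Qed.

End MobiusLorentz.

(** * The area distortion of a conformal map *)

Section AreaDistortion.
Context {R : realType}.

Definition cap (p : R3 R) (c : R) : set (R3 R) := [set q | S2 q /\ c < dot p q].

Lemma cap_S2 p c : cap p c `<=` S2. Proof. by move=> q []. Qed.

Lemma measurable_cap p c : measurable (cap p c).
Proof.
have -> : cap p c = @S2 R `&` (fun q => dot q p) @^-1` `]c, +oo[.
  by apply/seteqP; split => q [Sq h]; split => //; move: h; rewrite /= in_itv /= andbT dotC.
by apply: (measurable_funTS (measurable_dot p)) => //; exact: measurable_S2.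
Qed.

Lemma geodesic_ballE p r : S2 p -> 0 < r -> r <= pi -> geodesic_ball p r = cap p (cos r).
Proof.
move=> Sp r0 rpi.
have H q : S2 q -> (acos (dot p q) < r) = (cos r < dot p q).
  move=> Sq; have := dot_le1 Sp Sq; rewrite ler_norml => d1.
  rewrite -[in RHS](acosK (x := dot p q)) ?in_itv//= ltr_cos// in_itv /=.
    by rewrite acos_ge0// acos_lepi.
  by rewrite (ltW r0).
by apply/seteqP; split => q [Sq]; [rewrite H|rewrite -H].
Qed.

Lemma domega_le1 (A : set (R3 R)) : measurable A -> (domega A <= 1)%E.
Proof. by move=> mA; exact: (@probability_le1 _ _ _ sph A mA). Qed.

Lemma domega_fin (A : set (R3 R)) : measurable A -> domega A \is a fin_num.
Proof.
move=> mA; rewrite ge0_fin_numE ?measure_ge0//.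
by rewrite (le_lt_trans (domega_le1 mA))// ltry.
Qed.

(** A Poisson kernel concentrated at [p] has mean 1 but is at most 1/2 off the cap; this is
    impossible if the cap is a null set. *)
Lemma domega_cap_gt0 p c : S2 p -> c < 1 -> (0 < domega (cap p c))%E.
Proof.
move=> Sp c1; rewrite lt0e measure_ge0 andbT; apply/eqP => z.
pose d := 1 - c; have d0 : 0 < d by rewrite subr_gt0.
(* [poisson_far] bounds the kernel off the cap by [3 * e / d ^+ 2], which is at most 1/2 for this
   e. *)
pose e := Num.min 1 (d ^+ 2 / 6).
have e0 : 0 < e by rewrite lt_min ltr01 divr_gt0// exprn_gt0.
have e1 : e <= 1 by rewrite ge_min lexx.
have ed : 3 * e / d ^+ 2 <= 2^-1.
  rewrite ler_pdivrMr ?exprn_gt0//.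
  have : e <= d ^+ 2 / 6 by rewrite ge_min lexx orbT.
  lra.
have : (1 <= (2^-1 : R)%:E)%E.
  have ip : domega.-integrable (@S2 R) (EFin \o poisson e p).
    by apply: continuous_integrable_S2 => x Sx; exact: poisson_continuous.
  rewrite -[X in (X <= _)%E](congr1 EFin (poisson_integral e0 Sp)) -(EFin_Rintegral ip).
  apply: (@le_trans _ _ (\int[domega]_(x in @S2 R) (2^-1 : R)%:E)%E); last first.
    have ic : domega.-integrable (@S2 R) (EFin \o (fun=> (2^-1)%R : R)).
      by apply: continuous_integrable_S2 => x Sx; exact: cvg_cst.
    by rewrite (EFin_Rintegral ic) Rintegral_cst_S2.
  apply: ae_ge0_le_integral => //.
  - exact: measurable_S2.
  - by move=> x Sx; rewrite lee_fin poisson_ge0.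
  - exact: (measurable_int domega ip).
  exists (cap p c); split => //; first exact: measurable_cap.
  move=> x /= /not_implyP[Sx h]; split => //; rewrite ltNge; apply/negP => hc; apply: h.
  rewrite lee_fin; apply: le_trans ed; apply: poisson_far => //.
  by rewrite /d lerD2l lerN2.
by rewrite lee_fin; lra.
Qed.

Lemma image_act (L : @lorentz R) B : is_lorentz L -> B `<=` S2 ->
  act L @` B = S2 `&` act (linv L) @^-1` B.
Proof.
move=> hL BS; apply/seteqP; split => [_ [x Bx <-]|y [Sy By]].
  by split; [apply: act_S2 => //; exact: BS|rewrite /= actK//; exact: BS].
exists (act (linv L) y) => //.
by have := actK (is_lorentz_inv hL) Sy; rewrite linvK.
Qed.

Lemma domega_image (L : @lorentz R) B : is_lorentz L -> B `<=` S2 -> measurable B ->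
  domega (act L @` B) = (\int[domega]_(y in B) ((ell L y) ^- 2)%:E)%E.
Proof.
move=> hL BS mB.
have mI : measurable (act L @` B).
  rewrite image_act//; apply: (measurable_funTS (measurable_act (linv L))) => //.
  exact: measurable_S2.
transitivity (\int[domega]_(x in S2) (\1_(act L @` B) x)%:E)%E.
  have -> := integral_indic domega (@measurable_S2 R) mI.
  by congr (domega _); rewrite setIidl// => _ [x Bx <-]; apply: act_S2 => //; exact: BS.
rewrite -(change_var_ge0 hL); last 2 first.
- by apply: measurable_funTS; exact: measurable_indic.
- by move=> x _; rewrite indicE.
rewrite [LHS]integral_mkcond [RHS]integral_mkcond; apply: eq_integral => y _.
rewrite !patchE; case: ifPn => [/set_mem Sy|Sy]; last first.
  by rewrite memNset// => /BS /mem_set; apply/negP.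
rewrite indicE (_ : (act L y \in act L @` B) = (y \in B)).
  by case: ifPn; rewrite ?mul1r ?mul0r.
apply/idP/idP => /set_mem; last by move=> By; apply/mem_set; exists y.
move=> [x Bx e]; apply/mem_set.
by rewrite -(actK hL Sy) -e actK//; exact: BS.
Qed.

Lemma fine_area (A : set (R3 R)) : measurable A -> fine (area A) = 4 * pi * fine (domega A).
Proof.
move=> mA; have p0 : 4 * pi != 0 :> R by rewrite mulf_neq0// gt_eqF// pi_gt0.
have -> : area A = ((4 * pi)%:E * domega A)%E.
  by rewrite /domega /= /mscale /= muleA -EFinM divff// mul1e.
by rewrite fineM// domega_fin.
Qed.

(** Small geodesic balls are caps. By [domega_image] the quotient is the average of ell^-2 over the
    cap, and ell^-2 is continuous at [p]. *)
Lemma area_distortionE (L : @lorentz R) (tau : R3 R -> R3 R) p : is_lorentz L ->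
  (forall x, S2 x -> tau x = act L x) -> S2 p -> area_distortion tau p = (ell L p) ^- 2.
Proof.
move=> hL htau Sp; apply: (cvg_lim (@Rhausdorff R)).
apply/cvgrPdist_le => eps eps0.
set w := fun y => (ell L y) ^- 2.
have cw x : S2 x -> {for x, continuous w} by exact: continuous_ellV.
have /cvgrPdist_le/(_ _ eps0)/nbhs_ballP[rho /= rho0 hrho] := cw p Sp.
have c : cos x @[x --> (0:R)^'+] --> (1 : R).
  by rewrite -(@cos0 R); apply: cvg_at_right_filter; exact: continuous_cos.
have h : 0 < rho ^+ 2 / 2 by rewrite divr_gt0// exprn_gt0.
near=> r.
have r0 : 0 < r by near: r; exact: nbhs_right_gt.
have rpi : r < pi by near: r; apply: nbhs_right_lt; exact: pi_gt0.
(* By [S2_dist] this puts the cap inside the ball of radius [rho]. *)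
have hr : 1 - cos r < rho ^+ 2 / 2.
  near: r; have /cvgrPdist_lt/(_ _ h) := c.
  by apply: filterS => r; apply: le_lt_trans; rewrite ler_norm.
have rpi' := ltW rpi; rewrite geodesic_ballE//.
have cr1 : cos r < 1.
  rewrite -(@cos0 R) ltr_cos ?in_itv /= ?lexx ?pi_ge0//.
  by rewrite (ltW r0).
set B := cap p (cos r); have BS : B `<=` S2 := @cap_S2 _ _.
have mB : measurable B := measurable_cap _ _.
have -> : tau @` B = act L @` B.
  by apply/seteqP; split => _ [x Bx <-]; exists x => //; rewrite htau//; exact: BS.
have mI : measurable (act L @` B).
  rewrite image_act//; apply: (measurable_funTS (measurable_act (linv L))) => //.
  exact: measurable_S2.
have p0 : 4 * pi != 0 :> R by rewrite mulf_neq0// gt_eqF// pi_gt0.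
rewrite !fine_area// -mulf_div divff// mul1r domega_image//.
have D0 : 0 < fine (domega B) by rewrite fine_gt0// domega_cap_gt0//= (le_lt_trans (domega_le1 mB))// ltry.
set I := fine _.
have hI (x : R3 R -> R) : (forall y, S2 y -> {for y, continuous x}) -> domega.-integrable B (EFin \o x).
  by move=> cx; apply: (integrableS measurable_S2 mB BS); exact: continuous_integrable_S2.
have iw := hI w cw.
have ic k : domega.-integrable B (EFin \o (fun=> k : R)) by apply: hI => y Sy; exact: cvg_cst.
have cst k : \int[domega]_(x in B) k = k * fine (domega B).
  by rewrite Rintegral_cst.
have E : w p * fine (domega B) - I = \int[domega]_(y in B) (w p - w y).
  by rewrite (RintegralB mB (ic _) iw) cst.
have iwd : domega.-integrable B (EFin \o (fun y => w p - w y)).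
  by apply: hI => y Sy; apply: cvgB; [exact: cvg_cst|exact: cw].
have -> : ell L p ^- 2 - I / fine (domega B) = \int[domega]_(y in B) (w p - w y) / fine (domega B).
  by rewrite -E mulrBl mulfK// gt_eqF.
rewrite normrM normfV (gtr0_norm D0) ler_pdivrMr//.
apply: (le_trans (le_normr_Rintegral mB iwd)).
rewrite -cst; apply: (le_Rintegral mB _ (ic _)); first exact: (integrable_norm iwd).
move=> y [Sy hy]; apply: hrho; apply: S2_dist => //.
by apply: le_lt_trans hr; rewrite lerD2l lerN2 ltW.
Unshelve. all: by end_near. Qed.

End AreaDistortion.

(** * Square-integrable functions and fields *)

Section SquareIntegrable.
Context {R : realType}.
Implicit Types (f g u : R3 R -> R) (V W X : R3 R -> R3 R).

Lemma integrable_measurable_S2 f : domega.-integrable S2 (EFin \o f) -> measurable_fun S2 f.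
Proof. by move=> i; apply/measurable_EFinP; exact: (measurable_int domega i). Qed.

Lemma continuous_measurable_S2 f : (forall x, S2 x -> {for x, continuous f}) -> measurable_fun S2 f.
Proof. by move=> cf; apply: within_continuous_measurable3 => //; exact: measurable_S2. Qed.

Lemma integrable_le f g : measurable_fun S2 f -> domega.-integrable S2 (EFin \o g) ->
  (forall x, S2 x -> `|f x| <= g x) -> domega.-integrable S2 (EFin \o f).
Proof.
move=> mf ig fg; apply: (le_integrable measurable_S2 _ _ ig); first exact/measurable_EFinP.
by move=> x Sx; rewrite /= lee_fin (le_trans (fg x Sx))// ler_norm.
Qed.

Lemma integrable_bounded f g (B : R) : domega.-integrable S2 (EFin \o f) ->
  measurable_fun S2 g -> (forall x, S2 x -> `|g x| <= B) ->
  domega.-integrable S2 (EFin \o (fun x => f x * g x)).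
Proof.
move=> i mg gB; apply: (integrable_le (g := fun x => B * `|f x|)).
- by apply: measurable_funM => //; exact: integrable_measurable_S2.
- exact: (integrableZl measurable_S2 B (integrable_norm i)).
- by move=> x Sx; rewrite normrM mulrC ler_wpM2r// gB.
Qed.

Lemma integrable_continuousM f g : domega.-integrable S2 (EFin \o f) ->
  (forall x, S2 x -> {for x, continuous g}) ->
  domega.-integrable S2 (EFin \o (fun x => f x * g x)).
Proof.
move=> i cg; have [B _ hB] := continuous_S2_bounded cg.
by apply: (integrable_bounded i _ hB); exact: continuous_measurable_S2.
Qed.

Lemma L2_mul f g : measurable_fun S2 f -> measurable_fun S2 g ->
  domega.-integrable S2 (EFin \o (fun x => f x ^+ 2)) ->
  domega.-integrable S2 (EFin \o (fun x => g x ^+ 2)) ->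
  domega.-integrable S2 (EFin \o (fun x => f x * g x)).
Proof.
move=> mf mg i j; apply: (integrable_le (g := fun x => f x ^+ 2 + g x ^+ 2)).
- exact: measurable_funM.
- exact: (integrableD measurable_S2 i j).
- move=> x _; have := sqr_ge0 (f x + g x); have := sqr_ge0 (f x - g x).
  by move: (f x) (g x) => y z h1 h2; rewrite ler_norml; apply/andP; split; lra.
Qed.

Lemma L2_L1 f : measurable_fun S2 f ->
  domega.-integrable S2 (EFin \o (fun x => f x ^+ 2)) ->
  domega.-integrable S2 (EFin \o f).
Proof.
move=> mf i.
have j : domega.-integrable (@S2 R) (EFin \o (fun=> (1 : R) ^+ 2)).
  by apply: continuous_integrable_S2 => x Sx; exact: cvg_cst.
have := L2_mul mf (measurable_cst (1 : R)) i j.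
apply: eq_integrable; first exact: measurable_S2.
by move=> x _ /=; rewrite mulr1.
Qed.

Lemma measurable_field V : measurable_fun S2 V <->
  [/\ measurable_fun S2 (X1 V), measurable_fun S2 (X2 V) & measurable_fun S2 (X3 V)].
Proof.
split=> [mV|[a b c]].
  split.
  - by apply: (measurableT_comp (f := fun x : R3 R => x.1.1)) => //; apply: measurableT_comp.
  - by apply: (measurableT_comp (f := fun x : R3 R => x.1.2)) => //; apply: measurableT_comp.
  - exact: (measurableT_comp (f := snd)).
rewrite (_ : V = fun x => (X1 V x, X2 V x, X3 V x)); last first.
  by apply/funext => x; rewrite /X1 /X2 /X3; case: (V x) => [[]].
have mT f : measurable_fun S2 f -> measurable_fun setT (f \_ (@S2 R)).
  by move=> /(measurable_restrictT _ measurable_S2).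
have := measurable_fun_pair (measurable_fun_pair (mT _ a) (mT _ b)) (mT _ c).
move=> /(measurable_funTS (D := @S2 R)); apply: eq_measurable_fun => x xS.
by rewrite !patchE xS.
Qed.

Lemma measurable_dotS2 V W : measurable_fun S2 V -> measurable_fun S2 W ->
  measurable_fun S2 (fun x => dot (V x) (W x)).
Proof.
move=> /measurable_field[a b c] /measurable_field[a' b' c'].
rewrite (_ : (fun x => _) = fun x => X1 V x * X1 W x + X2 V x * X2 W x + X3 V x * X3 W x).
  by apply: measurable_funD; [apply: measurable_funD|]; exact: measurable_funM.
by apply/funext => x; rewrite dotE.
Qed.

Lemma dot_ge0 (v : R3 R) : 0 <= dot v v.
Proof. by rewrite dotE -!expr2 !addr_ge0 ?sqr_ge0. Qed.

Lemma dot_norm_le (v w : R3 R) : `|dot v w| <= dot v v + dot w w.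
Proof.
have := dot_ge0 v; have := dot_ge0 w => w0 v0.
rewrite ler_norml; apply/andP; split.
  have := dot_ge0 (v + w); rewrite (_ : dot (v + w) (v + w) = dot v v + dot w w + 2 * dot v w).
    by lra.
  by rewrite !dotE /=; ring.
have := dot_ge0 (v - w); rewrite (_ : dot (v - w) (v - w) = dot v v + dot w w - 2 * dot v w).
  by lra.
by rewrite !dotE /=; ring.
Qed.

Lemma L2_dot V W : measurable_fun S2 V -> measurable_fun S2 W ->
  domega.-integrable S2 (EFin \o (fun x => dot (V x) (V x))) ->
  domega.-integrable S2 (EFin \o (fun x => dot (W x) (W x))) ->
  domega.-integrable S2 (EFin \o (fun x => dot (V x) (W x))).
Proof.
move=> mV mW i j; apply: (integrable_le (g := fun x => dot (V x) (V x) + dot (W x) (W x))).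
- exact: measurable_dotS2.
- exact: (integrableD measurable_S2 i j).
- by move=> x _; exact: dot_norm_le.
Qed.

Lemma measurable_fieldD V W : measurable_fun S2 V -> measurable_fun S2 W ->
  measurable_fun S2 (fun x => V x + W x).
Proof.
move=> /measurable_field[a b c] /measurable_field[a' b' c'].
by apply/measurable_field; split; exact: measurable_funD.
Qed.

Lemma dotDl (u v w : R3 R) : dot (u + v) w = dot u w + dot v w.
Proof. by rewrite !dotE /=; ring. Qed.

Lemma dotDr (u v w : R3 R) : dot w (u + v) = dot w u + dot w v.
Proof. by rewrite !dotE /=; ring. Qed.

Lemma L2_fieldD V W : measurable_fun S2 V -> measurable_fun S2 W ->
  domega.-integrable S2 (EFin \o (fun x => dot (V x) (V x))) ->
  domega.-integrable S2 (EFin \o (fun x => dot (W x) (W x))) ->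
  domega.-integrable S2 (EFin \o (fun x => dot (V x + W x) (V x + W x))).
Proof.
move=> mV mW i j; have k := L2_dot mV mW i j.
have := integrableD measurable_S2 (integrableD measurable_S2 i j) (integrableZl measurable_S2 2 k).
apply: eq_integrable; first exact: measurable_S2.
by move=> x _ /=; rewrite -!EFinD; congr EFin; rewrite !dotE /=; ring.
Qed.

End SquareIntegrable.

(** * Weak gradients and their behaviour under conformal maps *)

Section WeakGradient.
Context {R : realType}.
Implicit Types (f g u : R3 R -> R) (V W X : R3 R -> R3 R).

Lemma sphere_div_continuousS2 X x : C1_tangent_field X -> S2 x -> {for x, continuous (sphere_div X)}.
Proof. by move=> [_ c] Sx; apply: sphere_div_continuous; exact: c. Qed.

Lemma tangent_continuous X x : C1_tangent_field X -> S2 x -> {for x, continuous X}.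
Proof. by move=> [_ c] Sx; apply: C1_cont; exact: c. Qed.

Lemma tangent_L2 X : (forall x, S2 x -> {for x, continuous X}) ->
  measurable_fun S2 X /\ domega.-integrable S2 (EFin \o (fun x => dot (X x) (X x))).
Proof.
move=> c; split; last by apply: continuous_integrable_S2 => x Sx; apply: dot_continuous; exact: c.
apply/measurable_field; split; apply: continuous_measurable_S2 => x Sx.
- apply: (continuous_comp (f := X) (g := fun v : R3 R => v.1.1)); first exact: c.
  by apply: C1_cont; exact: C1_x1.
- apply: (continuous_comp (f := X) (g := fun v : R3 R => v.1.2)); first exact: c.
  by apply: C1_cont; exact: C1_x2.
- apply: (continuous_comp (f := X) (g := fun v : R3 R => v.2)); first exact: c.
  by apply: C1_cont; exact: C1_x3.
Qed.

Lemma eq_weak_gradient u u' V : (forall x, S2 x -> u x = u' x) ->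
  is_weak_gradient u V -> is_weak_gradient u' V.
Proof.
move=> e [mV iV tV wV]; split => // X hX; rewrite wV//; congr (- fine _).
by apply: eq_integral => x /set_mem Sx; rewrite e.
Qed.

Lemma weak_gradientD u v V W : domega.-integrable S2 (EFin \o u) ->
  domega.-integrable S2 (EFin \o v) -> is_weak_gradient u V -> is_weak_gradient v W ->
  is_weak_gradient (fun x => u x + v x) (fun x => V x + W x).
Proof.
move=> iu iv [mV iV tV wV] [mW iW tW wW]; split.
- exact: measurable_fieldD.
- exact: L2_fieldD.
- by move=> x Sx; rewrite dotDr tV// tW// addr0.
move=> X hX; have [mX iX] := tangent_L2 (fun x => tangent_continuous (x := x) hX).
have cd x := sphere_div_continuousS2 (x := x) hX.
transitivity (\int[domega]_(x in S2) (dot (V x) (X x) + dot (W x) (X x))).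
  by congr fine; apply: eq_integral => x _; rewrite dotDl.
rewrite (RintegralD measurable_S2 (L2_dot mV mX iV iX) (L2_dot mW mX iW iX)).
rewrite wV// wW// -opprD; congr (- _).
rewrite -(RintegralD measurable_S2 (integrable_continuousM iu cd) (integrable_continuousM iv cd)).
by congr fine; apply: eq_integral => x _; rewrite mulrDl.
Qed.

Definition scale_field f X (x : R3 R) : R3 R := (f x * X1 X x, f x * X2 X x, f x * X3 X x).

Lemma scale_field_tangent f X : (forall x, S2 x -> C1 f x) -> C1_tangent_field X ->
  C1_tangent_field (scale_field f X).
Proof.
move=> cf [tX cX]; split.
  move=> p Sp; have := tX p Sp; rewrite !dotE /scale_field /X1 /X2 /X3 /= => e.
  by transitivity (f p * (p.1.1 * (X p).1.1 + p.1.2 * (X p).1.2 + p.2 * (X p).2));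
    [ring|rewrite e mulr0].
move=> p Sp; have [c1 c2 c3] := C1_comps (cX p Sp); have c := cf p Sp.
exact: (C1_field (X := scale_field f X) (C1M c c1) (C1M c c2) (C1M c c3)).
Qed.

Lemma sphere_div_scale f X x : (forall x, S2 x -> C1 f x) -> C1_tangent_field X -> S2 x ->
  sphere_div (scale_field f X) x = f x * sphere_div X x + 'D_(X x) f x.
Proof.
move=> cf [tX cX] Sx; have [c1 c2 c3] := C1_comps (cX x Sx).
have hd (g : R3 R -> R) : C1 g x -> has_diff g x (fun v => 'D_v g x).
  by move=> /C1_diff.
have hf := hd _ (cf x Sx).
rewrite (sphere_div_diff (X := scale_field f X) (has_diffM hf (hd _ c1)) (has_diffM hf (hd _ c2))
  (has_diffM hf (hd _ c3))).
rewrite (sphere_div_diff (hd _ c1) (hd _ c2) (hd _ c3)).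
have -> : 'D_(X x) f x = X1 X x * 'D_(std_basis 0) f x + X2 X x * 'D_(std_basis 1) f x
  + X3 X x * 'D_(std_basis 2) f x := derive_std (X x) hf.1.
have := tX x Sx; rewrite dotE -/(X1 X x) -/(X2 X x) -/(X3 X x).
move: (X1 X x) (X2 X x) (X3 X x) => a b c e.
move: ('D_x f x) => z.
(* The radial derivative ['D_x f x] depends on how f extends off the sphere; it occurs only
   multiplied by x.X(x) = 0. *)
transitivity (f x * ('D_(std_basis 0) (X1 X) x + 'D_(std_basis 1) (X2 X) x + 'D_(std_basis 2) (X3 X) x
  - (x.1.1 * 'D_x (X1 X) x + x.1.2 * 'D_x (X2 X) x + x.2 * 'D_x (X3 X) x))
  + (a * 'D_(std_basis 0) f x + b * 'D_(std_basis 1) f x + c * 'D_(std_basis 2) f x)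
  - (x.1.1 * a + x.1.2 * b + x.2 * c) * z); last by rewrite e mul0r subr0.
move: ('D_(std_basis 0) f x) ('D_(std_basis 1) f x) ('D_(std_basis 2) f x)
  ('D_(std_basis 0) (X1 X) x) ('D_(std_basis 1) (X2 X) x) ('D_(std_basis 2) (X3 X) x)
  ('D_x (X1 X) x) ('D_x (X2 X) x) ('D_x (X3 X) x) (f x) => *; ring.
Qed.

(** The divergence theorem for the field f X. [G] is compared with the derivative of f in tangent
    directions only, the extension of f off the sphere being arbitrary. *)
Lemma weak_gradient_C1 f (G : R3 R -> R3 R) : (forall x, S2 x -> C1 f x) ->
  (forall x, S2 x -> {for x, continuous G}) ->
  (forall x, S2 x -> dot x (G x) = 0) ->
  (forall x v, S2 x -> dot x v = 0 -> 'D_v f x = dot (G x) v) ->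
  is_weak_gradient f G.
Proof.
move=> cf cG tG dG; have [mG iG] := tangent_L2 cG; split => // X hX.
have [mX iX] := tangent_L2 (fun x => tangent_continuous (x := x) hX).
have := divergence_theorem (scale_field_tangent cf hX).
have i1 : domega.-integrable S2 (EFin \o (fun x => f x * sphere_div X x)).
  apply: continuous_integrable_S2 => x Sx; apply: cvgM; first exact: (C1_cont (cf x Sx)).
  exact: sphere_div_continuousS2.
have i2 := L2_dot mG mX iG iX.
have -> : \int[domega]_(x in S2) sphere_div (scale_field f X) x =
    \int[domega]_(x in S2) (f x * sphere_div X x + dot (G x) (X x)).
  congr fine; apply: eq_integral => x /set_mem Sx; rewrite sphere_div_scale// dG//.
  by case: hX => tX _; exact: tX.
by rewrite (RintegralD measurable_S2 i1 i2) => /eqP; rewrite addrC addr_eq0 => /eqP.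
Qed.

(** [pull_vec L x] is the adjoint of the differential of [act L] at x. By conformality that
    differential is ell^-2 times the adjoint belonging to the inverse map. *)
Lemma pull_vec_adjoint (L : @lorentz R) (x v w : R3 R) : is_lorentz L -> S2 x ->
  dot (act L x) v = 0 -> dot x w = 0 ->
  dot (pull_vec L x v) w = (ell L x) ^- 2 * dot v (pull_vec (linv L) (act L x) w).
Proof.
move=> hL Sx tv tw; have g0 := ell_gt0 hL Sx; have gn0 : ell L x != 0 by rewrite gt_eqF.
have e := ell_act hL Sx.
rewrite /pull_vec e; move: (ell L x) gn0 (act L x) tv => g gn0 y.
case: (L) => a l n p q r /=; rewrite !dotE /=; move: tw; rewrite dotE => tw tv.
transitivity ((v.1.1 * (p.1.1 * w.1.1 + p.1.2 * w.1.2 + p.2 * w.2) +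
  v.1.2 * (q.1.1 * w.1.1 + q.1.2 * w.1.2 + q.2 * w.2) +
  v.2 * (r.1.1 * w.1.1 + r.1.2 * w.1.2 + r.2 * w.2)) / g).
  transitivity ((v.1.1 * (p.1.1 * w.1.1 + p.1.2 * w.1.2 + p.2 * w.2) +
    v.1.2 * (q.1.1 * w.1.1 + q.1.2 * w.1.2 + q.2 * w.2) +
    v.2 * (r.1.1 * w.1.1 + r.1.2 * w.1.2 + r.2 * w.2) +
    (n.1.1 * v.1.1 + n.1.2 * v.1.2 + n.2 * v.2) * (x.1.1 * w.1.1 + x.1.2 * w.1.2 + x.2 * w.2)) / g).
    by field.
  by rewrite tw mulr0 addr0.
apply/esym; transitivity ((v.1.1 * (p.1.1 * w.1.1 + p.1.2 * w.1.2 + p.2 * w.2) +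
    v.1.2 * (q.1.1 * w.1.1 + q.1.2 * w.1.2 + q.2 * w.2) +
    v.2 * (r.1.1 * w.1.1 + r.1.2 * w.1.2 + r.2 * w.2) -
    (l.1.1 * w.1.1 + l.1.2 * w.1.2 + l.2 * w.2) * (y.1.1 * v.1.1 + y.1.2 * v.1.2 + y.2 * v.2)) / g).
  by field.
by rewrite tv mulr0 subr0.
Qed.

(** Conformality, obtained from the row relations L eta L^T = eta. In dimension two the squared
    conformal factor is the Jacobian itself, and this makes the Dirichlet energy invariant. *)
Lemma pull_vec_norm (L : @lorentz R) (x v : R3 R) : is_lorentz L -> S2 x ->
  dot (act L x) v = 0 -> dot (pull_vec L x v) (pull_vec L x v) = (ell L x) ^- 2 * dot v v.
Proof.
move=> hL Sx tv; have g0 := ell_gt0 hL Sx; have gn0 : ell L x != 0 by rewrite gt_eqF.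
case: (hL) => _ [_ _ _ _ h11 h12 h13 h22 h23 h33] _.
move: tv; rewrite /pull_vec /act.
move: (ell L x) gn0 => g gn0; move: Sx; rewrite /S2 /= => Sx.
move: h11 h12 h13 h22 h23 h33; case: (L) => a l n p q r /=; rewrite !dotE /=.
move: Sx; rewrite dotE => Sx h11 h12 h13 h22 h23 h33 tv.
set k := n.1.1 * v.1.1 + n.1.2 * v.1.2 + n.2 * v.2.
have tv' : k + (v.1.1 * (p.1.1 * x.1.1 + p.1.2 * x.1.2 + p.2 * x.2) +
  v.1.2 * (q.1.1 * x.1.1 + q.1.2 * x.1.2 + q.2 * x.2) +
  v.2 * (r.1.1 * x.1.1 + r.1.2 * x.1.2 + r.2 * x.2)) = 0.
  transitivity (g * 0); last by rewrite mulr0.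
  by rewrite -tv /k; field.
transitivity ((v.1.1 ^+ 2 * (p.1.1 * p.1.1 + p.1.2 * p.1.2 + p.2 * p.2) +
  v.1.2 ^+ 2 * (q.1.1 * q.1.1 + q.1.2 * q.1.2 + q.2 * q.2) +
  v.2 ^+ 2 * (r.1.1 * r.1.1 + r.1.2 * r.1.2 + r.2 * r.2) +
  2 * (v.1.1 * v.1.2 * (p.1.1 * q.1.1 + p.1.2 * q.1.2 + p.2 * q.2) +
    v.1.1 * v.2 * (p.1.1 * r.1.1 + p.1.2 * r.1.2 + p.2 * r.2) +
    v.1.2 * v.2 * (q.1.1 * r.1.1 + q.1.2 * r.1.2 + q.2 * r.2)) +
  2 * k * ((k + (v.1.1 * (p.1.1 * x.1.1 + p.1.2 * x.1.2 + p.2 * x.2) +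
  v.1.2 * (q.1.1 * x.1.1 + q.1.2 * x.1.2 + q.2 * x.2) +
  v.2 * (r.1.1 * x.1.1 + r.1.2 * x.1.2 + r.2 * x.2))) - k) +
  k ^+ 2 * (x.1.1 * x.1.1 + x.1.2 * x.1.2 + x.2 * x.2)) / g ^+ 2).
  by move: k {tv'} => k; field.
rewrite tv' h11 h12 h13 h22 h23 h33 Sx /k; field.
by rewrite gn0.
Qed.

Lemma measurable_pull (L : @lorentz R) V : is_lorentz L -> measurable_fun S2 V ->
  measurable_fun S2 (fun x => pull_vec L x (V (act L x))).
Proof.
move=> hL mV; have mVa := measurable_S2_act hL mV.
have /measurable_field[a b c] := mVa.
have mk : measurable_fun S2 (fun x => dot (lN L) (V (act L x))).
  by apply: measurable_dotS2 => //; exact: measurable_cst.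
have me : measurable_fun S2 (fun x : R3 R => (ell L x)^-1).
  by apply: measurable_funTS; apply: measurable_funV; exact: measurable_ell.
have mi : measurable_fun S2 (@id (R3 R)) by exact: measurable_id.
have /measurable_field[x1 x2 x3] := mi.
by apply/measurable_field; split; apply: measurable_funM => //;
  (apply: measurable_funD; [|exact: measurable_funM]);
  (apply: measurable_funD; [apply: measurable_funD|]);
  apply: measurable_funM => //; exact: measurable_cst.
Qed.

(** By [pull_vec_adjoint] and a change of variables, testing the pulled-back gradient with X amounts
    to testing [V] with the pull-back of X under the inverse map, a C^1 tangent field whose
    divergence is given by [pull_field_div]. *)
Lemma weak_gradient_pull (L : @lorentz R) u V : is_lorentz L ->
  domega.-integrable S2 (EFin \o u) -> is_weak_gradient u V ->
  is_weak_gradient (fun x => u (act L x)) (fun x => pull_vec L x (V (act L x))).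
Proof.
move=> hL iu [mV iV tV wV].
have hLi := is_lorentz_inv hL.
have tVa x : S2 x -> dot (act L x) (V (act L x)) = 0 by move=> Sx; apply: tV; exact: act_S2.
split.
- exact: measurable_pull.
- apply: (eq_integrable measurable_S2 _ _ _ (change_var_integrable hL iV)) => x /set_mem Sx.
  by rewrite /= pull_vec_norm//; [rewrite mulrC|exact: tVa].
- by move=> x Sx; rewrite pull_vec_tangent//; exact: tVa.
move=> X hX; have hZ := pull_field_tangent hLi hX.
have [mZ iZ] := tangent_L2 (fun x => tangent_continuous (x := x) hZ).
have iVZ := L2_dot mV mZ iV iZ.
transitivity (\int[domega]_(x in S2) (dot (V (act L x)) (pull_field (linv L) X (act L x)) * (ell L x) ^- 2)).
  congr fine; apply: eq_integral => x /set_mem Sx.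
  by rewrite pull_vec_adjoint ?tVa//; [rewrite /pull_field actK// mulrC|case: hX => tX _; exact: tX].
have E1 := change_var (f := fun x => dot (V x) (pull_field (linv L) X x)) hL iVZ.
have E2 := wV _ hZ.
rewrite E1 E2 {E1 E2}.
apply: (congr1 (fun r => - r)).
have iud : domega.-integrable S2 (EFin \o (fun x => u x * sphere_div (pull_field (linv L) X) x)).
  by apply: integrable_continuousM iu _ => x; exact: sphere_div_continuousS2.
apply: (etrans (esym (change_var hL iud))); congr fine; apply: eq_integral => x /set_mem Sx.
have g0 := ell_gt0 hL Sx.
rewrite pull_field_div//; last exact: act_S2.
rewrite actK// ell_act// exprVn invrK.
by move: (sphere_div X x) => d; congr EFin; field; rewrite gt_eqF.
Qed.

(** The Jacobian weight of [change_var_integrable] is removed by multiplying with ell^2, which is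
    bounded on the sphere. *)
Lemma ell_integrableM (L : @lorentz R) f : is_lorentz L ->
  domega.-integrable S2 (EFin \o f) -> domega.-integrable S2 (EFin \o (fun x => f (act L x))).
Proof.
move=> hL i; have := integrable_continuousM (change_var_integrable hL i)
  (fun x _ => C1_cont (C1M (C1_ell L x) (C1_ell L x))).
apply: eq_integrable; first exact: measurable_S2.
move=> x /set_mem Sx /=; have := ell_gt0 hL Sx => g0; congr EFin; field.
by rewrite gt_eqF.
Qed.

(** 3/4 of the logarithm of the Jacobian ell^-2, plus a constant: the shape of psi. *)
Definition log_factor (L : @lorentz R) (c : R) (x : R3 R) : R := - (3 / 2) * ln (ell L x) + c.

Definition log_factor_grad (L : @lorentz R) (x : R3 R) : R3 R :=
  - (3 / 2) *: polar_field (la L) (ll L) x.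

Lemma C1_log_factor (L : @lorentz R) c x : is_lorentz L -> S2 x -> C1 (log_factor L c) x.
Proof.
move=> hL Sx; exact: (C1D (C1M (C1_cst _ _) (C1_ln (ell_gt0 hL Sx) (C1_ell L x))) (C1_cst _ _)).
Qed.

Lemma ell_polar (L : @lorentz R) : is_lorentz L -> C1_tangent_field (polar_field (la L) (ll L)).
Proof.
by move=> hL; apply: polar_field_tangent => x Sx; rewrite gt_eqF//; exact: (ell_gt0 hL Sx).
Qed.

Lemma log_factor_weak (L : @lorentz R) c : is_lorentz L ->
  is_weak_gradient (log_factor L c) (log_factor_grad L).
Proof.
move=> hL; have hp := ell_polar hL; apply: weak_gradient_C1.
- by move=> x Sx; exact: C1_log_factor.
- by move=> x Sx; apply: cvgZr; exact: (tangent_continuous hp Sx).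
- move=> x Sx; have := hp.1 x Sx; rewrite !dotE /log_factor_grad /= => e.
  have sc (a b : R) : a *: b = a * b by [].
  rewrite !sc; rewrite -[RHS](mulr0 (- (3 / 2))) -e; ring.
- move=> x v Sx tv; have g0 := ell_gt0 hL Sx.
  have c1 := C1_ell L x.
  have hl : has_diff (ell L) x (dot (ll L)).
    by apply: (has_diff_eq (has_diffD (has_diff_cst (la L) x) (has_diff_dot (ll L) x))) => w; rewrite add0r.
  have hln : has_diff (fun x => ln (ell L x)) x (fun v => (ell L x)^-1 * dot (ll L) v).
    split; first exact: C1_diff (C1_ln g0 c1).
    by move=> w; rewrite (derive_ln _ g0 hl.1) hl.2.
  have [_ ->] := has_diffD (has_diffM (has_diff_cst (- (3 / 2)) x) hln) (has_diff_cst c x).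
  rewrite /log_factor_grad /polar_field -/(ell L x).
  have sc (a b : R) : a *: b = a * b by [].
  rewrite [in RHS]dotE /= !sc.
  move: tv; rewrite dotE => tv.
  transitivity (- (3/2) * ((dot (ll L) v - dot (ll L) x * (x.1.1 * v.1.1 + x.1.2 * v.1.2 + x.2 * v.2)) / ell L x)).
    by rewrite tv; field; rewrite gt_eqF.
  by rewrite (dotE (ll L) v); field; rewrite gt_eqF.
Qed.

End WeakGradient.

(** * Measurability and domination of iterated integrals *)

Section Iterated.
Context {R : realType}.
Local Notation D := (@S2 R `*` @S2 R).
Local Open Scope ereal_scope.

Lemma measurable_section1 (F : R3 R -> R3 R -> R) x :
  measurable_fun D (fun p => F p.1 p.2) -> S2 x -> measurable_fun S2 (F x).
Proof.
move=> mF Sx.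
apply: (measurable_comp (@measurable_S2S2 R) (g := fun y : R3 R => (x, y)) _ mF).
  by move=> _ [y Sy <-].
by apply: measurable_funTS; exact: pair1_measurable.
Qed.

Lemma measurable_iterated (F : R3 R -> R3 R -> R) :
  measurable_fun D (fun p => F p.1 p.2) ->
  (forall x y, S2 x -> S2 y -> 0 <= F x y)%R ->
  measurable_fun S2 (fun x => \int[domega]_(y in S2) (F x y)%:E).
Proof.
move=> mF F0.
pose f : R3 R * R3 R -> \bar R := (fun p => (F p.1 p.2)%:E) \_ D.
have mf : measurable_fun setT f.
  apply/(measurable_restrictT _ _).1; first exact: measurable_S2S2.
  exact/measurable_EFinP.
have f0 p : 0 <= f p.
  by rewrite /f patchE; case: ifPn => // /set_mem[S1 S2']; rewrite lee_fin F0.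
have := measurable_fun_fubini_tonelli_F (m2 := sph) f mf f0.
move=> /(measurable_funTS (D := @S2 R)); apply: eq_measurable_fun => x /set_mem Sx.
rewrite /fubini_F [RHS]integral_mkcond; apply: eq_integral => y _.
rewrite /f !patchE (_ : ((x, y) \in D) = (y \in @S2 R))//.
by apply/idP/idP => [/set_mem[_ ?]|/set_mem ?]; apply/mem_set.
Qed.

Lemma iterated_lt (F G : R3 R -> R3 R -> R) (g : R3 R -> R) :
  measurable_fun D (fun p => F p.1 p.2) -> measurable_fun D (fun p => G p.1 p.2) ->
  (forall x y, S2 x -> S2 y -> `|F x y| <= G x y)%R ->
  (forall x, S2 x -> \int[domega]_(y in S2) (G x y)%:E <= (g x)%:E) ->
  domega.-integrable S2 (EFin \o g) ->
  \int[domega]_(x in S2) \int[domega]_(y in S2) `|F x y|%:E < +oo.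
Proof.
move=> mF mG FG Gg ig.
have mN : measurable_fun D (fun p => `|F p.1 p.2|%R) by exact: measurableT_comp.
have h x : S2 x -> \int[domega]_(y in S2) `|F x y|%:E <= (g x)%:E.
  move=> Sx; apply: le_trans (Gg x Sx); apply: ge0_le_integral => //.
  - exact: measurable_S2.
  - by apply/measurable_EFinP; exact: (measurable_section1 (F := fun x y => `|F x y|%R) mN Sx).
  - by apply/measurable_EFinP; exact: (measurable_section1 mG Sx).
  - by move=> y Sy; rewrite lee_fin FG.
have igl := integral_fune_lt_pinfty measurable_S2 ig.
apply: le_lt_trans igl; apply: ge0_le_integral => //.
- exact: measurable_S2.
- by move=> x Sx; apply: integral_ge0 => y _; rewrite lee_fin.
- by apply: (measurable_iterated (F := fun x y => `|F x y|%R) mN).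
- exact: (measurable_int domega ig).
Qed.

Lemma measurable_dot_prod : measurable_fun D (fun p => dot p.1 p.2).
Proof.
rewrite (_ : (fun p => _) = (fun p : R3 R * R3 R => p.1.1.1 * p.2.1.1 +
  p.1.1.2 * p.2.1.2 + p.1.2 * p.2.2)%R); last by apply/funext => p; rewrite dotE.
have mi : measurable_fun S2 (@id (R3 R)) by exact: measurable_id.
have [x1 x2 x3] := (measurable_field id).1 mi.
have H (g : R3 R -> R) : measurable_fun S2 g -> measurable_fun D (fun p => g p.1 * g p.2)%R.
  by move=> mg; apply: measurable_funM; [exact: measurable_fst_S2|exact: measurable_snd_S2].
by apply: measurable_funD; [apply: measurable_funD|]; [exact: (H _ x1)|exact: (H _ x2)|exact: (H _ x3)].
Qed.

Lemma measurable_poisson e : measurable_fun D (fun p => poisson e p.1 p.2).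
Proof.
apply: measurable_funM; first exact: measurable_cst.
apply: measurable_funV; apply: measurable_funX; apply: measurable_funB; first exact: measurable_cst.
exact: measurable_dot_prod.
Qed.

End Iterated.

(** * Poisson smoothing of integrable functions *)

Section PoissonSmoothing.
Context {R : realType}.
Local Notation D := (@S2 R `*` @S2 R).
Variables (f h : R3 R -> R).
Hypothesis cf : forall x, S2 x -> {for x, continuous f}.
Hypothesis f1 : forall x, S2 x -> `|f x| <= 1.
Hypothesis ih : domega.-integrable S2 (EFin \o h).

Let harmonic_gt0 n : 0 < harmonic n :> R.
Proof. by rewrite /harmonic /= invr_gt0. Qed.

Lemma poisson_fubini (e : R) : 0 < e ->
  domega.-integrable S2 (EFin \o (fun x => h x * \int[domega]_(y in S2) (poisson e x y * f y))) /\
  \int[domega]_(y in S2) (f y * \int[domega]_(x in S2) (h x * poisson e y x)) =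
  \int[domega]_(x in S2) (h x * \int[domega]_(y in S2) (poisson e x y * f y)).
Proof.
move=> e0; pose F x y := h x * (poisson e x y * f y).
have mh := integrable_measurable_S2 ih.
have mf := continuous_measurable_S2 cf.
have mF : measurable_fun D (fun p => F p.1 p.2).
  apply: measurable_funM; first exact: measurable_fst_S2.
  by apply: measurable_funM; [exact: measurable_poisson|exact: measurable_snd_S2].
have mG : measurable_fun D (fun p => `|h p.1| * poisson e p.1 p.2).
  apply: measurable_funM; last exact: measurable_poisson.
  by apply: (measurable_fst_S2 (g := fun x => `|h x|)); exact: measurableT_comp.
have ip x : S2 x -> domega.-integrable (@S2 R) (EFin \o poisson e x).
  by move=> Sx; apply: continuous_integrable_S2 => z Sz; exact: poisson_continuous.
have iF : (\int[domega]_(x in S2) \int[domega]_(y in S2) `|F x y|%:E < +oo)%E.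
  apply: (iterated_lt mF (G := fun x y => `|h x| * poisson e x y) mG (g := fun x => `|h x|)).
  - move=> x y Sx Sy; have p0 := poisson_ge0 x y e0.
    rewrite /F normrM ler_wpM2l// normrM (ger0_norm p0) ler_piMr//; exact: f1.
  - move=> x Sx; rewrite EFin_Rintegral.
      by rewrite (RintegralZl _ measurable_S2 (ip x Sx)) poisson_integral// mulr1.
    exact: (integrableZl measurable_S2 `|h x| (ip x Sx)).
  - exact: (integrable_norm ih).
have R1 x : S2 x -> (\int[domega]_(y in S2) (F x y)%:E =
    (h x * \int[domega]_(y in S2) (poisson e x y * f y))%:E)%E.
  move=> Sx; have i := poisson_integrable cf e0 Sx.
  rewrite EFin_Rintegral; first by rewrite (RintegralZl _ measurable_S2 i).
  exact: (integrableZl measurable_S2 (h x) i).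
have R2 y : S2 y -> (\int[domega]_(x in S2) (F x y)%:E =
    (f y * \int[domega]_(x in S2) (h x * poisson e y x))%:E)%E.
  move=> Sy.
  have i : domega.-integrable (@S2 R) (EFin \o (fun x => h x * poisson e y x)).
    by apply: (integrable_continuousM ih) => x Sx; exact: poisson_continuous.
  transitivity (\int[domega]_(x in S2) (f y * (h x * poisson e y x))%:E)%E.
    by apply: eq_integral => x _; rewrite /F poissonC; congr EFin; ring.
  rewrite EFin_Rintegral; first by rewrite (RintegralZl _ measurable_S2 i).
  exact: (integrableZl measurable_S2 (f y) i).
have i1 : domega.-integrable S2 (EFin \o (fun x => h x * \int[domega]_(y in S2) (poisson e x y * f y))).
  by apply: (eq_integrable measurable_S2 _ _ _ (fubini_integrable1 mF iF)) => x /set_mem Sx; exact: R1.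
split; first exact: i1.
rewrite /Rintegral; apply: (congr1 fine).
transitivity (\int[domega]_(y in S2) \int[domega]_(x in S2) (F x y)%:E)%E.
  by apply: eq_integral => y /set_mem Sy; rewrite R2.
rewrite -(fubini_S2 mF iF).
by apply: eq_integral => x /set_mem Sx; rewrite R1.
Qed.

(** For a merely integrable [h] the convergence is obtained against continuous f: by symmetry of the
    kernel the smoothing is moved onto f, where it converges pointwise and stays bounded by 1. *)
Lemma poisson_smoothing :
  \int[domega]_(y in S2) (f y * \int[domega]_(x in S2) (h x * poisson (harmonic n) y x)) @[n --> \oo]
  --> \int[domega]_(x in S2) (h x * f x).
Proof.
rewrite (_ : (fun n => _) = (fun n => \int[domega]_(x in S2)
   (h x * \int[domega]_(y in S2) (poisson (harmonic n) x y * f y)))); last first.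
  by apply/funext => n; have [_ ->] := poisson_fubini (harmonic_gt0 n).
apply: (dct_S2 (g := fun x => `|h x|)).
- by move=> n; have [i _] := poisson_fubini (harmonic_gt0 n); exact: integrable_measurable_S2.
- by apply: measurable_funM; [exact: integrable_measurable_S2|exact: continuous_measurable_S2].
- move=> x Sx; apply: cvgM; first exact: cvg_cst.
  exact: (poisson_approx cf f1 Sx).
- exact: (integrable_norm ih).
- by move=> n x Sx; rewrite normrM ler_piMr//; exact: (poisson_le cf f1 (harmonic_gt0 n) Sx).
Qed.

End PoissonSmoothing.

(** * Uniqueness of the weak gradient *)

Section Uniqueness.
Context {R : realType}.

Lemma ae_zero_poisson (h : R3 R -> R) : domega.-integrable S2 (EFin \o h) ->
  (forall e y, 0 < e -> S2 y -> \int[domega]_(x in S2) (h x * poisson e y x) = 0) ->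
  {ae domega, forall x, S2 x -> h x = 0}.
Proof.
move=> ih H; apply: ae_zero_S2 => // f cf f1.
have cf' x : S2 x -> {for x, continuous f} by move=> _; exact: cf.
have c := poisson_smoothing cf' (fun x _ => f1 x) ih.
have e n : \int[domega]_(y in S2) (f y * \int[domega]_(x in S2) (h x * poisson (harmonic n) y x)) = 0.
  transitivity (\int[domega]_(y in @S2 R) (0 : R)); last by rewrite Rintegral_cst_S2.
  congr fine; apply: eq_integral => y /set_mem Sy.
  by rewrite H ?mulr0// /harmonic /= invr_gt0.
rewrite (funext e) in c.
transitivity (\int[domega]_(x in S2) (h x * f x)).
  by congr fine; apply: eq_integral => x _; rewrite mulrC.
rewrite -(cvg_lim (@Rhausdorff R) c); apply: (cvg_lim (@Rhausdorff R)); exact: cvg_cst.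
Qed.

(** On the sphere, the tangential projection of a basis vector; its product with a tangent vector at
    [x] is the i-th coordinate of that vector. *)
Definition tangent_std (i : 'I_3) (x : R3 R) : R3 R := std_basis i - coord3 x i *: x.

Lemma tangent_std_field (f : R3 R -> R) i : (forall x, S2 x -> C1 f x) ->
  C1_tangent_field (scale_field f (tangent_std i)).
Proof.
move=> cf; apply: scale_field_tangent => //; split.
  have sc (a b : R) : a *: b = a * b by [].
  move=> x; rewrite /S2 /= dotE => e.
  have H (a b : R) : b = 1 -> a - a * b = 0 by move=> ->; rewrite mulr1 subrr.
  rewrite -(H (coord3 x i) _ e) dotE /tangent_std /= !sc.
  by case: i => [[|[|[|//]]]] lt3; rewrite /coord3 /=; ring.
move=> p _; have c1 := C1_x1 p; have c2 := C1_x2 p; have c3 := C1_x3 p.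
have ci : C1 (fun x : R3 R => coord3 x i) p.
  case: i => [[|[|[|k]]] lt3]; [exact: c1|exact: c2|exact: c3|by exfalso].
apply: C1_field.
- exact: (C1B (C1_cst _ _) (C1M ci c1)).
- exact: (C1B (C1_cst _ _) (C1M ci c2)).
- exact: (C1B (C1_cst _ _) (C1M ci c3)).
Qed.

(** Testing with a Poisson kernel times [tangent_std i] yields the Poisson integral of the i-th
    coordinate of the gradient, so these integrals agree for [V] and [W]. *)
Lemma weak_gradient_unique (u : R3 R -> R) (V W : R3 R -> R3 R) :
  is_weak_gradient u V -> is_weak_gradient u W ->
  {ae domega, forall x, S2 x -> V x = W x}.
Proof.
move=> [mV iV tV wV] [mW iW tW wW].
have L2i (Y : R3 R -> R3 R) i : measurable_fun S2 Y ->
   domega.-integrable S2 (EFin \o (fun x => dot (Y x) (Y x))) ->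
   domega.-integrable S2 (EFin \o (fun x => coord3 (Y x) i)).
  move=> mY iY; have [a b c] := (measurable_field _).1 mY.
  have mi : measurable_fun S2 (fun x => coord3 (Y x) i) by case: i => [[|[|[|//]]]] lt3.
  apply: L2_L1 => //; apply: (integrable_le _ iY); first exact: measurable_funX.
  move=> x _; rewrite ger0_norm ?sqr_ge0// dotE -!expr2.
  have := sqr_ge0 (Y x).1.1; have := sqr_ge0 (Y x).1.2; have := sqr_ge0 (Y x).2.
  by case: i {mi} => [[|[|[|//]]]] lt3; rewrite /coord3 /= => *; lra.
have K i : {ae domega, forall x, S2 x -> coord3 (V x) i - coord3 (W x) i = 0}.
  have iVi := L2i V i mV iV; have iWi := L2i W i mW iW.
  apply: ae_zero_poisson; first exact: (integrableB measurable_S2 iVi iWi).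
  move=> e y e0 Sy.
  have cp x : S2 x -> C1 (poisson e y) x by move=> Sx; exact: C1_poisson.
  have cp' x (Sx : S2 x) := C1_cont (cp x Sx).
  have hX := tangent_std_field i cp.
  have tE (Y : R3 R -> R3 R) x : dot x (Y x) = 0 ->
      dot (Y x) (scale_field (poisson e y) (tangent_std i) x) = coord3 (Y x) i * poisson e y x.
    have sc (a b : R) : a *: b = a * b by [].
    rewrite !dotE /scale_field /X1 /X2 /X3 /tangent_std /= !sc => t.
    move: (poisson e y x) => P.
    have H (a b : R) : b = 0 -> a = a - P * coord3 x i * b by move=> ->; rewrite mulr0 subr0.
    rewrite [RHS](H _ _ t).
    by case: i {iVi iWi hX} H => [[|[|[|//]]]] lt3 _; rewrite /coord3 /=; ring.
  transitivity (\int[domega]_(x in S2) (coord3 (V x) i * poisson e y x - coord3 (W x) i * poisson e y x)).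
    by congr fine; apply: eq_integral => x _; rewrite mulrBl.
  rewrite (RintegralB measurable_S2 (integrable_continuousM iVi cp') (integrable_continuousM iWi cp')).
  apply/eqP; rewrite subr_eq0; apply/eqP.
  transitivity (\int[domega]_(x in S2) dot (V x) (scale_field (poisson e y) (tangent_std i) x)).
    by congr fine; apply: eq_integral => x /set_mem Sx; rewrite tE// tV.
  rewrite (wV _ hX) -(wW _ hX).
  by congr fine; apply: eq_integral => x /set_mem Sx; rewrite tE// tW.
apply: filterS3 (K ord0) (K (inord 1)) (K (inord 2)) => x h0 h1 h2 Sx.
move: (h0 Sx) (h1 Sx) (h2 Sx).
rewrite /coord3 !inordK//=; case: (V x) (W x) => [[v1 v2] v3] [[w1 w2] w3] /=.
by move=> /eqP + /eqP + /eqP; rewrite !subr_eq0 => /eqP -> /eqP -> /eqP ->.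
Qed.

Lemma gradient_energy (u : R3 R -> R) (V : R3 R -> R3 R) : is_weak_gradient u V ->
  \int[domega]_(x in S2) dot (gradient u x) (gradient u x) =
  \int[domega]_(x in S2) dot (V x) (V x).
Proof.
move=> hV; have hG : is_weak_gradient u (gradient u) by apply: xgetPex; exists V.
congr fine; apply: ae_eq_integral.
- exact: measurable_S2.
- by case: hG => m i _ _; apply/measurable_EFinP; exact: measurable_dotS2.
- by case: hV => m i _ _; apply/measurable_EFinP; exact: measurable_dotS2.
by have := weak_gradient_unique hG hV; apply: filterS => x h Sx; rewrite h.
Qed.

End Uniqueness.

(** * Fubini with the variables exchanged *)

Section FubiniSwap.
Context {R : realType}.
Local Notation D := (@S2 R `*` @S2 R).
Local Open Scope ereal_scope.

Lemma measurable_swap_S2 (F : R3 R -> R3 R -> R) :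
  measurable_fun D (fun p => F p.1 p.2) -> measurable_fun D (fun p => F p.2 p.1).
Proof.
move=> mF.
apply: (measurable_comp (@measurable_S2S2 R) (g := fun p : R3 R * R3 R => (p.2, p.1)) _ mF).
  by move=> _ [p [? ?] <-].
by apply: measurable_funTS; apply: measurable_fun_pair; [exact: measurable_snd|exact: measurable_fst].
Qed.

Lemma fubini_integrable2 (F : R3 R -> R3 R -> R) :
  measurable_fun D (fun p => F p.1 p.2) ->
  \int[domega]_(x in S2) \int[domega]_(y in S2) `|F x y|%:E < +oo ->
  domega.-integrable S2 (fun y => \int[domega]_(x in S2) (F x y)%:E).
Proof.
move=> mF iF; apply: (fubini_integrable1 (F := fun y x => F x y)).
  exact: measurable_swap_S2.
rewrite -(fubini_S2 (F := fun x y => `|F x y|%R)); first exact: iF.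
  exact: measurableT_comp.
by under eq_integral do under eq_integral do rewrite normr_id.
Qed.

End FubiniSwap.

(** * Orthogonal maps and zonal integrals *)

Section Reflection.
Context {R : realType}.

(** The reflection x - 2 (w.x / w.w) w across the plane orthogonal to [w], as a Lorentz matrix
    without boost. *)
Definition reflection (w : R3 R) : @lorentz R :=
  {| la := 1; ll := (0, 0, 0); lN := (0, 0, 0);
     m1 := (1 - 2 * w.1.1 * w.1.1 / dot w w, - (2 * w.1.1 * w.1.2 / dot w w), - (2 * w.1.1 * w.2 / dot w w));
     m2 := (- (2 * w.1.1 * w.1.2 / dot w w), 1 - 2 * w.1.2 * w.1.2 / dot w w, - (2 * w.1.2 * w.2 / dot w w));
     m3 := (- (2 * w.1.1 * w.2 / dot w w), - (2 * w.1.2 * w.2 / dot w w), 1 - 2 * w.2 * w.2 / dot w w) |}.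

Lemma reflection_lorentz w : dot w w != 0 -> is_lorentz (reflection w).
Proof.
rewrite /is_lorentz /reflection dotE; case: w => [[a b] c] /= w0.
by split => //; split; rewrite /= !dotE /=; field.
Qed.

Lemma dot_reflection (w n x : R3 R) : dot w w != 0 ->
  dot n (act (reflection w) x) = dot n x - 2 * dot w x * dot w n / dot w w.
Proof.
rewrite /act /ell /reflection (dotE w w); case: w => [[a b] c] /= w0; rewrite !dotE /=.
by rewrite !mul0r !add0r !addr0; field.
Qed.

Definition lorentz_id : @lorentz R :=
  {| la := 1; ll := (0, 0, 0); lN := (0, 0, 0);
     m1 := (1, 0, 0); m2 := (0, 1, 0); m3 := (0, 0, 1) |}.

(** Since l and n have equal length, the reflection along l - n exchanges them; when l = n the
    identity serves. *)
Lemma rotation_exists (l n : R3 R) : dot l l = dot n n ->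
  exists H : @lorentz R, [/\ is_lorentz H, (forall x, ell H x = 1) &
    (forall x, dot n (act H x) = dot l x)].
Proof.
move=> ln; have [w0|w0] := eqVneq (dot (l - n) (l - n)) 0.
  have -> : l = n.
    apply/eqP; rewrite -subr_eq0; apply/eqP; move: (l - n) w0 => [[a b] c].
    rewrite dotE /= -!expr2 => /eqP; rewrite paddr_eq0 ?addr_ge0 ?sqr_ge0//.
    by rewrite paddr_eq0 ?sqr_ge0// !sqrf_eq0 => /andP[/andP[/eqP -> /eqP ->] /eqP ->].
  exists lorentz_id; split.
  - by split => //; split; rewrite /= !dotE /=; ring.
  - by move=> x; rewrite /ell dotE /=; ring.
  - move=> x; rewrite /act (_ : ell _ _ = 1) ?invr1; last by rewrite /ell dotE /=; ring.
    by rewrite !dotE /=; ring.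
exists (reflection (l - n)); split.
- exact: reflection_lorentz.
- by move=> x; rewrite /ell dotE /=; ring.
move=> x; rewrite dot_reflection//.
have e : dot (l - n) n = - (dot (l - n) (l - n) / 2).
  move: ln; rewrite !dotE /= => ln.
  by lra.
rewrite e (_ : _ - _ = dot n x + dot (l - n) x); last by field.
by rewrite !dotE /=; ring.
Qed.

Local Notation lam := (@lebesgue_measure R).

(** An orthogonal map carries [y] to the north pole and preserves the area; there the integrand
    depends on the height alone, which is uniformly distributed on [-1, 1] (Archimedes). *)
Lemma zonal_integral (g : R -> R) (y : R3 R) : measurable_fun setT g -> (forall z, 0 <= g z) -> S2 y ->
  (\int[domega]_(x in S2) (g (dot y x))%:E = (2^-1)%:E * \int[lam]_(z in `[(-1)%R, 1%R]) (g z)%:E)%E.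
Proof.
move=> mg g0 Sy; pose e3 : R3 R := (0, 0, 1).
have Se : dot e3 e3 = 1 by rewrite dotE /=; ring.
have yn : dot y y = dot e3 e3 by rewrite Se.
have [H [hH eH dH]] := rotation_exists yn.
have mge : measurable_fun setT (fun x => g (dot e3 x)).
  by apply: measurableT_comp => //; rewrite (funext (dotC _)); exact: measurable_dot.
transitivity (\int[domega]_(x in S2) (g (dot e3 x))%:E)%E.
  rewrite -(change_var_ge0 (f := fun x => g (dot e3 x)) hH)//; last by exact: measurable_funTS.
  by apply: eq_integral => x _; rewrite eH dH expr1n invr1 mulr1.
rewrite integral_S2; last exact/measurable_EFinP.
rewrite domega_integral_fubini; [|exact/measurable_EFinP|by move=> x; rewrite lee_fin].
have pi0 := @pi_gt0 R.
have -> : (\int[lam]_(z in `[(-1)%R, 1%R]) \int[lam]_(t in `[0%R, (2 * pi)%R])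
    (g (dot e3 (cylindrical (t, z))))%:E = \int[lam]_(z in `[(-1)%R, 1%R]) ((2 * pi)%:E * (g z)%:E))%E.
  apply: eq_integral => z _.
  have -> : (fun t => (g (dot e3 (cylindrical (t, z))))%:E) = (fun=> (g z)%:E).
    by apply/funext => t; rewrite dotE /= !mul0r mul1r !add0r.
  rewrite integral_cst; last exact: measurable_itv.
  have pp : 0 < 2 * pi :> R by rewrite mulr_gt0.
  by rewrite [X in (_ * X)%E](lebesgue_measure_itvcc pp) subr0 muleC.
rewrite ge0_integralZl//; last 3 first.
- by apply/measurable_EFinP; exact: measurable_funTS.
- by move=> z _; rewrite lee_fin.
- by rewrite lee_fin mulr_ge0// ltW.
rewrite muleA -EFinM; congr (_%:E * _)%E.
by move: pi0; move: pi => p p0; field; rewrite gt_eqF.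
Qed.

End Reflection.

(** * One-dimensional kernel integrals *)

Section Kernels.
Context {R : realType}.
Local Notation lam := (@lebesgue_measure R).

Lemma is_derive_kernel (a c z : R) : 0 < c - z ->
  is_derive z 1 (fun z => expR (a * ln ((c - z) / 2))) (expR (a * ln ((c - z) / 2)) * (a * - (c - z)^-1)).
Proof.
move=> cz; have r0 : 0 < (c - z) / 2 by rewrite divr_gt0.
have d1 : is_derive z 1 (fun z : R => (c - z) / 2) (- 2^-1).
  have -> : (fun z : R => (c - z) / 2) = (fun z => 2^-1 *: (cst c z - id z)).
    by apply/funext => t; rewrite mulrC.
  have := is_deriveZ (2^-1) (is_deriveB (is_derive_cst c z 1) (is_derive_id z 1)).
  by move/is_derive_eq; apply; rewrite sub0r scalerN; congr (- _); rewrite -[RHS]mulr1.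
have d2 := @is_derive1_comp R (@ln R) (fun z : R => (c - z) / 2) z _ _ (is_derive1_ln r0) d1.
have d3 : is_derive z 1 (fun z => a * ln ((c - z) / 2)) _ := is_deriveZ a d2.
have := @is_derive1_comp R expR (fun z => a * ln ((c - z) / 2)) z _ _
  (is_derive_expR (a * ln ((c - z) / 2))) d3.
move/is_derive_eq; apply.
have sc (x y : R) : x *: y = x * y by [].
by rewrite !sc; congr (_ * (_ * _)); field; rewrite gt_eqF.
Qed.

Lemma continuous_kernel (a c z : R) : 0 < c - z ->
  {for z, continuous (fun z : R => expR (a * ln ((c - z) / 2)))}.
Proof.
move=> cz; apply: differentiable_continuous; apply/derivable1_diffP.
by case: (is_derive_kernel a cz).
Qed.

Lemma kernel_FTC (e : R) : 0 < e ->
  (\int[lam]_(z in `[(-1)%R, 1%R]) (expR (- (3 / 4) * ln ((1 + e - z) / 2)))%:E =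
   (8 * (expR (4^-1 * ln ((2 + e) / 2)) - expR (4^-1 * ln (e / 2))))%:E)%E.
Proof.
move=> e0.
(* With r = (1 + e - z) / 2, a primitive of r^(-3/4) is -8 r^(1/4); powers are written through exp
   and ln, and e > 0 keeps r positive up to z = 1. *)
pose F (z : R) : R := - 8 * expR (4^-1 * ln ((1 + e - z) / 2)).
have dF (z : R) : z <= 1 -> is_derive z 1 F (expR (- (3 / 4) * ln ((1 + e - z) / 2))).
  move=> z1; have cz : 0 < 1 + e - z by lra.
  have := is_deriveZ (- 8) (is_derive_kernel (4^-1) cz).
  move/is_derive_eq; apply.
  have sc (x y : R) : x *: y = x * y by [].
  have r0 : 0 < (1 + e - z) / 2 by rewrite divr_gt0.
  rewrite sc (_ : - (3 / 4) * _ = 4^-1 * ln ((1 + e - z) / 2) - ln ((1 + e - z) / 2)); last by field.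
  rewrite expRD expRN lnK ?posrE//.
  by move: (expR _) => E; field; rewrite gt_eqF.
have cF (z : R) : z <= 1 -> {for z, continuous F}.
  move=> z1; apply: differentiable_continuous; apply/derivable1_diffP.
  by case: (dF z z1).
rewrite (@continuous_FTC2 R _ F (-1) 1).
- rewrite /F -EFinB; congr EFin.
  rewrite (_ : 1 + e - 1 = e); last by ring.
  rewrite (_ : 1 + e - -1 = 2 + e); last by ring.
  by ring.
- by lra.
- apply: continuous_in_subspaceT => z /set_mem /=; rewrite in_itv /= => /andP[_ z1].
  by apply: continuous_kernel; lra.
- split.
  + by move=> z; rewrite in_itv/= => /andP[_ /ltW z1]; case: (dF z z1).
  + by apply: cvg_at_right_filter; apply: cF; lra.
  + by apply: cvg_at_left_filter; apply: cF.
- move=> z; rewrite in_itv/= => /andP[_ /ltW z1]; rewrite derive1E.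
  by case: (dF z z1).
Qed.

Lemma log_FTC (e : R) : 0 < e ->
  (\int[lam]_(z in `[(-1)%R, 1%R]) (((1 + e - z) / 2)^-1)%:E =
   (2 * (ln ((2 + e) / 2) - ln (e / 2)))%:E)%E.
Proof.
move=> e0.
pose F (z : R) : R := - 2 * ln ((1 + e - z) / 2).
have dF (z : R) : z <= 1 -> is_derive z 1 F (((1 + e - z) / 2)^-1).
  move=> z1; have cz : 0 < 1 + e - z by lra.
  have r0 : 0 < (1 + e - z) / 2 by rewrite divr_gt0.
  have d1 : is_derive z 1 (fun z : R => (1 + e - z) / 2) (- 2^-1).
    have -> : (fun z : R => (1 + e - z) / 2) = (fun z => 2^-1 *: (cst (1 + e) z - id z)).
      by apply/funext => t; rewrite mulrC.
    have := is_deriveZ (2^-1) (is_deriveB (is_derive_cst (1 + e) z 1) (is_derive_id z 1)).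
    by move/is_derive_eq; apply; rewrite sub0r scalerN; congr (- _); rewrite -[RHS]mulr1.
  have := is_deriveZ (- 2) (@is_derive1_comp R (@ln R) (fun z : R => (1 + e - z) / 2) z _ _ (is_derive1_ln r0) d1).
  move/is_derive_eq; apply.
  have sc (x y : R) : x *: y = x * y by [].
  by rewrite !sc; field; rewrite gt_eqF.
have cF (z : R) : z <= 1 -> {for z, continuous F}.
  move=> z1; apply: differentiable_continuous; apply/derivable1_diffP.
  by case: (dF z z1).
rewrite (@continuous_FTC2 R _ F (-1) 1).
- rewrite /F -EFinB; congr EFin.
  rewrite (_ : 1 + e - 1 = e); last by ring.
  rewrite (_ : 1 + e - -1 = 2 + e); last by ring.
  by ring.
- by lra.
- apply: continuous_in_subspaceT => z /set_mem /=; rewrite in_itv /= => /andP[_ z1].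
  apply: cvgV; first by rewrite gt_eqF// divr_gt0//; lra.
  apply: cvgM; last exact: cvg_cst.
  by apply: cvgB; [exact: cvg_cst|exact: cvg_id].
- split.
  + by move=> z; rewrite in_itv/= => /andP[_ /ltW z1]; case: (dF z z1).
  + by apply: cvg_at_right_filter; apply: cF; lra.
  + by apply: cvg_at_left_filter; apply: cF.
- move=> z; rewrite in_itv/= => /andP[_ /ltW z1]; rewrite derive1E.
  by case: (dF z z1).
Qed.

Lemma measurable_ln_kernel (a c : R) : measurable_fun setT (fun z : R => expR (a * ln ((c - z) / 2))).
Proof.
apply: measurableT_comp; first exact: measurable_expR.
apply: measurable_funM => //; apply: measurableT_comp; first exact: measurable_ln.
by apply: measurable_funM => //; exact: measurable_funB.
Qed.

Lemma ln2_le1 : ln (2 : R) <= 1.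
Proof.
rewrite -ler_expR lnK ?posrE//; exact: expR_ge1Dx.
Qed.

(** Monotone convergence from [kernel_FTC] along e = [harmonic n], which removes the singularity at
    z = 1 at each stage. *)
Lemma kernel_bound :
  (\int[lam]_(z in `[(-1)%R, 1%R]) (expR (- (3 / 4) * ln ((1 - z) / 2)))%:E <= 12%:E)%E.
Proof.
have h0 n : 0 < harmonic n :> R by rewrite /harmonic /= invr_gt0.
have h1 n : harmonic n <= 1 :> R by rewrite /harmonic /= invf_le1// ler1n.
pose g n (z : R) := (expR (- (3 / 4) * ln ((1 + harmonic n - z) / 2)))%:E.
have mg n D : measurable_fun D (g n).
  by apply: measurable_funTS; apply/measurable_EFinP; exact: measurable_ln_kernel.
have mon (z : R) : `[(-1)%R, 1%R[%classic z -> {homo g^~ z : n m / (n <= m)%N >-> (n <= m)%E}.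
  rewrite /= in_itv /= => /andP[_ z1] n m nm.
  have q : - (3 / 4) < 0 :> R by lra.
  rewrite lee_fin ler_expR (ler_nM2l q).
  have hnm : harmonic m <= harmonic n :> R.
    by rewrite /harmonic /= lef_pV2 ?posrE// ler_nat ltnS.
  have := h0 m; have := h0 n => hn hm.
  by rewrite ler_ln ?posrE ?divr_gt0//; lra.
have c := @cvg_monotone_convergence _ _ R lam `[(-1)%R, 1%R[%classic (measurable_itv _) g
  (fun n => mg n _) (fun n x _ => expR_ge0 _) mon.
(* At z = 1 the kernel takes the value 1, because [ln 0 = 0], and this is not the limit of the
   regularized kernels; the end point is dropped as a null set. *)
rewrite -integral_itv_bndo_bndc; last first.
  by apply: measurable_funTS; apply/measurable_EFinP; exact: (measurable_ln_kernel (- (3 / 4)) 1).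
have -> : (\int[lam]_(z in `[(-1)%R, 1%R[) (expR (- (3 / 4) * ln ((1 - z) / 2)))%:E =
    \int[lam]_(z in `[(-1)%R, 1%R[) limn (g^~ z))%E.
  apply: eq_integral => z /set_mem /=; rewrite in_itv /= => /andP[_ z1].
  apply/esym/cvg_lim => //; apply/fine_cvgP; split; first exact: nearW.
  have z0 : 0 < 1 - z by rewrite subr_gt0.
  have ck := @continuous_kernel (- (3 / 4)) 1 z z0.
  have cz : z - harmonic n @[n --> \oo] --> z.
    by rewrite -[X in _ --> X]subr0; apply: cvgB; [exact: cvg_cst|exact: cvg_harmonic].
  have := cvg_comp _ _ cz ck; apply: cvg_trans; apply: near_eq_cvg; apply: nearW => n /=.
  by rewrite opprB addrA.
rewrite -(cvg_lim _ c)//; apply: lime_le; first by apply/cvg_ex; eexists; exact: c.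
apply: nearW => n; rewrite integral_itv_bndo_bndc; last exact: mg.
rewrite /g kernel_FTC// lee_fin.
have := expR_ge0 (4^-1 * ln (harmonic n / 2 : R)).
(* A number at least 1 dominates its fourth root, and (2 + harmonic n) / 2 is at most 3/2; hence 12
   = 8 * 3/2. *)
have h2 : 1 <= (2 + harmonic n) / 2 :> R by rewrite ler_pdivlMr//; have := h0 n; lra.
have h3 : expR (4^-1 * ln ((2 + harmonic n) / 2)) <= (2 + harmonic n) / 2 :> R.
  rewrite -[X in _ <= X]lnK ?posrE ?(lt_le_trans ltr01)// ler_expR.
  by rewrite ler_piMl ?ln_ge0//; lra.
have := h1 n; lra.
Qed.

End Kernels.

(** * Singular kernels on the sphere *)

Section SphericalKernels.
Context {R : realType}.
Implicit Types (x y v : R3 R).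
Local Notation D := (@S2 R `*` @S2 R).

(** rho^(-3/4), where rho = (1 - x.y) / 2 is the square of half the chord. On the diagonal the value
    is 1, since [ln 0 = 0]; [hker] below is rho^(-1/2) with the same convention. *)
Definition sker (x y : R3 R) : R := expR (- (3 / 4) * ln ((1 - dot x y) / 2)).

Lemma sker_gt0 x y : 0 < sker x y. Proof. exact: expR_gt0. Qed.

Lemma sker_integral y : S2 y -> (\int[domega]_(x in S2) (sker y x)%:E <= 6%:E)%E.
Proof.
move=> Sy.
have := zonal_integral (g := fun z => expR (- (3 / 4) * ln ((1 - z) / 2)))
  (measurable_ln_kernel _ _) (fun z => expR_ge0 _) Sy.
move=> ->; apply: (@le_trans _ _ ((2^-1)%:E * 12%:E)%E).
  by apply: lee_wpmul2l; [rewrite lee_fin|exact: kernel_bound].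
by rewrite -EFinM lee_fin; lra.
Qed.

Lemma log_integral (e : R) y : 0 < e -> S2 y ->
  (\int[domega]_(x in S2) (((1 + e - dot y x) / 2)^-1)%:E = (ln ((2 + e) / 2) - ln (e / 2))%:E)%E.
Proof.
move=> e0 Sy.
transitivity (\int[domega]_(x in S2) (`|((1 + e - dot y x) / 2)^-1|)%:E)%E.
  apply: eq_integral => x /set_mem Sx; rewrite ger0_norm// invr_ge0 divr_ge0//.
  by have := dot_le1 Sy Sx; rewrite ler_norml => /andP[_]; lra.
rewrite (zonal_integral (g := fun z => `|((1 + e - z) / 2)^-1|))//; last first.
  apply: measurableT_comp => //; apply: measurable_funV; apply: measurable_funM => //.
  exact: measurable_funB.
transitivity ((2^-1)%:E * \int[@lebesgue_measure R]_(z in `[(-1)%R, 1%R]) (((1 + e - z) / 2)^-1)%:E)%E.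
  congr (_ * _)%E; apply: eq_integral => z /set_mem /=; rewrite in_itv /= => /andP[_ z1].
  by rewrite ger0_norm// invr_ge0 divr_ge0//; lra.
by rewrite log_FTC// -EFinM; congr EFin; field.
Qed.

Lemma measurable_sker : measurable_fun D (fun p => sker p.1 p.2).
Proof.
apply: (measurableT_comp (f := fun z : R => expR (- (3 / 4) * ln ((1 - z) / 2)))).
  exact: measurable_ln_kernel.
exact: measurable_dot_prod.
Qed.

Definition vnorm v : R := Num.sqrt (dot v v).

Lemma vnorm_sqr v : vnorm v ^+ 2 = dot v v.
Proof. by rewrite sqr_sqrtr// dot_ge0. Qed.

Lemma vnorm_ge0 v : 0 <= vnorm v. Proof. exact: sqrtr_ge0. Qed.

Definition hker x y : R := expR (- 2^-1 * ln ((1 - dot x y) / 2)).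

Lemma half_chord_itv x y : S2 x -> S2 y -> 0 <= (1 - dot x y) / 2 <= 1.
Proof.
by move=> Sx Sy; have := dot_le1 Sx Sy; rewrite ler_norml => /andP[h1 h2]; lra.
Qed.

Lemma ln_le0_unit (r : R) : 0 <= r <= 1 -> ln r <= 0.
Proof. by move=> /andP[_ r1]; exact: ln_le0. Qed.

Lemma hker_le_sker x y : S2 x -> S2 y -> hker x y <= sker x y.
Proof.
move=> Sx Sy; rewrite ler_expR; have := ln_le0_unit (half_chord_itv Sx Sy).
by move: (ln _) => l; lra.
Qed.

Lemma hker_sqr x y : S2 x -> S2 y -> dot x y < 1 -> hker x y ^+ 2 = ((1 - dot x y) / 2)^-1.
Proof.
move=> Sx Sy s1; have r0 : 0 < (1 - dot x y) / 2 by lra.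
by rewrite -expRM_natl mulrA mulrN divff// mulN1r expRN lnK.
Qed.

(* For v tangent at x, <v, y> / (1 + e - <x, y>) is the pairing of v with the
   field polar_field (1 + e) (- y), up to sign. *)
Lemma tangent_kernel_le (e : R) x y v : 0 <= e -> S2 x -> S2 y -> dot x v = 0 ->
  `|dot v y / (1 + e - dot x y)| <= vnorm v * hker x y.
Proof.
move=> e0 Sx Sy t.
have nn : 0 <= vnorm v * hker x y by rewrite mulr_ge0 ?vnorm_ge0 ?expR_ge0.
rewrite -(@ler_pXn2r _ 2) ?nnegrE// real_normK ?num_real// !exprMn vnorm_sqr.
set s := dot x y.
(* Cauchy-Schwarz with y replaced by its tangential part at x, of squared length 1 - s^2. *)
have q : dot v y ^+ 2 <= dot v v * (1 - s ^+ 2).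
  have -> : dot v y = dot v (y - s *: x).
    have sc (a b : R) : a *: b = a * b by [].
    have h : dot v (- (s *: x)) = - (s * dot x v) by rewrite !dotE /= !sc; ring.
    by rewrite dotDr h t mulr0 subr0.
  apply: (le_trans (dot_sqr_le _ _)); rewrite le_eqVlt; apply/orP; left; apply/eqP; congr (_ * _).
  have : dot x x = 1 := Sx; have : dot y y = 1 := Sy.
  rewrite /s !dotE /= => sy sx.
  have sc (a b : R) : a *: b = a * b by [].
  rewrite !sc.
  set p := x.1.1 * y.1.1 + x.1.2 * y.1.2 + x.2 * y.2.
  transitivity ((y.1.1 * y.1.1 + y.1.2 * y.1.2 + y.2 * y.2) - 2 * p * (x.1.1 * y.1.1 + x.1.2 * y.1.2 + x.2 * y.2)
     + p ^+ 2 * (x.1.1 * x.1.1 + x.1.2 * x.1.2 + x.2 * x.2)).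
    by move: p => p; ring.
  by rewrite -/p sy sx; ring.
have := dot_le1 Sx Sy; rewrite -/s ler_norml => /andP[s0 s1].
(* On the diagonal [hker] is finite by convention, but there the numerator vanishes. *)
have [se|sn] := eqVneq s 1.
  have -> : dot v y ^+ 2 = 0.
    by apply/eqP; rewrite eq_le sqr_ge0 andbT (le_trans q)// se expr1n subrr mulr0.
  by rewrite mul0r mulr_ge0 ?dot_ge0 ?sqr_ge0.
have s1' : s < 1 by rewrite lt_neqAle sn.
rewrite hker_sqr// -/s.
apply: (@le_trans _ _ (dot v v * (1 - s ^+ 2) * (1 + e - s) ^- 2)).
  by rewrite exprVn ler_wpM2r// invr_ge0 sqr_ge0.
rewrite -mulrA ler_wpM2l ?dot_ge0//.
have d0 : 0 < 1 + e - s by lra.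
rewrite invf_div ler_pdivrMr ?exprn_gt0//.
rewrite mulrAC ler_pdivlMr ?subr_gt0//.
have h : (1 - s) ^+ 2 <= (1 + e - s) ^+ 2 by rewrite lerXn2r ?nnegrE//; lra.
apply: (@le_trans _ _ (2 * (1 - s) ^+ 2)); last by rewrite ler_pM2l.
rewrite (_ : _ * (1 - s) = (1 + s) * (1 - s) ^+ 2); last by ring.
by rewrite ler_wpM2r ?sqr_ge0//; lra.
Qed.

(** Let r be (1 - x.y) / 2 and k = [hker x y]. For r >= eta use a k <= 8 a^2 + k^2 / 32 together
    with k^2 = 1/r <= 2 / (r + eta). For 0 < r < eta = e^(-8n), r^(-1/2) = r^(1/4) r^(-3/4) <=
    e^(-2n) r^(-3/4). The weight 1/16 turns the 8n of the logarithmic integral into n/2, which is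
    less than n. *)
Lemma kernel_split (a n : R) x y : 0 <= a -> 0 <= n -> S2 x -> S2 y ->
  a * hker x y <= 8 * a ^+ 2 + 16^-1 * ((1 + 2 * expR (- 8 * n) - dot x y) / 2)^-1
    + expR (- 2 * n) * (a * sker x y).
Proof.
move=> a0 n0 Sx Sy; set eta := expR (- 8 * n).
have eta0 : 0 < eta by exact: expR_gt0.
have eta1 : eta <= 1 by rewrite -expR0 ler_expR; lra.
have := half_chord_itv Sx Sy; set r := (1 - dot x y) / 2 => /andP[r0 r1].
have -> : (1 + 2 * eta - dot x y) / 2 = r + eta by rewrite /r; lra.
have re0 : 0 < r + eta by rewrite ltr_wpDl.
have G0 : 0 <= expR (- 2 * n) * (a * sker x y).
  by rewrite !mulr_ge0 ?expR_ge0.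
have far : hker x y ^+ 2 <= 2 * (r + eta)^-1 ->
    a * hker x y <= 8 * a ^+ 2 + 16^-1 * (r + eta)^-1 + expR (- 2 * n) * (a * sker x y).
  move: (hker x y) ((r + eta)^-1) (expR (- 2 * n) * _) G0 => k i G G0 h.
  by have := sqr_ge0 (16 * a - k); lra.
(* Here [hker] has its conventional value 1, which satisfies the far estimate since eta <= 1. *)
have [re|rn] := eqVneq r 0.
  apply: far; rewrite /hker -/r re ln0// mulr0 expR0 expr1n add0r.
  by rewrite ler_pdivlMr// mul1r; lra.
have rp : 0 < r by rewrite lt_neqAle eq_sym rn.
have [er|re] := leP eta r.
  apply: far; rewrite hker_sqr//; last by rewrite /r in rp; lra.
  by rewrite -/r -[_^-1]mul1r ler_pdivrMr// mulrAC ler_pdivlMr//; lra.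
have : hker x y <= expR (- 2 * n) * sker x y.
  rewrite /hker /sker -expRD ler_expR -/r.
  have : ln r <= - 8 * n by rewrite -[leRHS]expRK ler_ln ?posrE// ltW.
  by move: (ln r) => l; lra.
move=> h; have : a * hker x y <= expR (- 2 * n) * (a * sker x y).
  by rewrite mulrCA ler_wpM2l.
move/le_trans; apply; rewrite lerDr addr_ge0// ?mulr_ge0 ?sqr_ge0//.
by rewrite invr_ge0 ltW.
Qed.

End SphericalKernels.

Lemma measurable_section2 {R : realType} (F : R3 R -> R3 R -> R) y :
  measurable_fun (@S2 R `*` @S2 R) (fun p => F p.1 p.2) -> S2 y -> measurable_fun S2 (F^~ y).
Proof.
by move=> mF; exact: (measurable_section1 (F := fun y x => F x y) (measurable_swap_S2 mF)).
Qed.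

(** * Representation by the weak gradient and integrability of the exponential *)

Section Representation.
Context {R : realType}.
Variables (u : R3 R -> R) (V : R3 R -> R3 R).
Hypothesis iu : domega.-integrable S2 (EFin \o u).
Hypothesis wV : is_weak_gradient u V.
Local Notation D := (@S2 R `*` @S2 R).

Lemma S2_dot1 (x y : R3 R) : S2 x -> S2 y -> dot x y = 1 -> x = y.
Proof.
rewrite /S2 /=; case: x y => [[x1 x2] x3] [[y1 y2] y3]; rewrite !dotE /= => Sx Sy e.
have : (x1 - y1) ^+ 2 + (x2 - y2) ^+ 2 + (x3 - y3) ^+ 2 == 0 by apply/eqP; lra.
rewrite paddr_eq0 ?addr_ge0 ?sqr_ge0// paddr_eq0 ?sqr_ge0// !sqrf_eq0 !subr_eq0.
by move=> /andP[/andP[/eqP -> /eqP ->] /eqP ->].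
Qed.

Let a (x : R3 R) : R := vnorm (V x).
Let Q (e : R) (x y : R3 R) : R := dot (V x) y / (1 + e - dot x y).
(** For e > 0 this is the Poisson integral of [u] minus its mean, by [poisson_repr]. At e = 0 the
    kernel is singular; the integrand is controlled where [Kint] is finite, that is, almost
    everywhere. *)
Let T (e : R) (y : R3 R) : R := \int[domega]_(x in S2) Q e x y.
Let ubar : R := \int[domega]_(x in S2) u x.
Let Kint (y : R3 R) : \bar R := (\int[domega]_(x in S2) (a x * sker x y)%:E)%E.
Let N2 : R := \int[domega]_(x in S2) dot (V x) (V x).

Let mV : measurable_fun S2 V. Proof. by case: wV. Qed.
Let iV : domega.-integrable S2 (EFin \o (fun x => dot (V x) (V x))). Proof. by case: wV. Qed.
Let tV (x : R3 R) : S2 x -> dot x (V x) = 0. Proof. by case: wV => _ _ + _; exact. Qed.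

Let ma : measurable_fun S2 a.
Proof.
apply: (measurableT_comp (f := @Num.sqrt R)); last exact: measurable_dotS2.
by apply: continuous_measurable_fun; exact: sqrt_continuous.
Qed.

Let a0 x : 0 <= a x. Proof. exact: vnorm_ge0. Qed.

Let ia : domega.-integrable S2 (EFin \o a).
Proof.
apply: L2_L1 => //; apply: (eq_integrable measurable_S2 _ _ _ iV) => x _.
by rewrite /= vnorm_sqr.
Qed.

Let mQ (e : R) : measurable_fun D (fun p => Q e p.1 p.2).
Proof.
apply: measurable_funM.
  rewrite (_ : (fun p => _) = (fun p : R3 R * R3 R => X1 V p.1 * X1 id p.2 +
    X2 V p.1 * X2 id p.2 + X3 V p.1 * X3 id p.2)); last by apply/funext => p; rewrite dotE.
  have [v1 v2 v3] := (measurable_field _).1 mV.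
  have [x1 x2 x3] := (measurable_field id).1 (@measurable_id _ (R3 R) S2).
  by apply: measurable_funD; [apply: measurable_funD|]; apply: measurable_funM;
    by [exact: measurable_fst_S2|exact: measurable_snd_S2].
apply: measurable_funV; apply: measurable_funB; first exact: measurable_cst.
exact: measurable_dot_prod.
Qed.

Let mK : measurable_fun D (fun p => a p.1 * sker p.1 p.2).
Proof. by apply: measurable_funM; [exact: measurable_fst_S2|exact: measurable_sker]. Qed.

Let Qh (e : R) (x y : R3 R) : 0 <= e -> S2 x -> S2 y -> `|Q e x y| <= a x * hker x y.
Proof. by move=> e0 Sx Sy; exact: (tangent_kernel_le e0 Sx Sy (tV Sx)). Qed.

Let Qs (e : R) (x y : R3 R) : 0 <= e -> S2 x -> S2 y -> `|Q e x y| <= a x * sker x y.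
Proof.
move=> e0 Sx Sy; apply: (le_trans (Qh e0 Sx Sy)).
by rewrite ler_wpM2l//; exact: hker_le_sker.
Qed.

Let isker (x : R3 R) : S2 x -> domega.-integrable S2 (EFin \o sker x).
Proof.
move=> Sx; apply/integrableP; split.
  by apply/measurable_EFinP; exact: (measurable_section1 measurable_sker Sx).
apply: (@le_lt_trans _ _ 6%:E); last exact: ltry.
apply: le_trans (sker_integral Sx); rewrite le_eqVlt; apply/orP; left; apply/eqP.
by apply: eq_integral => y _; rewrite /= gtr0_norm// sker_gt0.
Qed.

Let Ka (x : R3 R) : S2 x -> (\int[domega]_(y in S2) (a x * sker x y)%:E <= (6 * a x)%:E)%E.
Proof.
move=> Sx; have i : domega.-integrable S2 (EFin \o (fun y => a x * sker x y)).
  exact: (integrableZl measurable_S2 (a x) (isker Sx)).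
rewrite (EFin_Rintegral i) (RintegralZl _ measurable_S2 (isker Sx)) lee_fin mulrC ler_wpM2r//.
by rewrite -lee_fin -(EFin_Rintegral (isker Sx)); exact: sker_integral.
Qed.

Let i6a : domega.-integrable S2 (EFin \o (fun x => 6 * a x)).
Proof. exact: (integrableZl measurable_S2 6 ia). Qed.

Let Kint_integrable : domega.-integrable S2 Kint.
Proof.
apply: (fubini_integrable2 mK); apply: (iterated_lt mK mK _ Ka i6a) => x y _ _.
by rewrite ger0_norm// mulr_ge0// ltW// sker_gt0.
Qed.

Let T_integrable (e : R) : 0 <= e -> domega.-integrable S2 (EFin \o T e).
Proof.
move=> e0.
have iF : (\int[domega]_(x in S2) \int[domega]_(y in S2) `|Q e x y|%:E < +oo)%E.
  by apply: (iterated_lt (mQ e) mK _ Ka i6a) => x y; exact: Qs.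
have i := fubini_integrable2 (mQ e) iF.
apply: (le_integrable measurable_S2 _ _ i).
  apply/measurable_EFinP; apply: (measurableT_comp (f := @fine R)) => //.
  exact: (measurable_int domega i).
by move=> y _ /=; rewrite /T /Rintegral; case: (integral _ _ _) => [r||] /=; rewrite ?normr0 ?leey ?lexx.
Qed.

Let Kfin (y : R3 R) : S2 y -> (Kint y < +oo)%E -> domega.-integrable S2 (EFin \o (fun x => a x * sker x y)).
Proof.
move=> Sy h; apply/integrableP; split.
  by apply/measurable_EFinP; exact: (measurable_section2 (F := fun x y => a x * sker x y) mK Sy).
apply: le_lt_trans h; rewrite le_eqVlt; apply/orP; left; apply/eqP.
by apply: eq_integral => x _; rewrite /= ger0_norm// mulr_ge0// ltW// sker_gt0.
Qed.

Let Qsection (e : R) (y : R3 R) : 0 <= e -> S2 y -> (Kint y < +oo)%E ->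
  domega.-integrable S2 (EFin \o (fun x => Q e x y)).
Proof.
move=> e0 Sy h; apply: (integrable_le _ (Kfin Sy h)) => [|x Sx]; last exact: Qs.
exact: (measurable_section2 (mQ e) Sy).
Qed.

Let Kae : {ae domega, forall y, S2 y -> (Kint y < +oo)%E}.
Proof.
have := integrable_ae measurable_S2 Kint_integrable; apply: filterS => y h Sy.
by have := h Sy; rewrite fin_numElt => /andP[].
Qed.

Lemma poisson_repr (e : R) (y : R3 R) : 0 < e -> S2 y ->
  \int[domega]_(x in S2) (u x * poisson e y x) = ubar + T e y.
Proof.
move=> e0 Sy; have hn := negv_lt e0 Sy.
have hX : C1_tangent_field (polar_field (1 + e) (negv y)).
  by apply: polar_field_tangent => x Sx; rewrite gt_eqF//; apply: affine_pos => //; lra.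
have [_ _ _ w] := wV; have {w} := w _ hX.
have ip : domega.-integrable S2 (EFin \o (fun x => u x * poisson e y x)).
  by apply: (integrable_continuousM iu) => x Sx; exact: poisson_continuous.
have dn x : dot (negv y) x = - dot y x by rewrite !dotE /=; ring.
have -> : \int[domega]_(x in S2) (u x * sphere_div (polar_field (1 + e) (negv y)) x) =
    \int[domega]_(x in S2) (u x * poisson e y x - u x).
  congr fine; apply: eq_integral => x /set_mem Sx; rewrite polar_field_div//; last first.
    by rewrite gt_eqF//; apply: affine_pos => //; lra.
  have Sy1 : dot (negv y) (negv y) = 1 by move: Sy; rewrite /S2 /= !dotE /= !mulrNN.
  by rewrite Sy1 dn /poisson; congr EFin; ring.
rewrite (RintegralB measurable_S2 ip iu) opprB -/ubar.
have -> : \int[domega]_(x in S2) dot (V x) (polar_field (1 + e) (negv y) x) =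
    \int[domega]_(x in S2) (- 1 * Q e x y).
  congr fine; apply: eq_integral => x /set_mem Sx; congr EFin.
  have p0 : 1 + e - dot x y != 0.
    by have := poisson_den e0 Sx Sy => h; rewrite gt_eqF//; lra.
  have := tV Sx; rewrite /polar_field dn dotC /Q (dotC y x).
  rewrite [dot (V x) x]dotE [dot (V x) (_, _)]dotE /= [dot (V x) y]dotE.
  move: (dot x y) p0 => s p0 t.
  transitivity ((- (((V x).1.1 * y.1.1 + (V x).1.2 * y.1.2 + (V x).2 * y.2)) +
    s * ((V x).1.1 * x.1.1 + (V x).1.2 * x.1.2 + (V x).2 * x.2)) / (1 + e - s)).
    by field.
  by rewrite t mulr0 addr0; field.
have iQ : domega.-integrable S2 (EFin \o (fun x => Q e x y)).
  apply: (integrable_le (g := fun x => a x * e^-1)).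
  - exact: (measurable_section2 (mQ e) Sy).
  - exact: (integrableZr measurable_S2 e^-1 ia).
  move=> x Sx; rewrite /Q normrM ler_pM//.
    rewrite -(@ler_pXn2r _ 2) ?nnegrE// real_normK ?num_real// vnorm_sqr.
    by apply: (le_trans (dot_sqr_le _ _)); rewrite [dot y y]Sy mulr1.
  have h := poisson_den e0 Sx Sy; have p0 := lt_le_trans e0 h.
  by rewrite gtr0_norm ?invr_gt0// lef_pV2.
rewrite (RintegralZl _ measurable_S2 iQ) -/(T e y); lra.
Qed.

Section Test.
Variable f : R3 R -> R.
Hypothesis cf : continuous f.
Hypothesis f1 : forall x, `|f x| <= 1.

Let cf' (x : R3 R) : S2 x -> {for x, continuous f}. Proof. by move=> _; exact: cf. Qed.

Let F (e : R) (x y : R3 R) := Q e x y * f y.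

Let mF (e : R) : measurable_fun D (fun p => F e p.1 p.2).
Proof.
apply: measurable_funM => //; apply: measurable_snd_S2.
exact: continuous_measurable_S2.
Qed.

Let Fs (e : R) (x y : R3 R) : 0 <= e -> S2 x -> S2 y -> `|F e x y| <= a x * sker x y.
Proof. by move=> e0 Sx Sy; rewrite normrM; apply: le_trans (Qs e0 Sx Sy); rewrite ler_piMr. Qed.

Let iF (e : R) : 0 <= e -> (\int[domega]_(x in S2) \int[domega]_(y in S2) `|F e x y|%:E < +oo)%E.
Proof. by move=> e0; apply: (iterated_lt (mF e) mK _ Ka i6a) => x y; exact: Fs. Qed.

Let iFx (e : R) (x : R3 R) : 0 <= e -> S2 x -> domega.-integrable S2 (EFin \o F e x).
Proof.
move=> e0 Sx; apply: (integrable_le _ (integrableZl measurable_S2 (a x) (isker Sx))).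
  exact: (measurable_section1 (mF e) Sx).
by move=> y; exact: Fs.
Qed.

Let S (e : R) (x : R3 R) := \int[domega]_(y in S2) F e x y.

Let iS (e : R) : 0 <= e -> domega.-integrable S2 (EFin \o S e).
Proof.
move=> e0; apply: (eq_integrable measurable_S2 _ _ _ (fubini_integrable1 (mF e) (iF e0))).
by move=> x /set_mem Sx; rewrite (EFin_Rintegral (iFx e0 Sx)).
Qed.

Let swapT (e : R) : 0 <= e ->
  \int[domega]_(y in S2) (f y * T e y) = \int[domega]_(x in S2) S e x.
Proof.
move=> e0; rewrite /Rintegral; congr fine.
transitivity (\int[domega]_(x in S2) \int[domega]_(y in S2) (F e x y)%:E)%E; last first.
  by apply: eq_integral => x /set_mem Sx; rewrite (EFin_Rintegral (iFx e0 Sx)).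
rewrite (fubini_S2 (mF e) (iF e0)).
have i := fubini_integrable2 (mF e) (iF e0).
apply: ae_eq_integral.
- exact: measurable_S2.
- apply/measurable_EFinP; apply: measurable_funM; first exact: continuous_measurable_S2.
  exact: integrable_measurable_S2 (T_integrable e0).
- exact: (measurable_int domega i).
move: Kae; apply: filterS => y h Sy; have iq := Qsection e0 Sy (h Sy).
rewrite EFin_Rintegral; last exact: (integrableZr measurable_S2 (f y) iq).
by rewrite (RintegralZr _ measurable_S2 iq) mulrC.
Qed.

Let harmonic_gt0 n : 0 < harmonic n :> R.
Proof. by rewrite /harmonic /= invr_gt0. Qed.

Let Scvg : \int[domega]_(x in S2) S (harmonic n) x @[n --> \oo] --> \int[domega]_(x in S2) S 0 x.
Proof.
apply: (dct_S2 (g := fun x => 6 * a x)).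
- by move=> n; apply: integrable_measurable_S2; apply: iS; exact: ltW.
- by apply: integrable_measurable_S2; exact: iS.
- move=> x Sx; apply: (dct_S2 (g := fun y => a x * sker x y)).
  + by move=> n; apply: integrable_measurable_S2; apply: iFx => //; exact: ltW.
  + by apply: integrable_measurable_S2; exact: iFx.
  + move=> y Sy; apply: cvgM; last exact: cvg_cst.
    rewrite /Q addr0.
    (* On the diagonal the limiting denominator is 0, but the numerator is V(x).x = 0 for every
       n. *)
    have [e|ne] := eqVneq (dot x y) 1.
      rewrite -(S2_dot1 Sx Sy e) dotC (tV Sx) mul0r.
      rewrite (_ : (fun n => _) = (fun=> 0)); first exact: cvg_cst.
      by apply/funext => n; rewrite mul0r.
    apply: cvgM; first exact: cvg_cst.
    apply: cvgV; first by rewrite subr_eq0 eq_sym.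
    apply: cvgB; last exact: cvg_cst.
    by rewrite -[X in _ --> X]addr0; apply: cvgD; [exact: cvg_cst|exact: cvg_harmonic].
  + exact: (integrableZl measurable_S2 (a x) (isker Sx)).
  + by move=> n y Sy; apply: Fs => //; exact: ltW.
- exact: i6a.
- move=> n x Sx; have i := iFx (ltW (harmonic_gt0 n)) Sx.
  apply: (le_trans (le_normr_Rintegral measurable_S2 i)).
  have ik := integrableZl measurable_S2 (a x) (isker Sx).
  apply: (@le_trans _ _ (\int[domega]_(y in S2) (a x * sker x y))).
    apply: (le_Rintegral measurable_S2 (integrable_norm i) ik) => y Sy.
    by apply: Fs => //; exact: ltW.
  by rewrite -lee_fin -(EFin_Rintegral ik); exact: Ka.
Qed.

(** The limit e -> 0 in [poisson_repr] is taken after integration against f: [u] is only integrable,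
    and [poisson_smoothing] provides convergence in this weak form. *)
Lemma repr_test : \int[domega]_(x in S2) (f x * (u x - ubar - T 0 x)) = 0.
Proof.
have if_ : domega.-integrable S2 (EFin \o f) := continuous_integrable_S2 cf'.
have iuf : domega.-integrable S2 (EFin \o (fun x => u x * f x)) := integrable_continuousM iu cf'.
have iuc : domega.-integrable S2 (EFin \o (fun x => ubar * f x)) := integrableZl measurable_S2 ubar if_.
have iT e : 0 <= e -> domega.-integrable S2 (EFin \o (fun x => f x * T e x)).
  move=> e0; apply: (eq_integrable measurable_S2 _ _ _ (integrable_continuousM (T_integrable e0) cf')).
  by move=> x _; rewrite /= mulrC.
have c1 := poisson_smoothing cf' (fun x _ => f1 x) iu.
have E n : \int[domega]_(y in S2) (f y * \int[domega]_(x in S2) (u x * poisson (harmonic n) y x)) =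
    ubar * \int[domega]_(y in S2) f y + \int[domega]_(x in S2) S (harmonic n) x.
  have h0 := ltW (harmonic_gt0 n).
  rewrite -(swapT h0) -(RintegralZl _ measurable_S2 if_) -(RintegralD measurable_S2 iuc (iT _ h0)).
  congr fine; apply: eq_integral => y /set_mem Sy; rewrite poisson_repr//.
  by congr EFin; ring.
rewrite (funext E) in c1.
have c2 : ubar * \int[domega]_(y in S2) f y + \int[domega]_(x in S2) S (harmonic n) x @[n --> \oo]
    --> ubar * \int[domega]_(y in S2) f y + \int[domega]_(x in S2) S 0 x.
  by apply: cvgD; [exact: cvg_cst|exact: Scvg].
have := cvg_unique (@Rhausdorff R) c1 c2 => {c1 c2 E}.
rewrite -swapT// -(RintegralZl _ measurable_S2 if_) => h.
transitivity (\int[domega]_(x in S2) (u x * f x - (ubar * f x + f x * T 0 x))).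
  by congr fine; apply: eq_integral => x _; congr EFin; ring.
have i2 := integrableD measurable_S2 iuc (iT 0 (lexx 0)).
rewrite (RintegralB measurable_S2 iuf i2) (RintegralD measurable_S2 iuc (iT 0 (lexx 0))) h.
by rewrite subrr.
Qed.

End Test.

Lemma repr_ae : {ae domega, forall x, S2 x -> u x = ubar + T 0 x}.
Proof.
have ic : domega.-integrable (@S2 R) (EFin \o (fun=> ubar)).
  by apply: continuous_integrable_S2 => x _; exact: cvg_cst.
have ih : domega.-integrable S2 (EFin \o (fun x => u x - ubar - T 0 x)).
  have i1 := integrableB measurable_S2 iu ic.
  exact: (integrableB measurable_S2 i1 (T_integrable (lexx 0))).
have := ae_zero_S2 ih repr_test; apply: filterS => x h Sx.
by have := h Sx; lra.
Qed.

(** [8 * N2] comes from the quadratic term of [kernel_split]; the 1 absorbs ln(1 + eta) / 16. *)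
Let c0 := 8 * N2 + 1.

Let T_bound (y : R3 R) (n : R) : S2 y -> (Kint y < +oo)%E -> 0 <= n ->
  `|T 0 y| <= c0 + n / 2 + expR (- 2 * n) * fine (Kint y).
Proof.
move=> Sy hK n0; have iq := Qsection (lexx 0) Sy hK; have iK := Kfin Sy hK.
set eta := expR (- 8 * n); have eta0 : 0 < eta by exact: expR_gt0.
have eta1 : eta <= 1 by rewrite -expR0 ler_expR; lra.
have e0 : 0 < 2 * eta by rewrite mulr_gt0.
have il : domega.-integrable (@S2 R) (EFin \o (fun x => ((1 + 2 * eta - dot y x) / 2)^-1)).
  apply: continuous_integrable_S2 => x Sx; apply: C1_cont; apply: C1V.
    by have := poisson_den e0 Sy Sx => h; rewrite gt_eqF//; lra.
  exact: (C1M (C1B (C1_cst _ _) (C1_dot y x)) (C1_cst _ _)).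
have i1 := integrableZl measurable_S2 8 iV.
have i2 := integrableZl measurable_S2 16^-1 il.
have i3 := integrableZl measurable_S2 (expR (- 2 * n)) iK.
have i12 := integrableD measurable_S2 i1 i2.
have i123 := integrableD measurable_S2 i12 i3.
apply: (le_trans (le_normr_Rintegral measurable_S2 iq)).
apply: (@le_trans _ _ (\int[domega]_(x in S2) (8 * dot (V x) (V x) +
    16^-1 * ((1 + 2 * eta - dot y x) / 2)^-1 + expR (- 2 * n) * (a x * sker x y)))).
  apply: (le_Rintegral measurable_S2 (integrable_norm iq) i123) => x Sx.
  apply: (le_trans (Qh (lexx 0) Sx Sy)); rewrite -vnorm_sqr (dotC y x).
  exact: (kernel_split (a0 x) n0 Sx Sy).
rewrite (RintegralD measurable_S2 i12 i3) (RintegralD measurable_S2 i1 i2).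
rewrite (RintegralZl _ measurable_S2 iV) (RintegralZl _ measurable_S2 il) (RintegralZl _ measurable_S2 iK).
rewrite -/N2 -/(Kint y) lerD2r /c0 -addrA lerD2l.
have -> : \int[domega]_(x in S2) ((1 + 2 * eta - dot y x) / 2)^-1 = ln (1 + eta) + 8 * n.
  have := log_integral e0 Sy; rewrite (EFin_Rintegral il) => -[->].
  rewrite (_ : 2 * eta / 2 = eta); last by field.
  rewrite (_ : (2 + 2 * eta) / 2 = 1 + eta); last by field.
  by rewrite /eta expRK; ring.
have : ln (1 + eta) <= 1.
  by apply: le_trans ln2_le1; rewrite ler_ln ?posrE//; lra.
lra.
Qed.

Let exp_bound (y : R3 R) : S2 y -> (Kint y < +oo)%E -> u y = ubar + T 0 y ->
  expR (2 * u y) <= expR (2 * ubar) * (expR (2 * c0 + 2) + 2 * expR (2 * c0) * fine (Kint y)).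
Proof.
move=> Sy hK ->; rewrite mulrDr expRD ler_pM2l ?expR_gt0//.
have K0 : 0 <= fine (Kint y).
  by apply: fine_ge0; apply: integral_ge0 => x _; rewrite lee_fin mulr_ge0// ltW// sker_gt0.
have hT n := @T_bound y n Sy hK.
apply: (@le_trans _ _ (expR (2 * `|T 0 y|))); first by rewrite ler_expR ler_pM2l// ler_norm.
have [h|h] := leP `|T 0 y| (c0 + 1).
  apply: ler_wpDr; first by rewrite !mulr_ge0 ?expR_ge0.
  by rewrite ler_expR; lra.
apply: ler_wpDl; first exact: expR_ge0.
(* With this n, depending on y, the bound reads n <= n/2 + e^(-2n) K. Since n >= 1 it gives 1/2 <=
   e^(-2n) K, that is, e^(2n) <= 2 K. *)
pose n := `|T 0 y| - c0; have n1 : 1 <= n by rewrite /n; lra.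
have n0 : 0 <= n by lra.
have := hT n n0; rewrite (_ : `|T 0 y| = c0 + n); last by rewrite /n; ring.
move=> hn; have {}hn : 2^-1 <= expR (- 2 * n) * fine (Kint y) by lra.
rewrite mulrDr expRD (mulrC 2 (expR _)) -mulrA ler_pM2l ?expR_gt0//.
have E0 : 0 < expR (2 * n) by exact: expR_gt0.
have : expR (2 * n) * 2^-1 <= expR (2 * n) * (expR (- 2 * n) * fine (Kint y)) by rewrite ler_pM2l.
by rewrite mulrA -expRD (_ : 2 * n + - 2 * n = 0) ?expR0 ?mul1r; lra.
Qed.

(** A qualitative Moser-Trudinger inequality: almost everywhere [exp_bound] majorizes the
    exponential by an affine function of the integrable potential [Kint]. *)
Theorem exp_integrable : domega.-integrable S2 (EFin \o (fun x => expR (2 * u x))).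
Proof.
have mu := integrable_measurable_S2 iu.
have mE : measurable_fun S2 (fun x => expR (2 * u x)).
  apply: (measurableT_comp (f := @expR R)); first exact: measurable_expR.
  by apply: measurable_funM.
apply/integrableP; split; first exact/measurable_EFinP.
pose A := expR (2 * ubar) * expR (2 * c0 + 2).
pose B := expR (2 * ubar) * (2 * expR (2 * c0)).
have A0 : 0 <= A by rewrite mulr_ge0 ?expR_ge0.
have B0 : 0 <= B by rewrite !mulr_ge0 ?expR_ge0.
have ic : domega.-integrable (@S2 R) (EFin \o (fun=> A)).
  by apply: continuous_integrable_S2 => x _; exact: cvg_cst.
have iK := integrableZl measurable_S2 B Kint_integrable.
have iG := integrableD measurable_S2 ic iK.
have K0 x : (0 <= Kint x)%E.
  by apply: integral_ge0 => z _; rewrite lee_fin mulr_ge0// ltW// sker_gt0.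
apply: le_lt_trans (integral_fune_lt_pinfty measurable_S2 iG).
apply: ae_ge0_le_integral.
- exact: measurable_S2.
- by [].
- by apply: measurableT_comp => //; exact/measurable_EFinP.
- by move=> x _; rewrite /= adde_ge0 ?lee_fin// mule_ge0.
- exact: (measurable_int domega iG).
apply: filterS2 Kae repr_ae => y h1 h2 Sy.
have hK := h1 Sy; have := exp_bound Sy hK (h2 Sy).
have fK : Kint y \is a fin_num by rewrite ge0_fin_numE.
rewrite /= ger0_norm ?expR_ge0// -(fineK fK) -EFinM -EFinD lee_fin /A /B.
by rewrite mulrDr !mulrA.
Qed.

End Representation.

(** * Balance of the logarithm and positivity of the quadratic form *)

Section Invariance.
Context {R : realType}.

(** [linv] keeps the time entry, and the relation |ll|^2 = la^2 - 1 for both matrices gives the two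
    vectors [ll] the same length, as [rotation_exists] requires. *)
Lemma log_ell_balance (L : @lorentz R) : is_lorentz L ->
  \int[domega]_(x in S2) ln (ell L x) = \int[domega]_(x in S2) ln (ell (linv L) x).
Proof.
move=> hL; have hLi := is_lorentz_inv hL.
have ln_ : dot (ll L) (ll L) = dot (ll (linv L)) (ll (linv L)).
  by case: hL => _ [-> _ _ _ _ _ _ _ _ _] [-> _ _ _ _ _ _ _ _ _].
have [H [hH eH dH]] := rotation_exists ln_.
have i : domega.-integrable S2 (EFin \o (fun x => ln (ell (linv L) x))).
  apply: continuous_integrable_S2 => x Sx.
  by apply: C1_cont; apply: C1_ln (C1_ell _ _); exact: ell_gt0.
rewrite -(change_var hH i); congr fine; apply: eq_integral => x _.
by rewrite eH expr1n invr1 mulr1 /ell dH.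
Qed.

(** The difference of the integrands, (1 - e.x) w, is nonnegative and is strictly positive on the
    open hemisphere around -e, which has positive area. *)
Lemma exp_moment_lt (w : R3 R -> R) (e : R3 R) :
  domega.-integrable S2 (EFin \o w) -> (forall x, 0 < w x) -> S2 e ->
  \int[domega]_(x in S2) (dot e x * w x) < \int[domega]_(x in S2) w x.
Proof.
move=> iw w0 Se.
have i1 : domega.-integrable S2 (EFin \o (fun x => dot e x * w x)).
  apply: (eq_integrable measurable_S2 _ _ _ (integrable_continuousM (g := dot e) iw _)).
    by move=> x _; rewrite /= mulrC.
  by move=> x _; apply: C1_cont; exact: C1_dot.
have id_ := integrableB measurable_S2 iw i1.
have p x : S2 x -> 0 <= w x - dot e x * w x.
  move=> Sx; have := dot_le1 Se Sx; rewrite ler_norml => /andP[_ h].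
  by rewrite -[X in X - _]mul1r -mulrBl mulr_ge0 ?subr_ge0// ltW.
rewrite -subr_gt0 -(RintegralB measurable_S2 iw i1) lt_neqAle; apply/andP; split; last first.
  by apply: Rintegral_ge0 => x Sx; exact: p.
apply/eqP => z.
have z' : (\int[domega]_(x in S2) `|(w x - dot e x * w x)%:E| = 0)%E.
  transitivity (\int[domega]_(x in S2) (w x - dot e x * w x)%:E)%E.
    by apply: eq_integral => x /set_mem Sx; rewrite gee0_abs// lee_fin p.
  by rewrite (EFin_Rintegral id_) -z.
have m : measurable_fun S2 (EFin \o (fun x => w x - dot e x * w x)) := measurable_int domega id_.
have [N [mN N0 hN]] := (ae_eq_integral_abs domega measurable_S2 m).1 z'.
have Sn : S2 (negv e) by move: Se; rewrite /S2 /= !dotE /= !mulrNN.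
have := domega_cap_gt0 Sn (ltr01 : 0 < (1 : R)).
rewrite ltNge => /negP; apply; rewrite -N0; apply: le_measure.
- by rewrite inE; exact: measurable_cap.
- by rewrite inE.
move=> x [Sx hx]; apply: hN => /= h; have := h Sx => -[].
have : dot (negv e) x = - dot e x by rewrite !dotE /=; ring.
move=> en; rewrite en in hx; have := w0 x => wx hh.
have : 0 < (1 - dot e x) * w x by rewrite mulr_gt0//; lra.
by rewrite mulrBl mul1r hh ltxx.
Qed.

Lemma I23E (u : R3 R -> R) : I23 u =
  2 / 3 * \int[domega]_(x in S2) dot (gradient u x) (gradient u x)
  + 2 * \int[domega]_(x in S2) u x
  - 2^-1 * ln ((\int[domega]_(x in S2) expR (2 * u x)) ^+ 2
      - ((\int[domega]_(x in S2) (x.1.1 * expR (2 * u x))) ^+ 2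
       + (\int[domega]_(x in S2) (x.1.2 * expR (2 * u x))) ^+ 2
       + (\int[domega]_(x in S2) (x.2 * expR (2 * u x))) ^+ 2)).
Proof. by rewrite /I23 !big_ord_recl big_ord0 addr0 addrA. Qed.

(** The vector of moments is timelike: apply [exp_moment_lt] in the direction of its space part.
    Positivity keeps the logarithm in [I23] away from its default value and lets it split a
    product. *)
Lemma exp_moments (w : R3 R -> R) : domega.-integrable S2 (EFin \o w) -> (forall x, 0 < w x) ->
  0 < (\int[domega]_(x in S2) w x) ^+ 2
      - ((\int[domega]_(x in S2) (x.1.1 * w x)) ^+ 2
       + (\int[domega]_(x in S2) (x.1.2 * w x)) ^+ 2
       + (\int[domega]_(x in S2) (x.2 * w x)) ^+ 2).
Proof.
move=> iw w0; set A0 := \int[domega]_(x in S2) w x.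
have ic (g : R3 R -> R) : (forall x, S2 x -> {for x, continuous g}) ->
    domega.-integrable S2 (EFin \o (fun x => g x * w x)).
  move=> cg; apply: (eq_integrable measurable_S2 _ _ _ (integrable_continuousM iw cg)).
  by move=> x _; rewrite /= mulrC.
have i1 := ic _ (fun x _ => C1_cont (C1_x1 x)).
have i2 := ic _ (fun x _ => C1_cont (C1_x2 x)).
have i3 := ic _ (fun x _ => C1_cont (C1_x3 x)).
set A1 := \int[domega]_(x in S2) (x.1.1 * w x).
set A2 := \int[domega]_(x in S2) (x.1.2 * w x).
set A3 := \int[domega]_(x in S2) (x.2 * w x).
have H (e : R3 R) : S2 e -> e.1.1 * A1 + e.1.2 * A2 + e.2 * A3 < A0.
  move=> Se; apply: le_lt_trans (exp_moment_lt iw w0 Se).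
  rewrite le_eqVlt; apply/orP; left; apply/eqP.
  have j1 := integrableZl measurable_S2 e.1.1 i1.
  have j2 := integrableZl measurable_S2 e.1.2 i2.
  have j3 := integrableZl measurable_S2 e.2 i3.
  have j12 := integrableD measurable_S2 j1 j2.
  rewrite -(RintegralZl _ measurable_S2 i1) -(RintegralZl _ measurable_S2 i2) -(RintegralZl _ measurable_S2 i3).
  rewrite -(RintegralD measurable_S2 j1 j2) -(RintegralD measurable_S2 j12 j3).
  by congr fine; apply: eq_integral => x _; rewrite dotE; congr EFin; ring.
pose q := A1 ^+ 2 + A2 ^+ 2 + A3 ^+ 2.
have q0 : 0 <= q by rewrite !addr_ge0 ?sqr_ge0.
rewrite -/q.
pose s := Num.sqrt q.
have s2 : s ^+ 2 = q by rewrite sqr_sqrtr.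
(* A zero space part gives no direction; the inequality at two opposite points then yields
   [0 < A0]. *)
have [e|ne] := eqVneq s 0.
  have A00 : 0 < A0.
    have Se : S2 ((0, 0, 1) : R3 R) by rewrite /S2 /= dotE /=; ring.
    have Se' : S2 ((0, 0, -1) : R3 R) by rewrite /S2 /= dotE /=; ring.
    by have := H _ Se; have := H _ Se'; rewrite /=; lra.
  by rewrite -s2 e expr0n subr0 exprn_gt0.
have s0 : 0 < s by rewrite lt_neqAle eq_sym ne sqrtr_ge0.
have Se : S2 ((A1 / s, A2 / s, A3 / s) : R3 R).
  rewrite /S2 /= dotE /=; transitivity (q / s ^+ 2); first by rewrite /q; field.
  by rewrite s2 divff// -s2 expf_neq0.
have := H _ Se; rewrite /=.
have -> : A1 / s * A1 + A2 / s * A2 + A3 / s * A3 = q / s by rewrite /q; field.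
rewrite -s2 expr2 mulfK// => sA; rewrite subr_gt0 -expr2 ltrXn2r//.
by rewrite ltW.
Qed.

(** * Energy, mean and exponential moments of the transformed function *)

Section Transform.
Variables (L : @lorentz R) (u : R3 R -> R) (V : R3 R -> R3 R) (c : R).
Hypothesis hL : is_lorentz L.
Hypothesis mu : measurable_fun S2 u.
Hypothesis iu2 : domega.-integrable S2 (EFin \o (fun x => u x ^+ 2)).
Hypothesis wV : is_weak_gradient u V.

Let iu : domega.-integrable S2 (EFin \o u). Proof. exact: L2_L1. Qed.
Let ut (x : R3 R) : R := u (act L x) + log_factor L c x.
Let Vp (x : R3 R) : R3 R := pull_vec L x (V (act L x)).
Let P := polar_field (la L) (ll L).
Let G := log_factor_grad L.
Let Lam := \int[domega]_(x in S2) ln (ell L x).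
Let iua : domega.-integrable S2 (EFin \o (fun x => u (act L x))) := ell_integrableM hL iu.

Let clog c' (x : R3 R) : S2 x -> {for x, continuous (log_factor L c')}.
Proof. by move=> Sx; apply: C1_cont; exact: C1_log_factor. Qed.

Let ilog c' : domega.-integrable S2 (EFin \o log_factor L c').
Proof. by apply: continuous_integrable_S2 => x; exact: clog. Qed.

Lemma transform_weak : is_weak_gradient ut (fun x => Vp x + G x).
Proof.
exact: (weak_gradientD iua (ilog c) (weak_gradient_pull hL iu wV) (log_factor_weak c hL)).
Qed.

Lemma transform_H1 : H1 ut.
Proof.
have mua := measurable_S2_act hL mu.
have mlog := continuous_measurable_S2 (fun x (Sx : S2 x) => @clog c x Sx).
split; [exact: measurable_funD| |by exists (fun x => Vp x + G x); exact: transform_weak].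
have i1 : domega.-integrable S2 (EFin \o (fun x => u (act L x) ^+ 2)) := ell_integrableM hL iu2.
have i2 : domega.-integrable S2 (EFin \o (fun x => log_factor L c x ^+ 2)).
  by apply: continuous_integrable_S2 => x Sx; apply: cvgM; exact: clog.
have i3 := L2_mul mua mlog i1 i2.
have := integrableD measurable_S2 (integrableD measurable_S2 i1 i2) (integrableZl measurable_S2 2 i3).
apply: eq_integrable; first exact: measurable_S2.
by move=> x _ /=; rewrite /ut -!EFinD; congr EFin; ring.
Qed.

Let divP (x : R3 R) : S2 x -> sphere_div P x = (ell L x) ^- 2 - 1.
Proof.
move=> Sx; rewrite polar_field_div//; last by rewrite gt_eqF//; exact: (ell_gt0 hL Sx).
have -> : la L ^+ 2 - dot (ll L) (ll L) = 1 by case: hL => _ [-> _ _ _ _ _ _ _ _ _] _; ring.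
by rewrite mul1r.
Qed.

Let hP : C1_tangent_field P := ell_polar hL.

(** Since G = -(3/2) P, the cross term and the square of G are both products with the C^1 field P,
    and both are integrated by parts. They leave u o act and ln ell against ell^-2 - 1; the first is
    evaluated by change of variables, the second by [log_ell_balance]. *)
Lemma transform_energy :
  \int[domega]_(x in S2) dot (Vp x + G x) (Vp x + G x) =
  \int[domega]_(x in S2) dot (V x) (V x) + 3 * \int[domega]_(x in S2) u x
    - 3 * \int[domega]_(x in S2) u (act L x) + 9 / 2 * Lam.
Proof.
have [mV iV tV _] := wV.
have [mp ip tp wp] := weak_gradient_pull hL iu wV.
have [mG iG tG wG] := log_factor_weak 0 hL.
have [mP iP] := tangent_L2 (fun x => tangent_continuous (x := x) hP).
have iell := ellV_integrable hL.
have iln : domega.-integrable S2 (EFin \o (fun x => ln (ell L x))).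
  apply: continuous_integrable_S2 => x Sx.
  by apply: C1_cont; apply: C1_ln (C1_ell _ _); exact: ell_gt0.
have iln' : domega.-integrable S2 (EFin \o (fun x => ln (ell (linv L) x))).
  apply: continuous_integrable_S2 => x Sx.
  apply: C1_cont; apply: C1_ln (C1_ell _ _); apply: ell_gt0 => //.
  exact: is_lorentz_inv.
have Gdot x v : dot v (G x) = - (3 / 2) * dot v (P x).
  have sc (a b : R) : a *: b = a * b by [].
  by rewrite /G /log_factor_grad -/P !dotE /= !sc; ring.
have cross : \int[domega]_(x in S2) dot (Vp x) (P x) =
    \int[domega]_(x in S2) u (act L x) - \int[domega]_(x in S2) u x.
  rewrite (wp _ hP).
  transitivity (- \int[domega]_(x in S2) (u (act L x) * (ell L x) ^- 2 - u (act L x))).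
    congr (- fine _); apply: eq_integral => x /set_mem Sx.
    by rewrite divP// mulrBr mulr1.
  by rewrite (RintegralB measurable_S2 (change_var_integrable hL iu) iua) (change_var hL iu) opprB.
(* ln ell(x) is minus the logarithm of the inverse factor at [act L x], so the change of variables
   gives minus the mean for the inverse matrix, which is again -Lam. *)
have lnJ : \int[domega]_(x in S2) (ln (ell L x) * (ell L x) ^- 2) = - Lam.
  rewrite /Lam (log_ell_balance hL).
  rewrite -(change_var hL iln') -mulN1r.
  rewrite -(RintegralZl (-1) measurable_S2 (change_var_integrable hL iln')).
  congr fine; apply: eq_integral => x /set_mem Sx; congr EFin.
  by rewrite ell_act// lnV ?posrE ?ell_gt0// mulrA mulN1r opprK.
have self : \int[domega]_(x in S2) dot (G x) (P x) = - (3 * Lam).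
  rewrite (wG _ hP).
  transitivity (- \int[domega]_(x in S2) (- (3 / 2) * (ln (ell L x) * (ell L x) ^- 2 - ln (ell L x)))).
    congr (- fine _); apply: eq_integral => x /set_mem Sx.
    by rewrite divP// /log_factor; congr EFin; ring.
  have il2 : domega.-integrable S2 (EFin \o (fun x => ln (ell L x) * (ell L x) ^- 2)).
    by apply: (integrable_continuousM iln) => x Sx; exact: continuous_ellV.
  rewrite (RintegralZl _ measurable_S2 (integrableB measurable_S2 il2 iln)).
  by rewrite (RintegralB measurable_S2 il2 iln) lnJ -/Lam; field.
have iVP := L2_dot mp mP ip iP.
have iGP := L2_dot mG mP iG iP.
have j2 := integrableZl measurable_S2 (- 3) iVP.
have j3 := integrableZl measurable_S2 (- (3 / 2)) iGP.
have j12 := integrableD measurable_S2 ip j2.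
transitivity (\int[domega]_(x in S2) (dot (Vp x) (Vp x) + - 3 * dot (Vp x) (P x) + - (3 / 2) * dot (G x) (P x))).
  congr fine; apply: eq_integral => x _; congr EFin.
  by rewrite dotDl !dotDr (dotC (G x) (Vp x)) (Gdot x (Vp x)) (Gdot x (G x)); field.
rewrite (RintegralD measurable_S2 j12 j3) (RintegralD measurable_S2 ip j2).
rewrite (RintegralZl _ measurable_S2 iVP) (RintegralZl _ measurable_S2 iGP) cross self.
have -> : \int[domega]_(x in S2) dot (Vp x) (Vp x) = \int[domega]_(x in S2) dot (V x) (V x).
  rewrite -(change_var hL iV); congr fine; apply: eq_integral => x /set_mem Sx.
  by rewrite /Vp pull_vec_norm ?tV 1?mulrC//; exact: act_S2.
by field.
Qed.

Lemma transform_mean :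
  \int[domega]_(x in S2) ut x = \int[domega]_(x in S2) u (act L x) - 3 / 2 * Lam + c.
Proof.
have iln : domega.-integrable S2 (EFin \o (fun x => ln (ell L x))).
  apply: continuous_integrable_S2 => x Sx.
  by apply: C1_cont; apply: C1_ln (C1_ell _ _); exact: ell_gt0.
have ic : domega.-integrable (@S2 R) (EFin \o (fun=> c)).
  by apply: continuous_integrable_S2 => x _; exact: cvg_cst.
rewrite (RintegralD measurable_S2 iua (ilog c)) -addrA; congr (_ + _).
rewrite (RintegralD measurable_S2 (integrableZl measurable_S2 (- (3 / 2)) iln) ic).
by rewrite (RintegralZl _ measurable_S2 iln) Rintegral_cst_S2 mulNr.
Qed.

Let w (x : R3 R) : R := expR (2 * u x).
Let iw : domega.-integrable S2 (EFin \o w) := exp_integrable iu wV.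

Let icw (g : R3 R -> R) : (forall x, S2 x -> {for x, continuous g}) ->
  domega.-integrable S2 (EFin \o (fun x => g x * w x)).
Proof.
move=> cg; apply: (eq_integrable measurable_S2 _ _ _ (integrable_continuousM iw cg)).
by move=> x _; rewrite /= mulrC.
Qed.

(** Twice the factor 3/2 of [log_factor] produces ell^-3. Two powers remain as the Jacobian, and by
    [ell_act] the third is [ell (linv L)] at the image point, an affine function of that point. *)
Let exp_ut (x : R3 R) : S2 x ->
  expR (2 * ut x) = expR (2 * c) * (w (act L x) * ell (linv L) (act L x) * (ell L x) ^- 2).
Proof.
move=> Sx; have g0 := ell_gt0 hL Sx; rewrite ell_act//.
rewrite /ut /log_factor (_ : 2 * _ = 2 * c + 2 * u (act L x) + - (3%:R * ln (ell L x))); last by field.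
have e3 : expR (3%:R * ln (ell L x)) = ell L x ^+ 3 by rewrite expRM_natl lnK.
rewrite !expRD expRN e3 -/(w _).
by move: (w _) (expR _) => a b; field; rewrite gt_eqF.
Qed.

Let moment (g h : R3 R -> R) : (forall x, S2 x -> {for x, continuous h}) ->
  (forall x, S2 x -> g x * ell (linv L) (act L x) = h (act L x)) ->
  \int[domega]_(x in S2) (g x * expR (2 * ut x)) = expR (2 * c) * \int[domega]_(x in S2) (h x * w x).
Proof.
move=> ch gh; have i := icw ch.
rewrite -(change_var hL i) -(RintegralZl _ measurable_S2 (change_var_integrable hL i)).
congr fine; apply: eq_integral => x /set_mem Sx; congr EFin.
by rewrite exp_ut// -gh//; ring.
Qed.

Lemma transform_log :
  (\int[domega]_(x in S2) expR (2 * ut x)) ^+ 2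
      - ((\int[domega]_(x in S2) (x.1.1 * expR (2 * ut x))) ^+ 2
       + (\int[domega]_(x in S2) (x.1.2 * expR (2 * ut x))) ^+ 2
       + (\int[domega]_(x in S2) (x.2 * expR (2 * ut x))) ^+ 2) =
  expR (4 * c) * ((\int[domega]_(x in S2) w x) ^+ 2
      - ((\int[domega]_(x in S2) (x.1.1 * w x)) ^+ 2
       + (\int[domega]_(x in S2) (x.1.2 * w x)) ^+ 2
       + (\int[domega]_(x in S2) (x.2 * w x)) ^+ 2)).
Proof.
have hLi := is_lorentz_inv hL.
have i1 := icw (fun x _ => C1_cont (C1_x1 x)).
have i2 := icw (fun x _ => C1_cont (C1_x2 x)).
have i3 := icw (fun x _ => C1_cont (C1_x3 x)).
set A0 := \int[domega]_(x in S2) w x.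
set A1 := \int[domega]_(x in S2) (x.1.1 * w x).
set A2 := \int[domega]_(x in S2) (x.1.2 * w x).
set A3 := \int[domega]_(x in S2) (x.2 * w x).
have lin (b : R) (l : R3 R) : \int[domega]_(x in S2) ((b + dot l x) * w x) =
    b * A0 + l.1.1 * A1 + l.1.2 * A2 + l.2 * A3.
  have j0 := integrableZl measurable_S2 b iw.
  have j1 := integrableZl measurable_S2 l.1.1 i1.
  have j2 := integrableZl measurable_S2 l.1.2 i2.
  have j3 := integrableZl measurable_S2 l.2 i3.
  have j01 := integrableD measurable_S2 j0 j1.
  have j012 := integrableD measurable_S2 j01 j2.
  rewrite -(RintegralZl _ measurable_S2 iw) -(RintegralZl _ measurable_S2 i1).
  rewrite -(RintegralZl _ measurable_S2 i2) -(RintegralZl _ measurable_S2 i3).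
  rewrite -(RintegralD measurable_S2 j0 j1) -(RintegralD measurable_S2 j01 j2) -(RintegralD measurable_S2 j012 j3).
  by congr fine; apply: eq_integral => x _; rewrite dotE; congr EFin; ring.
have caff (b : R) (l x : R3 R) : {for x, continuous (fun x => b + dot l x)}.
  by apply: C1_cont; exact: (C1D (C1_cst _ _) (C1_dot l x)).
have K := linvK L.
have E0 : \int[domega]_(x in S2) expR (2 * ut x) = expR (2 * c) * (la (linv L) * A0 +
    (ll (linv L)).1.1 * A1 + (ll (linv L)).1.2 * A2 + (ll (linv L)).2 * A3).
  rewrite -lin -(moment (g := fun=> 1) (h := fun x => la (linv L) + dot (ll (linv L)) x)).
  - by congr fine; apply: eq_integral => x _; rewrite mul1r.
  - by move=> x _; exact: caff.
  - by move=> x _; rewrite mul1r.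
(* For a coordinate g the product in the premise is a component of L^-1 (1, y), hence affine in
   y. *)
have comp (g : R3 R -> R) (b : R) (m : R3 R) :
    (forall y, S2 y -> g (act (linv L) y) * ell (linv L) y = b + dot m y) ->
    \int[domega]_(x in S2) (g x * expR (2 * ut x)) =
    expR (2 * c) * (b * A0 + m.1.1 * A1 + m.1.2 * A2 + m.2 * A3).
  move=> h; rewrite -lin (moment (h := fun x => b + dot m x))//.
  by move=> x Sx; rewrite -h; [rewrite actK|exact: act_S2].
have act1 (y : R3 R) (a b : R) : S2 y -> a = b / ell (linv L) y -> a * ell (linv L) y = b.
  by move=> Sy ->; rewrite divfK// gt_eqF//; exact: ell_gt0.
rewrite E0.
rewrite (comp (fun x => x.1.1) (lN (linv L)).1.1 (m1 (linv L))); last by move=> y Sy; exact: act1.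
rewrite (comp (fun x => x.1.2) (lN (linv L)).1.2 (m2 (linv L))); last by move=> y Sy; exact: act1.
rewrite (comp (fun x => x.2) (lN (linv L)).2 (m3 (linv L))); last by move=> y Sy; exact: act1.
rewrite (_ : 4 * c = 2 * c + 2 * c); last by ring.
rewrite expRD; move: (expR (2 * c)) => E.
move: (A0) (A1) (A2) (A3) => a0 a1 a2 a3.
move: (linv L) hLi => M hM; have := lorentz_cols hM; case: M {hM} => [a l n p q r] /=.
rewrite dotE => -[h [h1 h2 h3] [h11 h22 h33] [h12 h13 h23]].
(* Collects the form by monomials in the old moments; the coefficients are entries of M^T eta M with
   M = [linv L], which the column relations evaluate. *)
transitivity (E * E * (a0 ^+ 2 * (a ^+ 2 - (n.1.1 * n.1.1 + n.1.2 * n.1.2 + n.2 * n.2)) +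
  2 * a0 * (a1 * (a * l.1.1 - (n.1.1 * p.1.1 + n.1.2 * q.1.1 + n.2 * r.1.1)) +
    a2 * (a * l.1.2 - (n.1.1 * p.1.2 + n.1.2 * q.1.2 + n.2 * r.1.2)) +
    a3 * (a * l.2 - (n.1.1 * p.2 + n.1.2 * q.2 + n.2 * r.2))) +
  a1 ^+ 2 * (l.1.1 * l.1.1 - (p.1.1 * p.1.1 + q.1.1 * q.1.1 + r.1.1 * r.1.1)) +
  a2 ^+ 2 * (l.1.2 * l.1.2 - (p.1.2 * p.1.2 + q.1.2 * q.1.2 + r.1.2 * r.1.2)) +
  a3 ^+ 2 * (l.2 * l.2 - (p.2 * p.2 + q.2 * q.2 + r.2 * r.2)) +
  2 * (a1 * a2 * (l.1.1 * l.1.2 - (p.1.1 * p.1.2 + q.1.1 * q.1.2 + r.1.1 * r.1.2)) +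
    a1 * a3 * (l.1.1 * l.2 - (p.1.1 * p.2 + q.1.1 * q.2 + r.1.1 * r.2)) +
    a2 * a3 * (l.1.2 * l.2 - (p.1.2 * p.2 + q.1.2 * q.2 + r.1.2 * r.2))))).
  by ring.
by rewrite h h1 h2 h3 h11 h22 h33 h12 h13 h23; ring.
Qed.

End Transform.

End Invariance.

Theorem lemma4p2 (R : realType) (tau : R3 R -> R3 R) (u : R3 R -> R)
    (htau : conformal tau) (hu : H1 u) :
  H1 (conf_transform tau u) /\ I23 (conf_transform tau u) = I23 u.
Proof.
have [L hL tauE] := conformal_lorentz htau.
have [mu iu2 [V wV]] := hu.
set c := c_conf tau.
have utE x : S2 x -> conf_transform tau u x = u (act L x) + log_factor L c x.
  move=> Sx; rewrite /conf_transform /psi_conf (area_distortionE hL tauE Sx) tauE//.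
  have g0 := ell_gt0 hL Sx.
  rewrite /log_factor lnV ?posrE ?exprn_gt0// lnXn// -mulr_natl; congr (_ + (_ + _)).
  by move: (ln _) => l; field.
move: (conf_transform tau u) c utE => ut c utE.
have [m i _] := transform_H1 c hL mu iu2 wV.
(* Besides giving membership in [H1], an explicit weak gradient lets [gradient_energy] replace the
   one chosen by [xget] in [I23]. *)
have hT := eq_weak_gradient (fun x Sx => esym (utE x Sx)) (transform_weak c hL mu iu2 wV).
split.
  split.
  - by apply: eq_measurable_fun m => x /set_mem Sx; rewrite utE.
  - by apply: (eq_integrable measurable_S2 _ _ _ i) => x /set_mem Sx /=; rewrite utE.
  - by eexists; exact: hT.
have utI (g : R3 R -> R -> R) : \int[domega]_(x in S2) g x (ut x) =
    \int[domega]_(x in S2) g x (u (act L x) + log_factor L c x).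
  by apply: eq_Rintegral => x /set_mem Sx; rewrite utE.
rewrite !I23E (gradient_energy hT) (gradient_energy wV).
rewrite (utI (fun _ t => t)) (utI (fun _ t => expR (2 * t))) (utI (fun x t => x.1.1 * expR (2 * t))).
rewrite (utI (fun x t => x.1.2 * expR (2 * t))) (utI (fun x t => x.2 * expR (2 * t))).
rewrite (transform_energy hL mu iu2 wV) (transform_mean c hL mu iu2).
rewrite (transform_log c hL mu iu2 wV).
have D0 := exp_moments (exp_integrable (L2_L1 mu iu2) wV) (fun x => expR_gt0 _).
(* The balance: 2/3 * 3 = 2 exchanges the mean of u o act for that of u, 2/3 * 9/2 = 2 * 3/2 cancels
   the mean of ln ell, and 2c cancels half of 4c. *)
by rewrite lnM ?posrE ?expR_gt0// expRK; field.
Qed.
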